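(* Let $H$ be an underspread Hilbert-Schmidt operator on $\mathbf{L}^2(\mathbb{R})$: its spreading function $\eta_H$ satisfies $\operatorname{supp}(\eta_H)\subseteq[-t_0,t_0]\times[-\xi_0,\xi_0]$ with $t_0\xi_0<1/4$. (a) For $(b_0,\nu_0)$ such that $1/b_0>2\xi_0$ and $1/\nu_0>2t_0$, it is possible to find a Gabor frame $\{g_{mn}=M_{n\nu_0}T_{mb_0}g,\ m,n\in\mathbb{Z}\}$ with lattice constants $(b_0,\nu_0)$, and dual window $h$, where $g,h\in S_0(\mathbb{R})$. (b) Let $b_0,\nu_0,g,h$ be as in (a), let $\mathcal{U}(b,\nu)=\sum_{k,\ell\in\mathbb{Z}}|\mathcal{V}_gh(b+k/\nu_0,\nu+\ell/b_0)|^2$ and $\square=[0,\nu_0^{-1}[\times[0,b_0^{-1}[$, and assume that there are constants $0<A\le B<\infty$ with $A\le\mathcal{U}\le B$ a.e. on $\square$. Then the symplectic Fourier transform $\mathcal{M}$ of the time-frequency transfer function of the best Gabor multiplier approximation of $H$ (in Hilbert-Schmidt sense, with windows $g,h$ and lattice constants $b_0,\nu_0$) takes the form $$\mathcal{M}=\frac{\eta_H\,\overline{\mathcal{V}_gh}}{\mathcal{U}},$$ and the approximation error can be bounded by $$\left\|\eta_H-\mathcal{M}\,\mathcal{V}_gh\right\|^2\le\|\eta_H\|^2\ \mathop{\mathrm{ess\,sup}}_{(b,\nu)\in\square}\left[1-\frac{|\mathcal{V}_gh(b,\nu)|^2}{\mathcal{U}(b,\nu)}\right],$$ where $\|\cdot\|$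 is the norm of $\mathbf{L}^2(\mathbb{R}^2)$.
   Context: Notation: $T_bf(t)=f(t-b)$, $M_\nu f(t)=e^{2i\pi\nu t}f(t)$, $\pi(b,\nu)=M_\nu T_b$, $\mathcal{V}_gf(b,\nu)=\langle f,\pi(b,\nu)g\rangle$ (antilinear in the second slot). $S_0(\mathbb{R})=\{f\in\mathbf{L}^2(\mathbb{R}):\|\mathcal{V}_\varphi f\|_{\mathbf{L}^1(\mathbb{R}^2)}<\infty\}$ ($\varphi\neq0$ a fixed Schwartz function). A dual window $h$ of $g$ satisfies $f=\sum_{m,n}\langle f,g_{mn}\rangle\,\pi(mb_0,n\nu_0)h$ for all $f\in\mathbf{L}^2(\mathbb{R})$. Gabor multiplier: $\mathbb{M}^G_{\mathbf{m};g,h}f=\sum_{m,n\in\mathbb{Z}}\mathbf{m}(m,n)\mathcal{V}_gf(mb_0,n\nu_0)\,\pi(mb_0,n\nu_0)h$. The symplectic Fourier transform of the transfer function $\mathbf{m}$ is the $(\nu_0^{-1},b_0^{-1})$-periodic function $\mathcal{M}(t,\xi)=\sum_{m,n}\mathbf{m}(m,n)e^{2i\pi(n\nu_0t-mb_0\xi)}$; the spreading function of $\mathbb{M}^G_{\mathbf{m};g,h}$ is $\mathcal{M}\,\mathcal{V}_gh$. The spreading function of a Hilbert-Schmidt operator with integral kernel $\kappa_H$ is $\eta_H(b,\nu)=\int\kappa_H(t,t-b)e^{-2i\pi\nu t}dt\in\mathbf{L}^2(\mathbb{R}^2)$; $H\mapsto\eta_H$ is isometric for the Hilbert-Schmidt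 norm.
   Formalization: In (a) the condition b_0ν_0<1 is added, since otherwise no Gabor frame with windows in S_0 exists (density and Balian–Low theorems); in (b) the formula for the periodic function M is stated on the period centred at the origin, which contains supp η_H. *)

(* Defs.v *)
From HB Require Import structures.
From mathcomp Require Import all_boot all_order all_algebra.
From mathcomp Require Import finmap complex.
From mathcomp Require Import all_classical all_reals all_analysis ess_sup_inf.
From mathcomp.analysis.showcase Require Import summability.

Set Implicit Arguments.
Unset Strict Implicit.
Unset Printing Implicit Defensive.

Import Order.TTheory GRing.Theory Num.Theory.
Import numFieldNormedType.Exports.
Import Normc.

Local Open Scope classical_set_scope.
Local Open Scope ring_scope.
Local Open Scope complex_scope.

Notation line R := (measurableTypeR R).
Notation plane R := (measurableTypeR R * measurableTypeR R)%type.
Notation mu1 R := (@lebesgue_measure R).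
Notation mu2 R := (product_measure1 (@lebesgue_measure R) (@lebesgue_measure R)).

Section ComplexFunctions.
Context {R : realType} {d : measure_display} {T : measurableType d}.
Implicit Types (mu : {measure set T -> \bar R}) (f : T -> R[i]).

Definition cmeasurable f : Prop :=
  measurable_fun [set: T] (fun x => complex.Re (f x)) /\
  measurable_fun [set: T] (fun x => complex.Im (f x)).

Definition cintegral mu (D : set T) f : R[i] :=
  (\int[mu]_(x in D) complex.Re (f x)) +i* (\int[mu]_(x in D) complex.Im (f x)).

Definition cLnorm mu (p : \bar R) f : \bar R :=
  'N[mu]_p[EFin \o (@normc R \o f)]%E.

Definition L2norm mu f : \bar R := cLnorm mu 2%:E f.

Definition L2 mu f : Prop := cmeasurable f /\ (L2norm mu f < +oo)%E.

Definition inner mu f g : R[i] := cintegral mu [set: T] (fun x => f x * (g x)^*).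

(* Unconditional convergence in L^2(mu): the net of the partial sums over the
   finite subsets of I, ordered by inclusion, converges to f. *)
Definition L2_sum mu (I : choiceType) (u : I -> T -> R[i]) f : Prop :=
  (fun A : {fset I} => L2norm mu (fun x => f x - \sum_(i <- A) u i x))
    @ totally --> 0%E.

End ComplexFunctions.

Section TimeFrequency.
Context {R : realType}.
Implicit Types (f g h phi : line R -> R[i]) (x : plane R) (k : int * int).
Implicit Types (b nu : R) (m : int * int -> R[i]).
Implicit Types (kappa eta M : plane R -> R[i]).

(* e^{2 i pi s} *)
Definition cexp2pi (s : R) : R[i] := cos (2 * pi * s) +i* sin (2 * pi * s).

Definition translation (b : R) f : line R -> R[i] := fun t => f (t - b).

Definition modulation (nu : R) f : line R -> R[i] :=
  fun t => cexp2pi (nu * t) * f t.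

Definition tfshift x f : line R -> R[i] := modulation x.2 (translation x.1 f).

(* [STFT g f] is V_g f: the window is the first argument. *)
Definition STFT g f : plane R -> R[i] :=
  fun x => inner (mu1 R) f (tfshift x g).

Definition real_schwartz (f : R -> R) : Prop :=
  (forall (n : nat) (t : R), derivable (derive1n n f) t 1) /\
  (forall j n : nat, exists C : R, forall t : R,
     `|t ^+ j * derive1n n f t| <= C).

Definition schwartz phi : Prop :=
  real_schwartz (fun t => complex.Re (phi t)) /\ real_schwartz (fun t => complex.Im (phi t)).

Definition S0 phi f : Prop :=
  L2 (mu1 R) f /\ (cLnorm (mu2 R) 1 (STFT phi f) < +oo)%E.

Definition lattice (b0 nu0 : R) k : plane R := (k.1%:~R * b0, k.2%:~R * nu0).

Definition gabor_frame (b0 nu0 : R) g : Prop :=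
  L2 (mu1 R) g /\
  exists A B : R, 0 < A /\
    forall f, L2 (mu1 R) f ->
      let S := (\esum_(k in [set: int * int])
        ((normc (inner (mu1 R) f (tfshift (lattice b0 nu0 k) g))) ^+ 2)%:E)%E in
      (A%:E * L2norm (mu1 R) f ^+ 2 <= S /\
       S <= B%:E * L2norm (mu1 R) f ^+ 2)%E.

Definition dual_window (b0 nu0 : R) g h : Prop :=
  L2 (mu1 R) h /\
  forall f, L2 (mu1 R) f ->
    L2_sum (mu1 R)
      (fun k t => inner (mu1 R) f (tfshift (lattice b0 nu0 k) g) *
                  tfshift (lattice b0 nu0 k) h t) f.

(* An operator on L^2(R) acts on representatives; only its values on
   square-integrable functions, up to a.e. equality, are relevant below. *)
Definition operator := (line R -> R[i]) -> (line R -> R[i]).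

(* The Hilbert-Schmidt operators on L^2(R) are the integral operators with
   kernel in L^2(R^2). *)
Definition HS_kernel (H : operator) kappa : Prop :=
  L2 (mu2 R) kappa /\
  forall f, L2 (mu1 R) f ->
    {ae mu1 R, forall t,
      H f t = cintegral (mu1 R) [set: line R] (fun s => kappa (t, s) * f s)}.

(* The L^2(R^2) norm of the kernel, which is unique up to a.e. equality; +oo
   for an operator that is not Hilbert-Schmidt. *)
Definition HS_norm (H : operator) : \bar R :=
  ereal_inf [set L2norm (mu2 R) kappa | kappa in HS_kernel H].

(* For kappa in L^2(R^2) the integral of kappa(t, t - b) e^{-2 i pi nu t} over
   t in R need not converge absolutely: it is the L^2 Fourier transform in t,
   i.e. the limit in L^2(R^2) of the integrals over [-N, N]. *)
Definition spreading_function kappa eta : Prop :=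
  L2 (mu2 R) eta /\
  (fun N : nat => L2norm (mu2 R) (fun x => eta x -
     cintegral (mu1 R) `[- N%:R, N%:R]
       (fun t => kappa (t, t - x.1) * cexp2pi (- (x.2 * t)))))
    @ \oo --> 0%E.

Definition l2 m : Prop :=
  (\esum_(k in [set: int * int]) ((normc (m k)) ^+ 2)%:E < +oo)%E.

Definition gabor_multiplier (b0 nu0 : R) g h m (G : operator) : Prop :=
  forall f, L2 (mu1 R) f ->
    L2 (mu1 R) (G f) /\
    L2_sum (mu1 R)
      (fun k t => m k * STFT g f (lattice b0 nu0 k) *
                  tfshift (lattice b0 nu0 k) h t) (G f).

Definition best_gabor_multiplier (b0 nu0 : R) g h (H : operator) m : Prop :=
  l2 m /\
  exists G, gabor_multiplier b0 nu0 g h m G /\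
    forall m' G', l2 m' -> gabor_multiplier b0 nu0 g h m' G' ->
      (HS_norm (fun f t => (H f t - G f t)%R) <=
       HS_norm (fun f t => (H f t - G' f t)%R))%E.

Definition period_box (b0 nu0 : R) : set (plane R) :=
  `[0, nu0^-1[ `*` `[0, b0^-1[.

(* The period containing [-t0, t0] x [-xi0, xi0] when 2 t0 < 1/nu0 and
   2 xi0 < 1/b0: a function periodic with respect to period_box agrees with a
   formula involving a function supported in that rectangle only on this
   period, the formula being then extended by periodicity. *)
Definition centered_box (b0 nu0 : R) : set (plane R) :=
  `[- (nu0^-1 / 2), nu0^-1 / 2[ `*` `[- (b0^-1 / 2), b0^-1 / 2[.

Lemma measurable_period_box (b0 nu0 : R) : measurable (period_box b0 nu0).
Proof. by apply: measurableX; exact: measurable_itv. Qed.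

Lemma measurable_centered_box (b0 nu0 : R) : measurable (centered_box b0 nu0).
Proof. by apply: measurableX; exact: measurable_itv. Qed.

(* The (1/nu0, 1/b0)-periodic function with symplectic Fourier coefficients m;
   for m in l^2 the series converges in L^2 of a period. *)
Definition symplectic_FT (b0 nu0 : R) m M : Prop :=
  [/\ cmeasurable M,
      forall x k, M (x.1 + k.1%:~R / nu0, x.2 + k.2%:~R / b0) = M x
    & L2_sum (mrestr (mu2 R) (measurable_period_box b0 nu0))
        (fun k x => m k * cexp2pi (k.2%:~R * nu0 * x.1 - k.1%:~R * b0 * x.2))
        M].

(* Valued in \bar R, as no summability is assumed a priori. *)
Definition Ufun (b0 nu0 : R) g h x : \bar R :=
  (\esum_(k in [set: int * int])
    ((normc (STFT g h (x.1 + k.1%:~R / nu0, x.2 + k.2%:~R / b0))) ^+ 2)%:E)%E.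

Definition defect (b0 nu0 : R) g h x : \bar R :=
  (1 - (normc (STFT g h x)) ^+ 2 / fine (Ufun b0 nu0 g h x))%:E.

End TimeFrequency.

(* Main.v *)
Require Import Defs.
From HB Require Import structures.
From mathcomp Require Import all_boot all_order all_algebra.
From mathcomp Require Import finmap complex.
From mathcomp Require Import all_classical all_reals all_analysis ess_sup_inf.
From mathcomp Require Import measurable_realfun.
From mathcomp Require Import zify ring lra.
From mathcomp.analysis.showcase Require Import summability.

(** Everything rests on two isometries. Parseval's identity for Fourier series,
    itself a consequence of the totality of the characters of a period
    ([echar_total]), gives Plancherel's identity for compactly supported
    functions ([plancherel_compact]); applied to the lines t - s = b of a kernel
    it shows that an operator and its spreading function have the same norm
    ([spreading_isometry]). For rank-one kernels this is Moyal's identity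
    ([moyal]).

    Best approximation. The rank-one kernel attached to a lattice point has
    spreading function V times a character of the torus, where V = V_g h, so a
    Gabor multiplier with symbol m has spreading function M V, M being the
    periodic function with Fourier coefficients m. The bound U <= B makes the
    kernel series converge for every square-summable m ([atoms_synthesis]), and
    the Hilbert-Schmidt distance to H becomes the norm of eta - M V
    ([gabor_distance]). Folding that norm over the lattice of periods onto the
    centered period C, where only the unshifted term meets eta, and completing
    the square in M gives ([error_split])

      |eta - M V|^2 = int_C |eta|^2 (1 - |V|^2 / U)
                      + int_C U |M - eta conj(V) / U|^2.

    The first term does not depend on M, and U >= A > 0, so the unique minimizer
    is M = eta conj(V) / U on C: its Fourier coefficients are square summable
    ([ell2_best_symbol]) and form the unique best symbol ([best_unique],
    [best_symbol_best]). What remains is the first term, which is at most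
    |eta|^2 times the essential supremum of the relative loss
    1 - |V|^2 / U over C ([error_le_ess_sup]).

    The loss is not periodic, so the bound over the period [0, 1/nu0[ x
    [0, 1/b0[ needs another reason. Integrating the reconstruction formula,
    shifted over the plane, against a character of the torus shows that V
    vanishes at the nonzero points of the adjoint lattice ([wexler_raz]). One of
    them, (1/nu0, 0), is a corner of this period; V is continuous
    ([STFT_continuous]) and U >= A, so the essential supremum there is 1
    ([ess_sup_defect_ge1]), and the error is at most |eta|^2 because the loss
    never exceeds 1.

    Existence of windows. When b0 nu0 < 1 one can choose a window w in an
    interval of length at most 1/nu0 whose translates by b0 satisfy
    sum_m w(t - m b0)^2 = 1: a product of a rising and a falling profile sin and
    cos of one angle ([tight_window_sum]). Parseval on each translate then yields
    a tight frame ([tight_frame]) with dual window nu0 w ([window_dual]). The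
    profile is a spline with two continuous derivatives, so two integrations by
    parts bound V_phi w by a product of Cauchy weights in the two variables
    ([oscillatory_decay]), which is integrable ([window_STFT_integrable]). *)

Set Implicit Arguments.
Unset Strict Implicit.
Unset Printing Implicit Defensive.

Import Order.TTheory GRing.Theory Num.Theory.
Import numFieldNormedType.Exports.
Import Normc.

Local Open Scope classical_set_scope.
Local Open Scope complex_scope.
Local Open Scope ring_scope.

(** * Square-integrable complex functions *)

Section SquaredModulus.
Context {R : realType}.
Implicit Types (z w : R[i]).

Definition sqn z : R := complex.Re z ^+ 2 + complex.Im z ^+ 2.

Lemma sqn_normc z : normc z ^+ 2 = sqn z.
Proof.
by case: z => a b; rewrite /sqn /= sqr_sqrtr// addr_ge0// sqr_ge0.
Qed.

Lemma sqn_ge0 z : 0 <= sqn z. Proof. by rewrite addr_ge0// sqr_ge0. Qed.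

Lemma sqn0 : sqn 0 = 0. Proof. by rewrite /sqn /= expr0n /= addr0. Qed.

Lemma sqn_eq0 z : sqn z = 0 -> z = 0.
Proof.
case: z => a b /eqP; rewrite paddr_eq0 ?sqr_ge0// !sqrf_eq0 /=.
by move=> /andP[/eqP-> /eqP->].
Qed.

Lemma sqnM z w : sqn (z * w) = sqn z * sqn w.
Proof. by case: z => a b; case: w => c e; rewrite /sqn /=; ring. Qed.

Lemma sqnN z : sqn (- z) = sqn z.
Proof. by case: z => a b; rewrite /sqn /=; ring. Qed.

Lemma sqnBC z w : sqn (z - w) = sqn (w - z).
Proof. by rewrite -sqnN opprB. Qed.

Lemma sqn_conj z : sqn z^* = sqn z.
Proof. by case: z => a b; rewrite /sqn /=; ring. Qed.

Lemma sqnR (x : R) : sqn x%:C = x ^+ 2.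
Proof. by rewrite /sqn /= expr0n addr0. Qed.

Lemma mulJ_sqn z : z * z^* = (sqn z)%:C.
Proof. by case: z => a b; rewrite /sqn; apply/eqP; rewrite eq_complex /=; apply/andP; split; apply/eqP; ring. Qed.

Lemma sqnB z w : sqn (z - w) = sqn z + sqn w - 2 * complex.Re (z * w^*).
Proof. by case: z => a b; case: w => c e; rewrite /sqn /=; ring. Qed.

Lemma sqnD z w : sqn (z + w) = sqn z + sqn w + 2 * complex.Re (z * w^*).
Proof. by case: z => a b; case: w => c e; rewrite /sqn /=; ring. Qed.

(** The interpolation between the two squared moduli stands in for the
    triangle inequality: letting [e] tend to [0] gives continuity of squared
    norms without square roots. *)
Lemma sqnD_le e z w : 0 < e ->
  sqn (z + w) <= (1 + e) * sqn z + (1 + e^-1) * sqn w.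
Proof.
move=> e0; have := sqn_ge0 (e%:C * z - w); rewrite sqnB sqnM sqnR sqnD => h.
have hR : complex.Re (e%:C * z * w^*) = e * complex.Re (z * w^*).
  by case: (z) => a b; case: (w) => c f /=; ring.
rewrite hR in h.
have : 0 <= e^-1 * (e ^+ 2 * sqn z + sqn w - 2 * (e * complex.Re (z * w^*))).
  by rewrite mulr_ge0// invr_ge0 ltW.
rewrite (_ : e^-1 * _ = e * sqn z + e^-1 * sqn w - 2 * complex.Re (z * w^*)); last first.
  by field; rewrite gt_eqF.
by lra.
Qed.

Lemma normr_Re_mul z w : `|complex.Re (z * w^*)| <= sqn z + sqn w.
Proof.
rewrite ler_norml; have := sqn_ge0 (z - w); have := sqn_ge0 (z + w).
rewrite sqnB sqnD; have := sqn_ge0 z; have := sqn_ge0 w.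
by move=> *; apply/andP; split; lra.
Qed.

Lemma normr_Im_mul z w : `|complex.Im (z * w^*)| <= sqn z + sqn w.
Proof.
have := normr_Re_mul z (w * 'i%C).
rewrite sqnM (_ : sqn 'i%C = 1) ?mulr1; last by rewrite /sqn /=; ring.
by move=> h; rewrite (le_trans _ h)//; case: (z) => a b; case: (w) => c e /=;
   rewrite (_ : a * (c * 0 - e * 1) - b * - (c * 1 + e * 0) = a * - e + b * c)//; ring.
Qed.

Lemma Re_sqn z : `|complex.Re z| ^+ 2 <= sqn z.
Proof. by rewrite real_normK ?num_real// lerDl sqr_ge0. Qed.
Lemma Im_sqn z : `|complex.Im z| ^+ 2 <= sqn z.
Proof. by rewrite real_normK ?num_real// lerDr sqr_ge0. Qed.

Lemma cReD z w : complex.Re (z + w) = complex.Re z + complex.Re w.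
Proof. by case: z; case: w. Qed.
Lemma cImD z w : complex.Im (z + w) = complex.Im z + complex.Im w.
Proof. by case: z; case: w. Qed.
Lemma cReN z : complex.Re (- z) = - complex.Re z. Proof. by case: z. Qed.
Lemma cImN z : complex.Im (- z) = - complex.Im z. Proof. by case: z. Qed.
Lemma cReM z w : complex.Re (z * w) =
  complex.Re z * complex.Re w - complex.Im z * complex.Im w.
Proof. by case: z; case: w. Qed.
Lemma cImM z w : complex.Im (z * w) =
  complex.Re z * complex.Im w + complex.Im z * complex.Re w.
Proof. by case: z; case: w. Qed.
Lemma cReJ z : complex.Re z^* = complex.Re z. Proof. by case: z. Qed.
Lemma cImJ z : complex.Im z^* = - complex.Im z. Proof. by case: z. Qed.
Lemma complex_ext z w : complex.Re z = complex.Re w ->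
  complex.Im z = complex.Im w -> z = w.
Proof. by case: z => a b; case: w => c e /= -> ->. Qed.

Lemma conjD z w : (z + w)^* = z^* + w^*.
Proof. by case: z => a b; case: w => c e; apply: complex_ext => /=; ring. Qed.
Lemma conjB z w : (z - w)^* = z^* - (w^*).
Proof. by case: z => a b; case: w => c e; apply: complex_ext => /=; ring. Qed.
Lemma conjM z w : (z * w)^* = z^* * w^*.
Proof. by case: z => a b; case: w => c e; apply: complex_ext => /=; ring. Qed.

End SquaredModulus.
Arguments sqn : simpl never.

Section CMeasurable.
Context {R : realType} {d : measure_display} {T : measurableType d}.
Implicit Types (f g : T -> R[i]).

Lemma cmeasurableD f g : cmeasurable f -> cmeasurable g ->
  cmeasurable (fun x => f x + g x).
Proof.
move=> [fr fi] [gr gi]; split.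
  by under eq_fun do rewrite cReD; exact: measurable_funD.
by under eq_fun do rewrite cImD; exact: measurable_funD.
Qed.

Lemma cmeasurableN f : cmeasurable f -> cmeasurable (fun x => - f x).
Proof.
move=> [fr fi]; split.
  by under eq_fun do rewrite cReN; exact: measurable_funN.
by under eq_fun do rewrite cImN; exact: measurable_funN.
Qed.

Lemma cmeasurableB f g : cmeasurable f -> cmeasurable g ->
  cmeasurable (fun x => f x - g x).
Proof. by move=> mf /cmeasurableN; exact: cmeasurableD. Qed.

Lemma cmeasurableM f g : cmeasurable f -> cmeasurable g ->
  cmeasurable (fun x => f x * g x).
Proof.
move=> [fr fi] [gr gi]; split.
  by under eq_fun do rewrite cReM; apply: measurable_funB; exact: measurable_funM.
by under eq_fun do rewrite cImM; apply: measurable_funD; exact: measurable_funM.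
Qed.

Lemma cmeasurableJ f : cmeasurable f -> cmeasurable (fun x => (f x)^*).
Proof.
move=> [fr fi]; split; first by under eq_fun do rewrite cReJ.
by under eq_fun do rewrite cImJ; exact: measurable_funN.
Qed.

Lemma cmeasurable_cst (c : R[i]) : cmeasurable (fun _ : T => c).
Proof. by split; exact: measurable_cst. Qed.

Lemma cmeasurable_real (h : T -> R) : measurable_fun setT h ->
  cmeasurable (fun x => (h x)%:C).
Proof. by move=> mh; split => //=; exact: measurable_cst. Qed.

Lemma cmeasurable_sum (I : Type) (s : seq I) (F : I -> T -> R[i]) :
  (forall i, cmeasurable (F i)) -> cmeasurable (fun x => \sum_(i <- s) F i x).
Proof.
move=> mF; elim: s => [|i s ih].
  by under eq_fun do rewrite big_nil; exact: cmeasurable_cst.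
by under eq_fun do rewrite big_cons; exact: cmeasurableD.
Qed.

Lemma measurable_sqn f : cmeasurable f -> measurable_fun setT (fun x => sqn (f x)).
Proof.
by move=> [fr fi]; apply: measurable_funD; exact: measurable_funX.
Qed.

Lemma cmeasurable_comp d' (T' : measurableType d') (h : T' -> T) f :
  cmeasurable f -> measurable_fun setT h -> cmeasurable (fun x => f (h x)).
Proof.
by move=> [fr fi] mh; split; [exact: (measurableT_comp fr)|exact: (measurableT_comp fi)].
Qed.

End CMeasurable.

Section SquaredNorm.
Context {R : realType} {d : measure_display} {T : measurableType d}.
Variable mu : {measure set T -> \bar R}.
Implicit Types (f g h : T -> R[i]).

(** Squared L^2 norms are used throughout: they are integrals of nonnegative
    functions, so that Tonelli's theorem applies to them directly. *)
Definition nsq f : \bar R := (\int[mu]_x (sqn (f x))%:E)%E.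

Lemma nsq_ge0 f : (0 <= nsq f)%E.
Proof. by apply: integral_ge0 => x _; rewrite lee_fin sqn_ge0. Qed.

Lemma L2norm_ge0 f : (0 <= L2norm mu f)%E. Proof. exact: Lnorm_ge0. Qed.

Lemma L2norm_poweR f : (L2norm mu f `^ 2 = nsq f)%E.
Proof.
rewrite /L2norm /cLnorm poweR_Lnorm//.
apply: eq_integral => x _ /=; congr EFin.
rewrite (powR_mulrn 2); last exact: normr_ge0.
by rewrite real_normK ?num_real// sqn_normc.
Qed.

Lemma L2norm_sqr f : (L2norm mu f ^+ 2 = nsq f)%E.
Proof.
rewrite -L2norm_poweR; have := L2norm_ge0 f; case: (L2norm mu f) => //=.
- by move=> r; rewrite lee_fin => r0; rewrite (powR_mulrn 2 r0) -EFinM expr2.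
- by move=> _; rewrite mulyy pnatr_eq0.
Qed.

Lemma L2norm_lty f : (L2norm mu f < +oo)%E = (nsq f < +oo)%E.
Proof.
rewrite -L2norm_sqr; have := L2norm_ge0 f; case: (L2norm mu f) => //= r _.
by rewrite -EFinM !ltry.
Qed.

Lemma L2P f : L2 mu f <-> cmeasurable f /\ (nsq f < +oo)%E.
Proof. by rewrite /L2 L2norm_lty. Qed.

Lemma L2_cmeas f : L2 mu f -> cmeasurable f. Proof. by case. Qed.
Lemma L2_lty f : L2 mu f -> (nsq f < +oo)%E. Proof. by case/L2P. Qed.

Lemma L2norm_cvg0P I (F : set_system I) (FF : Filter F) (f : I -> T -> R[i]) :
  (fun i => L2norm mu (f i)) @ F --> 0%E <->
  (forall e : R, 0 < e -> \forall i \near F, (nsq (f i) < e%:E)%E).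
Proof.
have key i (e : R) : 0 < e -> (L2norm mu (f i) < e%:E)%E = (nsq (f i) < (e ^+ 2)%:E)%E.
  move=> e0; rewrite -L2norm_sqr; have := L2norm_ge0 (f i).
  case: (L2norm mu (f i)) => //= r; rewrite lee_fin => r0.
  by rewrite -EFinM -expr2 !lte_fin ltr_pXn2r// nnegrE ltW.
split.
- move=> /fine_cvgP[hfin hcvg] e e0.
  have /cvgrPdist_lt /(_ (Num.sqrt e)) := hcvg; rewrite sqrtr_gt0 => /(_ e0) h.
  near=> i.
  rewrite -(sqr_sqrtr (ltW e0)) -key ?sqrtr_gt0//.
  have fi : L2norm mu (f i) \is a fin_num by near: i.
  rewrite -(fineK fi) lte_fin.
  have : `|0 - fine (L2norm mu (f i))| < Num.sqrt e by near: i.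
  by rewrite sub0r normrN ger0_norm// fine_ge0// L2norm_ge0.
- move=> h; apply/fine_cvgP; split.
    near=> i; rewrite ge0_fin_numE ?L2norm_ge0//.
    rewrite (@lt_trans _ _ 1%:E) ?ltry// key//.
    by near: i; apply: h; rewrite exprn_gt0.
  apply/cvgrPdist_lt => e e0; near=> i.
  have hi : (L2norm mu (f i) < e%:E)%E.
    by rewrite key//; near: i; apply: h; rewrite exprn_gt0.
  rewrite /= sub0r normrN ger0_norm ?fine_ge0 ?L2norm_ge0//.
  rewrite -lte_fin fineK// ge0_fin_numE ?L2norm_ge0//.
  by rewrite (lt_trans hi)// ltry.
Unshelve. all: by end_near. Qed.

Lemma measurable_sqnE f : cmeasurable f ->
  measurable_fun setT (fun x => (sqn (f x))%:E).
Proof. by move=> mf; apply/measurable_EFinP; exact: measurable_sqn. Qed.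

Lemma nsqD_le (e : R) f g : 0 < e -> cmeasurable f -> cmeasurable g ->
  (nsq (fun x => (f x + g x)%R) <= (1 + e)%:E * nsq f + (1 + e^-1)%:E * nsq g)%E.
Proof.
move=> e0 mf mg.
have e1 : 0 <= 1 + e by rewrite addr_ge0// ltW.
have e2 : 0 <= 1 + e^-1 by rewrite addr_ge0// invr_ge0 ltW.
rewrite /nsq -!ge0_integralZl//; [|exact: measurable_sqnE|
  by move=> x _; rewrite lee_fin sqn_ge0|exact: measurable_sqnE|
  by move=> x _; rewrite lee_fin sqn_ge0].
rewrite -ge0_integralD//; last 4 first.
- by move=> x _; rewrite -EFinM lee_fin mulr_ge0// sqn_ge0.
- by apply: measurable_funeM; exact: measurable_sqnE.
- by move=> x _; rewrite -EFinM lee_fin mulr_ge0// sqn_ge0.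
- by apply: measurable_funeM; exact: measurable_sqnE.
apply: ge0_le_integral => //.
- by move=> x _; rewrite lee_fin sqn_ge0.
- by apply: measurable_sqnE; exact: cmeasurableD.
- by apply: emeasurable_funD; apply: measurable_funeM; exact: measurable_sqnE.
by move=> x _; rewrite -!EFinM -EFinD lee_fin sqnD_le.
Qed.

Lemma nsqD_le2 f g : cmeasurable f -> cmeasurable g ->
  (nsq (fun x => (f x + g x)%R) <= 2%:E * nsq f + 2%:E * nsq g)%E.
Proof.
move=> mf mg; have := nsqD_le (ltr01 : 0 < 1 :> R) mf mg.
by rewrite invr1 (_ : 1 + 1 = 2 :> R).
Qed.

Lemma nsqN f : nsq (fun x => - f x) = nsq f.
Proof. by apply: eq_integral => x _; rewrite sqnN. Qed.

Lemma nsqBC f g : nsq (fun x => f x - g x) = nsq (fun x => g x - f x).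
Proof. by apply: eq_integral => x _; rewrite sqnBC. Qed.

Lemma nsqZ (c : R[i]) f : cmeasurable f ->
  nsq (fun x => c * f x) = ((sqn c)%:E * nsq f)%E.
Proof.
move=> mf; rewrite /nsq -ge0_integralZl//.
- by apply: eq_integral => x _; rewrite sqnM.
- exact: measurable_sqnE.
- by move=> x _; rewrite lee_fin sqn_ge0.
- by rewrite lee_fin sqn_ge0.
Qed.

Lemma nsq_eq f g : (forall x, sqn (f x) = sqn (g x)) -> nsq f = nsq g.
Proof. by move=> fg; apply: eq_integral => x _; rewrite fg. Qed.

Lemma le_nsq f g : cmeasurable f -> cmeasurable g ->
  (forall x, sqn (f x) <= sqn (g x)) -> (nsq f <= nsq g)%E.
Proof.
move=> mf mg fg; apply: ge0_le_integral => //; try exact: measurable_sqnE;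
  by move=> x _; rewrite lee_fin ?sqn_ge0 ?fg.
Qed.

Lemma nsq_ae_eq f g : cmeasurable f -> cmeasurable g ->
  {ae mu, forall x, f x = g x} -> nsq f = nsq g.
Proof.
move=> mf mg fg; apply: ge0_ae_eq_integral => //; try exact: measurable_sqnE;
  try by move=> x _; rewrite lee_fin sqn_ge0.
by apply: filterS fg => x -> .
Qed.

Lemma nsq_eq0 f : cmeasurable f -> nsq f = 0%E -> {ae mu, forall x, f x = 0}.
Proof.
move=> mf f0.
have /(ae_eq_integral_abs mu measurableT (measurable_sqnE mf)) h :
  (\int[mu]_x `|(sqn (f x))%:E| = 0)%E.
  by under eq_integral do rewrite gee0_abs ?lee_fin ?sqn_ge0//.
by apply: filterS h => x /(_ Logic.I) [] /sqn_eq0.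
Qed.

Lemma nsq0 : nsq (fun=> 0) = 0%E.
Proof. by rewrite /nsq; under eq_integral do rewrite sqn0; rewrite integral0. Qed.

Lemma nsq_eq0_ae f : cmeasurable f -> {ae mu, forall x, f x = 0} -> nsq f = 0%E.
Proof.
move=> mf f0; rewrite -nsq0; apply: nsq_ae_eq => //; exact: cmeasurable_cst.
Qed.

Lemma L2D f g : L2 mu f -> L2 mu g -> L2 mu (fun x => f x + g x).
Proof.
move=> /L2P[mf ff] /L2P[mg fg]; apply/L2P; split; first exact: cmeasurableD.
rewrite (le_lt_trans (nsqD_le2 mf mg))// lte_add_pinfty// lte_mul_pinfty//.
Qed.

Lemma L2N f : L2 mu f -> L2 mu (fun x => - f x).
Proof.
by move=> /L2P[mf ff]; apply/L2P; rewrite nsqN; split => //; exact: cmeasurableN.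
Qed.

Lemma L2B f g : L2 mu f -> L2 mu g -> L2 mu (fun x => f x - g x).
Proof. by move=> hf /L2N; exact: L2D. Qed.

Lemma L2Z (c : R[i]) f : L2 mu f -> L2 mu (fun x => c * f x).
Proof.
move=> /L2P[mf ff]; apply/L2P; split.
  by apply: cmeasurableM => //; exact: cmeasurable_cst.
by rewrite nsqZ// lte_mul_pinfty// lee_fin sqn_ge0.
Qed.

Lemma L20 : L2 mu (fun _ => 0).
Proof. by apply/L2P; rewrite nsq0; split; [exact: cmeasurable_cst|]. Qed.

Lemma L2_bigsum (I : Type) (s : seq I) (F : I -> T -> R[i]) :
  (forall i, L2 mu (F i)) -> L2 mu (fun x => \sum_(i <- s) F i x).
Proof.
move=> hF; elim: s => [|i s ih].
  by under eq_fun do rewrite big_nil; exact: L20.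
by under eq_fun do rewrite big_cons; exact: L2D.
Qed.

Lemma L2_le f g : cmeasurable f -> L2 mu g ->
  (forall x, sqn (f x) <= sqn (g x)) -> L2 mu f.
Proof.
move=> mf /L2P[mg fg] h; apply/L2P; split => //.
by rewrite (le_lt_trans _ fg)// le_nsq.
Qed.

Lemma L2_fin f : L2 mu f -> nsq f \is a fin_num.
Proof. by move=> /L2_lty; rewrite ge0_fin_numE ?nsq_ge0. Qed.

Lemma L2_close f g : cmeasurable f -> L2 mu g ->
  (nsq (fun x => (f x - g x)%R) < +oo)%E -> L2 mu f.
Proof.
move=> mf hg h; have -> : f = (fun x => (f x - g x) + g x).
  by apply/funext => x; rewrite subrK.
by apply: L2D => //; apply/L2P; split => //; apply: cmeasurableB => //; case: hg.
Qed.

End SquaredNorm.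

Section ComplexIntegral.
Context {R : realType} {d : measure_display} {T : measurableType d}.
Variable mu : {measure set T -> \bar R}.
Implicit Types (f g h : T -> R[i]).

Definition cintegrable f : Prop :=
  mu.-integrable setT (EFin \o (fun x => complex.Re (f x))) /\
  mu.-integrable setT (EFin \o (fun x => complex.Im (f x))).

Local Notation cint f := (cintegral mu [set: T] f).

Lemma cintegralD f g : cintegrable f -> cintegrable g ->
  cint (fun x => f x + g x) = cint f + cint g.
Proof.
move=> [fr fi] [gr gi]; apply: complex_ext => /=.
  by rewrite -RintegralD//; apply: eq_Rintegral => x _; rewrite cReD.
by rewrite -RintegralD//; apply: eq_Rintegral => x _; rewrite cImD.
Qed.

Lemma cintegrableD f g : cintegrable f -> cintegrable g ->
  cintegrable (fun x => f x + g x).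
Proof.
move=> [fr fi] [gr gi]; split.
  by apply: eq_integrable (integrableD _ fr gr) => // x _ /=; rewrite cReD.
by apply: eq_integrable (integrableD _ fi gi) => // x _ /=; rewrite cImD.
Qed.

Lemma cintegrableZ (c : R[i]) f : cintegrable f -> cintegrable (fun x => c * f x).
Proof.
move=> [fr fi]; split.
  apply: eq_integrable (integrableB _ (integrableZl _ (complex.Re c) fr)
    (integrableZl _ (complex.Im c) fi)) => // x _ /=.
  by rewrite (cReM c).
apply: eq_integrable (integrableD _ (integrableZl _ (complex.Re c) fi)
  (integrableZl _ (complex.Im c) fr)) => // x _ /=.
by rewrite (cImM c).
Qed.

Lemma cintegralZ (c : R[i]) f : cintegrable f ->
  cint (fun x => c * f x) = c * cint f.
Proof.
move=> [fr fi]; apply: complex_ext; [rewrite (cReM c)|rewrite (cImM c)] => /=.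
  rewrite -RintegralZl// -RintegralZl// -RintegralB//; last 2 first.
  - exact: integrableZl fr.
  - exact: integrableZl fi.
  by apply: eq_Rintegral => x _; rewrite (cReM c).
rewrite -RintegralZl// -RintegralZl// -RintegralD//; last 2 first.
- exact: integrableZl fi.
- exact: integrableZl fr.
by apply: eq_Rintegral => x _; rewrite (cImM c).
Qed.

Lemma cintegrableN f : cintegrable f -> cintegrable (fun x => - f x).
Proof.
move=> /(cintegrableZ (- 1)); congr cintegrable; apply/funext => x.
by rewrite mulN1r.
Qed.

Lemma cintegralN f : cintegrable f -> cint (fun x => - f x) = - cint f.
Proof.
move=> /(cintegralZ (- 1)); rewrite mulN1r => <-; congr cintegral.
by apply/funext => x; rewrite mulN1r.
Qed.

Lemma cintegralB f g : cintegrable f -> cintegrable g ->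
  cint (fun x => f x - g x) = cint f - cint g.
Proof.
move=> hf hg; rewrite (cintegralD hf (cintegrableN hg)).
by rewrite cintegralN.
Qed.

Lemma cintegralJ f : cintegrable f -> cint (fun x => (f x)^*) = (cint f)^*.
Proof.
move=> [fr fi]; apply: complex_ext; rewrite ?cReJ ?cImJ /=.
  by apply: eq_Rintegral => x _; rewrite cReJ.
rewrite -mulN1r -RintegralZl//; apply: eq_Rintegral => x _.
by rewrite cImJ mulN1r.
Qed.

Lemma cintegrable0 : cintegrable (fun=> 0).
Proof. by split => /=; exact: integrable0. Qed.

Lemma cintegral0 : cint (fun=> 0) = 0.
Proof.
apply: complex_ext => /=; rewrite /Rintegral.
  by rewrite integral0.
by rewrite integral0.
Qed.

Lemma cintegrable_sum (I : Type) (s : seq I) (F : I -> T -> R[i]) :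
  (forall i, cintegrable (F i)) -> cintegrable (fun x => \sum_(i <- s) F i x).
Proof.
move=> hF; elim: s => [|i s ih].
  by under eq_fun do rewrite big_nil; exact: cintegrable0.
by under eq_fun do rewrite big_cons; exact: cintegrableD.
Qed.

Lemma cintegral_sum (I : Type) (s : seq I) (F : I -> T -> R[i]) :
  (forall i, cintegrable (F i)) ->
  cint (fun x => \sum_(i <- s) F i x) = \sum_(i <- s) cint (F i).
Proof.
move=> hF; elim: s => [|i s ih].
  by under eq_fun do rewrite big_nil; rewrite big_nil cintegral0.
under eq_fun do rewrite big_cons.
by rewrite big_cons -ih cintegralD//; exact: cintegrable_sum.
Qed.

Lemma cintegral_ae f g : cmeasurable f -> cmeasurable g ->
  {ae mu, forall x, f x = g x} -> cint f = cint g.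
Proof.
move=> [fr fi] [gr gi] fg; apply: complex_ext => /=; congr fine;
  apply: ae_eq_integral => //; try exact/measurable_EFinP.
  by apply: filterS fg => x ->.
by apply: filterS fg => x ->.
Qed.

End ComplexIntegral.

Section Inner.
Context {R : realType} {d : measure_display} {T : measurableType d}.
Variable mu : {measure set T -> \bar R}.
Implicit Types (f g h : T -> R[i]).

Lemma L2_integrable_sqn f : L2 mu f ->
  mu.-integrable setT (EFin \o (fun x => sqn (f x))).
Proof.
move=> /L2P[mf ff]; apply/integrableP; split; first exact: measurable_sqnE.
by under eq_integral do rewrite gee0_abs ?lee_fin ?sqn_ge0//.
Qed.

Lemma L2_mulJ_integrable f g : L2 mu f -> L2 mu g ->
  cintegrable mu (fun x => f x * (g x)^*).
Proof.
move=> hf hg; have hi := integrableD measurableT (L2_integrable_sqn hf) (L2_integrable_sqn hg).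
have [mr mi] : cmeasurable (fun x => f x * (g x)^*).
  by apply: cmeasurableM; [case: hf|apply: cmeasurableJ; case: hg].
split; apply: le_integrable hi => //; try exact/measurable_EFinP; move=> x _ /=;
  rewrite lee_fin (le_trans _ (ler_norm _))//.
  exact: normr_Re_mul.
exact: normr_Im_mul.
Qed.

(** The squared norm occurs as an extended real, for functions of unknown
    size and monotone convergence, and as a real, for algebra with inner
    products. *)
Definition sqf f : R := fine (nsq mu f).

Lemma sqf_ge0 f : 0 <= sqf f. Proof. by rewrite fine_ge0// nsq_ge0. Qed.

Lemma sqfE f : L2 mu f -> nsq mu f = (sqf f)%:E.
Proof. by move=> /L2_fin hf; rewrite /sqf fineK. Qed.

Lemma inner_ff f : L2 mu f -> inner mu f f = (sqf f)%:C.
Proof.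
move=> hf; apply: complex_ext => /=.
  by congr fine; apply: eq_integral => x _; rewrite mulJ_sqn.
rewrite /Rintegral (_ : (fun x => _) = cst 0%E) ?integral0//.
by apply/funext => x; rewrite mulJ_sqn.
Qed.

Lemma innerJ f g : L2 mu f -> L2 mu g -> (inner mu f g)^* = inner mu g f.
Proof.
move=> hf hg; rewrite -cintegralJ; last exact: L2_mulJ_integrable.
by congr cintegral; apply/funext => x; rewrite conjM conjCK mulrC.
Qed.

Lemma innerDl f g h : L2 mu f -> L2 mu g -> L2 mu h ->
  inner mu (fun x => f x + g x) h = inner mu f h + inner mu g h.
Proof.
move=> hf hg hh; rewrite -cintegralD; try exact: L2_mulJ_integrable.
by congr cintegral; apply/funext => x; rewrite mulrDl.
Qed.

Lemma innerZl (c : R[i]) f h : L2 mu f -> L2 mu h ->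
  inner mu (fun x => c * f x) h = c * inner mu f h.
Proof.
move=> hf hh; rewrite -cintegralZ; last exact: L2_mulJ_integrable.
by congr cintegral; apply/funext => x; rewrite mulrA.
Qed.

Lemma innerBl f g h : L2 mu f -> L2 mu g -> L2 mu h ->
  inner mu (fun x => f x - g x) h = inner mu f h - inner mu g h.
Proof.
move=> hf hg hh; rewrite -cintegralB; try exact: L2_mulJ_integrable.
by congr cintegral; apply/funext => x; rewrite mulrBl.
Qed.

Lemma inner_suml (I : Type) (s : seq I) (F : I -> T -> R[i]) h :
  (forall i, L2 mu (F i)) -> L2 mu h ->
  inner mu (fun x => \sum_(i <- s) F i x) h = \sum_(i <- s) inner mu (F i) h.
Proof.
move=> hF hh; rewrite -cintegral_sum; last by move=> i; exact: L2_mulJ_integrable.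
by congr cintegral; apply/funext => x; rewrite mulr_suml.
Qed.

Lemma innerDr f g h : L2 mu f -> L2 mu g -> L2 mu h ->
  inner mu h (fun x => f x + g x) = inner mu h f + inner mu h g.
Proof.
move=> hf hg hh; rewrite -[LHS]conjCK innerJ//; last exact: L2D.
by rewrite innerDl// conjD !innerJ.
Qed.

Lemma innerBr f g h : L2 mu f -> L2 mu g -> L2 mu h ->
  inner mu h (fun x => f x - g x) = inner mu h f - inner mu h g.
Proof.
move=> hf hg hh; rewrite -[LHS]conjCK innerJ//; last exact: L2B.
by rewrite innerBl// conjB !innerJ.
Qed.

Lemma innerZr (c : R[i]) f h : L2 mu f -> L2 mu h ->
  inner mu h (fun x => c * f x) = c^* * inner mu h f.
Proof.
move=> hf hh; rewrite -[LHS]conjCK innerJ//; last exact: L2Z.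
by rewrite innerZl// conjM innerJ.
Qed.

Lemma inner_sumr (I : Type) (s : seq I) (F : I -> T -> R[i]) h :
  (forall i, L2 mu (F i)) -> L2 mu h ->
  inner mu h (fun x => \sum_(i <- s) F i x) = \sum_(i <- s) inner mu h (F i).
Proof.
move=> hF hh; rewrite -[LHS]conjCK innerJ//; last exact: L2_bigsum.
rewrite inner_suml// rmorph_sum; apply: eq_bigr => i _.
exact: innerJ.
Qed.

Lemma sqfB f g : L2 mu f -> L2 mu g ->
  sqf (fun x => f x - g x) = sqf f + sqf g - 2 * complex.Re (inner mu f g).
Proof.
move=> hf hg; have hB := L2B hf hg.
have := inner_ff hB; rewrite innerBl// !innerBr//.
rewrite inner_ff// inner_ff// -(innerJ hf hg).
by move/(congr1 (@complex.Re R)); rewrite !cReD !cReN !cReD !cReN cReJ /= => <-; ring.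
Qed.

Lemma sqfZ (c : R[i]) f : L2 mu f -> sqf (fun x => c * f x) = sqn c * sqf f.
Proof. by move=> hf; rewrite /sqf nsqZ; [rewrite fineM// L2_fin|case: hf]. Qed.

(** Cauchy-Schwarz, by minimizing the squared norm of [f - c g] over [c]. *)
Lemma inner_CS f g : L2 mu f -> L2 mu g -> sqn (inner mu f g) <= sqf f * sqf g.
Proof.
move=> hf hg; set z := inner mu f g.
have key c : 0 <= sqf f + sqn c * sqf g - 2 * complex.Re (c^* * z).
  rewrite -innerZr// -(sqfZ _ hg) -sqfB ?sqf_ge0//; exact: L2Z.
have Re_s (s : R) : complex.Re ((s%:C * z)^* * z) = s * sqn z.
  by rewrite conjM /sqn; case: (z) => a b /=; ring.
have [g0|g0] := eqVneq (sqf g) 0.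
  rewrite g0 mulr0 leNgt; apply/negP => z0.
  have := key ((((sqf f) + 1) / sqn z)%:C * z).
  rewrite Re_s g0 mulr0 divfK ?gt_eqF// addr0.
  have := sqf_ge0 f; lra.
have gp : 0 < sqf g by rewrite lt_neqAle eq_sym g0 sqf_ge0.
have := key ((sqf g)^-1%:C * z); rewrite Re_s sqnM sqnR => h.
rewrite -ler_pdivrMr//.
suff -> : sqn z / sqf g = 2 * ((sqf g)^-1 * sqn z) - (sqf g)^-1 ^+ 2 * sqn z * sqf g by lra.
by field.
Qed.

End Inner.

Section Completeness.
Context {R : realType} {d : measure_display} {T : measurableType d}.
Variable mu : {measure set T -> \bar R}.
Implicit Types (f g h : T -> R[i]).

Lemma measurable_fun_limn_einf (f : nat -> T -> \bar R) :
  (forall n, measurable_fun setT (f n)) ->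
  measurable_fun setT (fun x => limn_einf (f ^~ x)).
Proof.
move=> mf; rewrite (_ : (fun x => _) = (fun x => - limn_esup (fun n => - f n x))%E); last first.
  by apply/funext => x; rewrite -limn_einfN; congr limn_einf; apply/funext => n /=; rewrite oppeK.
apply: measurableT_comp => //; apply: measurable_fun_limn_esup => n.
exact: measurableT_comp.
Qed.

Lemma cvg_sqn (f : nat -> R[i]) (z w : R[i]) m :
  (fun n => complex.Re (f n)) @ \oo --> complex.Re z ->
  (fun n => complex.Im (f n)) @ \oo --> complex.Im z ->
  (fun n => (sqn (f (m + n)%N - w))%:E) @ \oo --> (sqn (z - w))%:E.
Proof.
move=> hr hi.
have hr' := cvg_comp (addn m) _ (@cvg_addnl m) hr.
have hi' := cvg_comp (addn m) _ (@cvg_addnl m) hi.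
have X : (fun n => complex.Re (f (m + n)%N) - complex.Re w) @ \oo -->
    complex.Re z - complex.Re w by apply: cvgB; [exact: hr'|exact: cvg_cst].
have Y : (fun n => complex.Im (f (m + n)%N) - complex.Im w) @ \oo -->
    complex.Im z - complex.Im w by apply: cvgB; [exact: hi'|exact: cvg_cst].
have h : (fun n => sqn (f (m + n)%N - w)) @ \oo --> sqn (z - w).
  rewrite /sqn !cReD !cReN !cImD !cImN !expr2.
  under eq_fun do rewrite !cReD !cReN !cImD !cImN !expr2.
  by apply: cvgD; [exact: (cvgM X X)|exact: (cvgM Y Y)].
by apply/fine_cvgP; split; [exact: nearW|].
Qed.

Lemma geometric_increments_cvg (u : R ^nat) (K : R) :
  (forall n, `|u n.+1 - u n| <= K * 2^-1 ^+ n) -> cvgn u.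
Proof.
move=> hu; pose a n := u n - 2 * K * 2^-1 ^+ n.
have K0 : 0 <= K by have := hu 0%N; rewrite expr0 mulr1; exact: le_trans.
have ha n : a n <= a n.+1.
  have := hu n; rewrite ler_norml => /andP[h _].
  rewrite /a exprS; move: h; set q := 2^-1 ^+ n.
  by rewrite (_ : 2 * K * (2^-1 * q) = K * q); [lra|field].
have hb n : u n <= u 0%N + 2 * K - 2 * K * 2^-1 ^+ n.
  elim: n => [|n ih]; first by rewrite expr0; lra.
  have := hu n; rewrite ler_norml exprS => /andP[_ h].
  move: h ih; set q := 2^-1 ^+ n.
  by rewrite (_ : 2 * K * (2^-1 * q) = K * q); [lra|field].
have ca : cvgn a.
  apply: nondecreasing_is_cvgn; first exact/nondecreasing_seqP.
  exists (u 0%N + 2 * K) => _ [n _ <-]; rewrite /a.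
  have := hb n; have : 0 <= 2 * K * 2^-1 ^+ n by rewrite !mulr_ge0// exprn_ge0.
  lra.
have -> : u = (fun n => a n + 2 * K * 2^-1 ^+ n).
  by apply/funext => n; rewrite /a subrK.
apply: is_cvgD => //; apply: is_cvgM; first exact: is_cvg_cst.
apply/cvg_ex; exists 0; apply: cvg_expr.
by rewrite ger0_norm; lra.
Qed.

Lemma nsq_increments (f : nat -> T -> R[i]) : (forall n, L2 mu (f n)) ->
  (forall n, nsq mu (fun x => (f n.+1 x - f n x)%R) <= (8^-1 ^+ n)%:E)%E ->
  forall k m, (nsq mu (fun x => (f (m + k)%N x - f m x)%R) <= (4 * 8^-1 ^+ m)%:E)%E.
Proof.
move=> hf hd; elim => [|k ih] m.
  rewrite addn0 (_ : (fun x => _) = fun=> 0) ?nsq0; last first.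
    by apply/funext => x; rewrite subrr.
  by rewrite lee_fin mulr_ge0// exprn_ge0.
have mf n : cmeasurable (f n) by case: (hf n).
have -> : (fun x => f (m + k.+1)%N x - f m x) =
  (fun x => (f (m.+1 + k)%N x - f m.+1 x) + (f m.+1 x - f m x)).
  by apply/funext => x; rewrite addnS addSn; ring.
apply: (le_trans (nsqD_le2 _ _ _)); try exact: cmeasurableB.
apply: (@le_trans _ _ (2%:E * (4 * 8^-1 ^+ m.+1)%:E + 2%:E * (8^-1 ^+ m)%:E)%E).
  by apply: leeD; rewrite lee_pmul2l.
rewrite -!EFinM -EFinD lee_fin exprS.
have : 0 <= (8^-1 : R) ^+ m by rewrite exprn_ge0.
by set q := 8^-1 ^+ m; lra.
Qed.

(** Riesz-Fischer for a rapidly Cauchy sequence: the weighted squared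
    increments have a finite integral, hence a finite sum almost everywhere,
    which forces pointwise convergence; Fatou's lemma then gives convergence
    in norm. *)
Lemma L2_complete_fast (f : nat -> T -> R[i]) : (forall n, L2 mu (f n)) ->
  (forall n, nsq mu (fun x => (f n.+1 x - f n x)%R) <= (8^-1 ^+ n)%:E)%E ->
  exists2 g, L2 mu g &
    forall m, (nsq mu (fun x => (g x - f m x)%R) <= (4 * 8^-1 ^+ m)%:E)%E.
Proof.
move=> hf hd; have mf n : cmeasurable (f n) by case: (hf n).
have mD n : cmeasurable (fun x => (f n.+1 x - f n x)%R) by exact: cmeasurableB.
pose D n x : \bar R := ((4 ^+ n)%:E * (sqn (f n.+1 x - f n x))%:E)%E.
have D0 n x : (0 <= D n x)%E by rewrite /D -EFinM lee_fin mulr_ge0 ?exprn_ge0 ?sqn_ge0.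
have mDn n : measurable_fun setT (D n).
  by apply: measurable_funeM; exact: measurable_sqnE.
pose S x := (\sum_(n <oo) D n x)%E.
have mS : measurable_fun setT S by apply: ge0_emeasurable_sum => // n x _ _; exact: D0.
have S0 x : (0 <= S x)%E by apply: nneseries_ge0 => n _ _; exact: D0.
have iS : (\int[mu]_x S x < +oo)%E.
  rewrite integral_nneseries//.
  apply: (@le_lt_trans _ _ (\sum_(n <oo) (2^-1 ^+ n)%:E)%E).
    apply: lee_nneseries => n _; first by move=> _; apply: integral_ge0 => x _; exact: D0.
    rewrite ge0_integralZl//; [|exact: measurable_sqnE|
      by move=> x _; rewrite lee_fin sqn_ge0].
    apply: (@le_trans _ _ ((4 ^+ n)%:E * (8^-1 ^+ n)%:E)%E).
      by rewrite lee_pmul2l ?exprn_gt0//; exact: hd.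
    by rewrite -EFinM -exprMn (_ : 4 * 8^-1 = 2^-1 :> R)//; field.
  have := @cvg_geometric_eseries_half R 2 0.
  rewrite (_ : (fun n => _) = (fun n => (2^-1 ^+ n)%:E : \bar R)); last first.
    apply/funext => n; rewrite addn1 natrX exprS invfM mulrA mulfV ?mul1r ?exprVn//.
  by move=> /cvg_lim => -> //; rewrite ltry.
have aeS : {ae mu, forall x, S x \is a fin_num}.
  have : mu.-integrable setT S.
    by apply/integrableP; split => //; under eq_integral do rewrite gee0_abs//.
  by move/(integrable_ae measurableT); apply: filterS => x /(_ Logic.I).
pose gr x : R := fine (limn_esup (fun n => (complex.Re (f n x))%:E)).
pose gi x : R := fine (limn_esup (fun n => (complex.Im (f n x))%:E)).
pose g x := (gr x +i* gi x)%C.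
have mg : cmeasurable g.
  by split; apply: (@measurableT_comp _ _ _ _ _ _ fine) => //;
    apply: measurable_fun_limn_esup => n; apply/measurable_EFinP; case: (mf n).
have cvr (x : T) : S x \is a fin_num ->
    (fun n => complex.Re (f n x)) @ \oo --> gr x /\
    (fun n => complex.Im (f n x)) @ \oo --> gi x.
  move=> Sx; pose C := fine (S x).
  have hC n : sqn (f n.+1 x - f n x) <= C * (2^-1 ^+ n) ^+ 2.
    have : (D n x <= S x)%E.
      rewrite /S (nneseriesD1 (n := n))// leeDl//.
      by apply: nneseries_ge0 => k _ _; exact: D0.
    rewrite -(fineK Sx) /D -EFinM lee_fin => h.
    rewrite -exprM mulnC exprM -(@ler_pM2l _ (4 ^+ n)) ?exprn_gt0//.
    rewrite (le_trans h)// mulrCA -exprMn (_ : 4 * 2^-1 ^+ 2 = 1 :> R); last by field.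
    by rewrite expr1n mulr1.
  have C0 : 0 <= C by rewrite /C fine_ge0.
  have hsq (a q : R) : 0 <= q -> `|a| ^+ 2 <= C * q ^+ 2 -> `|a| <= Num.sqrt C * q.
    move=> q0 h; rewrite -(@ler_pXn2r _ 2) ?nnegrE ?mulr_ge0 ?sqrtr_ge0//.
    by rewrite exprMn sqr_sqrtr.
  have cr : cvgn (fun n => complex.Re (f n x)).
    apply: (@geometric_increments_cvg _ (Num.sqrt C)) => n; apply: hsq; first exact: exprn_ge0.
    apply: le_trans (hC n); rewrite -cReN -cReD; exact: Re_sqn.
  have ci : cvgn (fun n => complex.Im (f n x)).
    apply: (@geometric_increments_cvg _ (Num.sqrt C)) => n; apply: hsq; first exact: exprn_ge0.
    apply: le_trans (hC n); rewrite -cImN -cImD; exact: Im_sqn.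
  have aux (u : R ^nat) : cvgn u -> u @ \oo --> fine (limn_esup (fun n => (u n)%:E)).
    move=> cu; have cE : (fun n => (u n)%:E) @ \oo --> (limn u)%:E.
      by apply/fine_cvgP; split; [apply: nearW|].
    rewrite is_cvg_limn_esupE; last by apply/cvg_ex; eexists; exact: cE.
    by rewrite (cvg_lim _ cE).
  by split; exact: aux.
have key m : (nsq mu (fun x => (g x - f m x)%R) <= (4 * 8^-1 ^+ m)%:E)%E.
  have -> : nsq mu (fun x => (g x - f m x)%R) =
    (\int[mu]_x limn_einf (fun n => (sqn (f (m + n)%N x - f m x))%:E))%E.
    apply: ge0_ae_eq_integral => //.
    - by apply: measurable_sqnE; exact: cmeasurableB.
    - by apply: measurable_fun_limn_einf => n; apply: measurable_sqnE; exact: cmeasurableB.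
    - by move=> x _; rewrite lee_fin sqn_ge0.
    - move=> x _; rewrite limn_einf_lim; apply: lime_ge; first exact: is_cvg_einfs.
      apply: nearW => k; apply: le_ereal_inf_tmp => _ [n _ <-].
      by rewrite lee_fin sqn_ge0.
    apply: filterS aeS => x /cvr[hr hi] _.
    have cE : (fun n => (sqn (f (m + n)%N x - f m x))%:E) @ \oo --> (sqn (g x - f m x))%:E by exact: (@cvg_sqn (f ^~ x) (g x)).
    by rewrite is_cvg_limn_einfE ?(cvg_lim _ cE)//; apply/cvg_ex; eexists; exact: cE.
  apply: (le_trans (fatou _ _ _ _)) => //.
  - by move=> n; apply: measurable_sqnE; exact: cmeasurableB.
  - by move=> n x _; rewrite lee_fin sqn_ge0.
  apply: (le_trans (limn_einf_sup _)).
  rewrite limn_esup_lim; apply: lime_le; first exact: is_cvg_esups.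
  apply: nearW => k; apply: ge_ereal_sup => _ [n _ <-].
  exact: nsq_increments.
exists g => //; apply: (L2_close mg (hf 0%N)).
by rewrite (le_lt_trans (key 0%N))// ltry.
Qed.

End Completeness.

(** * Unconditional sums in L^2 *)

Section Nets.
Context {R : realType} {d : measure_display} {T : measurableType d}.
Variable mu : {measure set T -> \bar R}.
Implicit Types (f g h : T -> R[i]).

(** An increasing sequence of indices along which the increments decay
    geometrically reduces the net to a sequence; the Cauchy condition
    controls the other indices. *)
Lemma L2_complete_net (I : choiceType) (S : {fset I} -> T -> R[i]) :
  (forall A, L2 mu (S A)) ->
  (forall e : R, 0 < e -> exists A, forall B, (A `<=` B)%fset ->
     (nsq mu (fun x => (S B x - S A x)%R) <= e%:E)%E) ->
  exists2 g, L2 mu g & forall e : R, 0 < e -> exists A, forall B, (A `<=` B)%fset ->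
     (nsq mu (fun x => (g x - S B x)%R) <= e%:E)%E.
Proof.
move=> hS hC; have mS A : cmeasurable (S A) by case: (hS A).
have h8 n : 0 < (8^-1 ^+ n : R) / 4 by rewrite divr_gt0// exprn_gt0.
pose A n := projT1 (cid (hC _ (h8 n))).
have hA n B : (A n `<=` B)%fset ->
    (nsq mu (fun x => (S B x - S (A n) x)%R) <= (8^-1 ^+ n / 4)%:E)%E.
  exact: (projT2 (cid (hC _ (h8 n)))).
pose E n := (\bigcup_(i <- iota 0 n.+1) A i)%fset.
have AE n m : (n <= m)%N -> (A n `<=` E m)%fset.
  by move=> nm; apply: bigfcup_sup => //; rewrite mem_iota.
have EE n m : (n <= m)%N -> (E n `<=` E m)%fset.
  move=> nm; apply/bigfcupsP => i; rewrite mem_iota /= => hi _.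
  by apply: AE; rewrite (leq_trans _ nm).
have hE n B : (E n `<=` B)%fset ->
    (nsq mu (fun x => (S B x - S (E n) x)%R) <= (8^-1 ^+ n)%:E)%E.
  move=> nB.
  have -> : (fun x => S B x - S (E n) x) =
      (fun x => (S B x - S (A n) x) + (S (A n) x - S (E n) x)).
    by apply/funext => x; ring.
  apply: (le_trans (nsqD_le2 _ (cmeasurableB _ _) (cmeasurableB _ _))) => //.
  apply: (@le_trans _ _ (2%:E * (8^-1 ^+ n / 4)%:E + 2%:E * (8^-1 ^+ n / 4)%:E)%E).
    apply: leeD; rewrite lee_pmul2l//.
      by apply: hA; rewrite (fsubset_trans _ nB)// AE.
    by rewrite nsqBC; apply: hA; exact: AE.
  by rewrite -!EFinM -EFinD lee_fin; set q := 8^-1 ^+ n; lra.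
have [g hg hgn] := L2_complete_fast (fun n => hS (E n)) (fun n => hE n _ (EE _ _ (leqnSn n))).
exists g => // e e0.
have [n hn] : exists n, 10 * 8^-1 ^+ n < e.
  have := @cvg_expr R (8^-1); rewrite ger0_norm ?invr_ge0// invf_lt1// => /(_ _)/cvgrPdist_lt.
  have e10 : 0 < e / 10 by rewrite divr_gt0.
  move=> /(_ _ _ e10) []; first by rewrite ltr1n.
  move=> n _ /(_ n (leqnn n)) /=; rewrite sub0r normrN ger0_norm ?exprn_ge0// => h.
  by exists n; move: h; rewrite ltr_pdivlMr// mulrC.
exists (E n) => B nB.
have -> : (fun x => g x - S B x) =
    (fun x => (g x - S (E n) x) + (S (E n) x - S B x)).
  by apply/funext => x; ring.
apply: (le_trans (nsqD_le2 _ (cmeasurableB _ _) (cmeasurableB _ _))) => //; try by case: hg.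
apply: (@le_trans _ _ (2%:E * (4 * 8^-1 ^+ n)%:E + 2%:E * (8^-1 ^+ n)%:E)%E).
  apply: leeD; rewrite lee_pmul2l//.
  by rewrite nsqBC; exact: hE.
rewrite -!EFinM -EFinD lee_fin (le_trans _ (ltW hn))//; set q := 8^-1 ^+ n; lra.
Qed.

Lemma L2_sumP (I : choiceType) (u : I -> T -> R[i]) f :
  L2_sum mu u f <-> forall e : R, 0 < e -> exists A, forall B, (A `<=` B)%fset ->
     (nsq mu (fun x => (f x - \sum_(i <- B) u i x)%R) <= e%:E)%E.
Proof.
rewrite /L2_sum; split.
  move=> /L2norm_cvg0P-/(_ totally_filter) h e e0; have [A _ hA] := h e e0.
  by exists A => B AB; apply: ltW; exact: hA.
move=> h; apply/L2norm_cvg0P => [|e e0]; first exact: totally_filter.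
have e2 : 0 < e / 2 by rewrite divr_gt0.
have [A hA] := h _ e2; exists A => // B AB /=.
by rewrite (le_lt_trans (hA _ AB))// lte_fin; lra.
Qed.

End Nets.

Section SquareSummable.
Context {R : realType} {I : choiceType}.
Implicit Types (a : I -> R) (A B : {fset I}).

Lemma fset_sum_le_esum a A : (forall i, 0 <= a i) ->
  ((\sum_(i <- A) a i)%:E <= \esum_(i in [set: I]) (a i)%:E)%E.
Proof.
move=> a0; apply: ereal_sup_ubound; exists [set` A] => //.
by rewrite fsbig_finite//= set_fsetK sumEFin.
Qed.

Lemma esum_le_fset a (c : \bar R) : (forall i, 0 <= a i) ->
  (forall A, ((\sum_(i <- A) a i)%:E <= c)%E) ->
  (\esum_(i in [set: I]) (a i)%:E <= c)%E.
Proof.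
move=> a0 h; apply: ge_ereal_sup => _ [X [finX _] <-].
by rewrite fsbig_finite//= sumEFin; exact: h.
Qed.

Lemma fset_sum_le a A B : (forall i, 0 <= a i) -> (A `<=` B)%fset ->
  \sum_(i <- A) a i <= \sum_(i <- B) a i.
Proof.
move=> a0 AB; rewrite [leRHS](big_fsetID _ (fun i => i \in A))//=.
rewrite (_ : [fset x in B | x \in A]%fset = A); last first.
  apply/fsetP => i; rewrite !inE andbC; case: (boolP (i \in A)) => //= iA.
  by rewrite (fsubsetP AB).
by rewrite lerDl sumr_ge0.
Qed.

Lemma big_fset_sub (V : zmodType) (F : I -> V) A B : (A `<=` B)%fset ->
  \sum_(i <- B) F i - \sum_(i <- A) F i = \sum_(i <- (B `\` A)%fset) F i.
Proof.
move=> AB; rewrite (big_fsetID _ (fun i => i \in A))//=.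
rewrite (_ : [fset x in B | x \in A]%fset = A); last first.
  apply/fsetP => i; rewrite !inE andbC; case: (boolP (i \in A)) => //= iA.
  by rewrite (fsubsetP AB).
rewrite addrC addrK; apply: eq_fbigl => i; by rewrite !inE andbC.
Qed.

Lemma esum_tail a : (forall i, 0 <= a i) ->
  (\esum_(i in [set: I]) (a i)%:E < +oo)%E ->
  forall e, 0 < e -> exists A, forall B, (A `<=` B)%fset ->
    \sum_(i <- (B `\` A)%fset) a i <= e.
Proof.
move=> a0 fin e e0; set S := esum _ _ in fin.
have S0 : (0 <= S)%E by apply: esum_ge0 => i _; rewrite lee_fin.
have Sfin : S \is a fin_num by rewrite ge0_fin_numE.
have [_ [X [finX _] <-]] := @ub_ereal_sup_adherent _ _ _ e0 Sfin.
rewrite fsbig_finite//= sumEFin -/S => hX.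
exists (fset_set X) => B XB; rewrite -big_fset_sub//.
have := fset_sum_le_esum B a0; rewrite -/S -(fineK Sfin) lee_fin.
move: hX; rewrite -/(esum _ _) -/S -[S in X in (X < _)%E](fineK Sfin) -EFinB lte_fin; lra.
Qed.

End SquareSummable.

(** ** Orthogonal systems *)

Section Synthesis.
Context {R : realType} {d : measure_display} {T : measurableType d}.
Variables (mu : {measure set T -> \bar R}) (I : choiceType) (u : I -> T -> R[i]).
Hypothesis uL2 : forall i, L2 mu (u i).
Implicit Types (f g h : T -> R[i]) (c : I -> R[i]).

Let L2_part c (A : {fset I}) : L2 mu (fun x => \sum_(i <- A) c i * u i x).
Proof. by apply: L2_bigsum => i; exact: L2Z. Qed.

Definition ell2 c := (\esum_(i in [set: I]) (sqn (c i))%:E < +oo)%E.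

(** An upper Riesz bound turns square-summable coefficients into an
    unconditionally convergent series. *)
Lemma L2_synthesis (C : R) : 0 <= C ->
  (forall c (A : {fset I}), (nsq mu (fun x => (\sum_(i <- A) c i * u i x)%R) <=
     (C * \sum_(i <- A) sqn (c i))%:E)%E) ->
  forall c, ell2 c -> exists2 f, L2 mu f & L2_sum mu (fun i x => c i * u i x) f.
Proof.
move=> C0 hC c hc.
have [|f hf hfc] := @L2_complete_net _ _ _ mu I _ (L2_part c).
  move=> e e0; have e' : 0 < e / (C + 1) by rewrite divr_gt0// ltr_wpDl.
  have [A hA] := esum_tail (fun i => sqn_ge0 (c i)) hc e'.
  exists A => B AB.
  have -> : (fun x => \sum_(i <- B) c i * u i x - \sum_(i <- A) c i * u i x) =
     (fun x => \sum_(i <- (B `\` A)%fset) c i * u i x).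
    by apply/funext => x; rewrite big_fset_sub.
  rewrite (le_trans (hC _ _))// lee_fin.
  have := hA _ AB; rewrite ler_pdivlMr; last by rewrite ltr_wpDl.
  set s := \sum_(_ <- _) _ => hs; rewrite (le_trans _ hs)// mulrC ler_wpM2l//.
    by apply: sumr_ge0 => i _; exact: sqn_ge0.
  by rewrite lerDl.
by exists f => //; apply/L2_sumP.
Qed.

(** Cauchy-Schwarz: inner products are continuous for the convergence in
    norm. *)
Lemma inner_L2_sum_lim c f h : L2 mu f -> L2 mu h ->
  L2_sum mu (fun i x => c i * u i x) f ->
  forall e, 0 < e -> exists A : {fset I}, forall B, (A `<=` B)%fset ->
    sqn (inner mu f h - \sum_(i <- B) c i * inner mu (u i) h) <= e.
Proof.
move=> hf hh /L2_sumP hs e e0.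
have e' : 0 < e / (sqf mu h + 1) by rewrite divr_gt0// ltr_wpDl// sqf_ge0.
have [A hA] := hs _ e'; exists A => B /hA hB.
have hd : L2 mu (fun x => f x - \sum_(i <- B) c i * u i x) by exact: L2B.
have -> : \sum_(i <- B) c i * inner mu (u i) h =
   inner mu (fun x => \sum_(i <- B) c i * u i x) h.
  rewrite inner_suml//; last by move=> i; exact: L2Z.
  by apply: eq_bigr => i _; rewrite innerZl.
rewrite -innerBl// (le_trans (inner_CS hd hh))//.
move: hB; rewrite (sqfE hd) lee_fin => hB.
apply: (@le_trans _ _ (e / (sqf mu h + 1) * sqf mu h)).
  by rewrite ler_wpM2r// sqf_ge0.
rewrite -mulrA ger_pMr// mulrC ler_pdivrMr ?ltr_wpDl ?sqf_ge0// mul1r.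
by rewrite lerDl.
Qed.

Section Orthogonal.
Variable (L : R).
Hypothesis L0 : 0 < L.
Hypothesis orth : forall i j, inner mu (u i) (u j) = if i == j then L%:C else 0.

Lemma orth_inner_sum c (A : {fset I}) j :
  inner mu (fun x => \sum_(i <- A) c i * u i x) (u j) =
  if j \in A then c j * L%:C else 0.
Proof.
rewrite inner_suml//; last by move=> i; exact: L2Z.
under eq_bigr do rewrite innerZl// orth.
case: ifP => jA.
  rewrite (big_fsetD1 j)//= eqxx big1_fset ?addr0// => i.
  by rewrite !inE => /andP[/negPf -> _]; rewrite mulr0.
rewrite big1_fset// => i iA _; case: eqP => [E|_]; rewrite ?mulr0//.
by rewrite E jA in iA.
Qed.

Lemma orth_sqf c (A : {fset I}) :
  sqf mu (fun x => \sum_(i <- A) c i * u i x) = L * \sum_(i <- A) sqn (c i).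
Proof.
have := inner_ff (L2_part c A); rewrite inner_sumr//; last by move=> i; exact: L2Z.
rewrite (_ : \sum_(i <- A) _ = (L * \sum_(i <- A) sqn (c i))%:C); first by case.
rewrite mulr_sumr rmorph_sum/= big_seq [RHS]big_seq; apply: eq_bigr => i iA.
rewrite innerZr// orth_inner_sum iA mulrA [_ * c i]mulrC mulJ_sqn.
by rewrite -rmorphM mulrC.
Qed.

Lemma orth_nsq c (A : {fset I}) :
  nsq mu (fun x => \sum_(i <- A) c i * u i x) = (L * \sum_(i <- A) sqn (c i))%:E.
Proof. by rewrite sqfE// orth_sqf. Qed.

Definition coef f i := inner mu f (u i) / L%:C.

Lemma orth_residual f (A : {fset I}) : L2 mu f ->
  sqf mu (fun x => f x - \sum_(i <- A) coef f i * u i x) =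
  sqf mu f - L * \sum_(i <- A) sqn (coef f i).
Proof.
move=> hf; rewrite sqfB// orth_sqf inner_sumr//; last by move=> i; exact: L2Z.
rewrite (_ : \sum_(i <- A) inner mu f _ = (L * \sum_(i <- A) sqn (coef f i))%:C).
  by rewrite /=; ring.
rewrite mulr_sumr rmorph_sum/=; apply: eq_bigr => i _.
have Lc : L%:C != 0 by rewrite (inj_eq (@complexI _)) gt_eqF.
rewrite innerZr// (_ : inner mu f (u i) = L%:C * coef f i); last first.
  by rewrite /coef mulrC divfK.
by rewrite mulrCA [_^* * _]mulrC mulJ_sqn -rmorphM.
Qed.

(** The squared norm of the residual of every finite partial sum is
    nonnegative. *)
Lemma bessel f : L2 mu f -> ((\esum_(i in [set: I]) (sqn (coef f i))%:E) <= (sqf mu f / L)%:E)%E.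
Proof.
move=> hf; apply: esum_le_fset => [i|A]; first exact: sqn_ge0.
rewrite lee_fin ler_pdivlMr// mulrC -subr_ge0 -orth_residual//.
exact: sqf_ge0.
Qed.

Lemma bessel_ell2 f : L2 mu f -> ell2 (coef f).
Proof. by move=> /bessel h; rewrite /ell2 (le_lt_trans h)// ltry. Qed.

Lemma orth_synthesis c : ell2 c ->
  exists2 f, L2 mu f & L2_sum mu (fun i x => c i * u i x) f.
Proof.
apply: (@L2_synthesis L); first exact: ltW.
by move=> b A; rewrite orth_nsq.
Qed.

(** The coefficients of a partial sum are eventually constant, and inner
    products pass to the limit. *)
Lemma coef_L2_sum c f : L2 mu f -> L2_sum mu (fun i x => c i * u i x) f ->
  coef f = c.
Proof.
move=> hf hs; apply/funext => j; apply/eqP; rewrite -subr_eq0; apply/eqP.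
apply: sqn_eq0; apply/eqP; rewrite eq_le sqn_ge0 andbT.
apply/ler_addgt0Pl => e e0; rewrite addr0.
have e' : 0 < e * L ^+ 2 by rewrite mulr_gt0// exprn_gt0.
have [A hA] := inner_L2_sum_lim hf (uL2 j) hs e'.
have := hA (j |` A)%fset (fsubsetUr _ _).
have -> : \sum_(i <- (j |` A)%fset) c i * inner mu (u i) (u j) = c j * L%:C.
  rewrite (big_fsetD1 j)/= ?fset1U1// orth eqxx big1_fset ?addr0// => i.
  by rewrite !inE => /andP[/negPf ij _] _; rewrite orth ij mulr0.
have Lc : L%:C != 0 by rewrite (inj_eq (@complexI _)) gt_eqF.
rewrite (_ : inner mu f (u j) = coef f j * L%:C); last by rewrite /coef divfK.
by rewrite -mulrBl sqnM sqnR ler_pM2r// exprn_gt0.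
Qed.

Hypothesis total : forall f, L2 mu f -> (forall i, inner mu f (u i) = 0) ->
  nsq mu f = 0%E.

(** The series of the coefficients converges by Bessel's inequality; its
    limit has the same coefficients as [f], so totality identifies them. *)
Lemma orth_expansion f : L2 mu f -> L2_sum mu (fun i x => coef f i * u i x) f.
Proof.
move=> hf; have [g hg hs] := orth_synthesis (bessel_ell2 hf).
have cfg := coef_L2_sum hg hs.
have Lc : L%:C != 0 by rewrite (inj_eq (@complexI _)) gt_eqF.
have fg0 : nsq mu (fun x => f x - g x) = 0%E.
  apply: total; first exact: L2B.
  move=> i; rewrite innerBl//.
  have := congr1 (fun c => c i * L%:C) cfg; rewrite /coef !divfK// => ->.
  by rewrite subrr.
apply/L2_sumP => e e0; have e2 : 0 < e / 2 by rewrite divr_gt0.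
have /L2_sumP/(_ _ e2)[A hA] := hs; exists A => B /hA hB.
have -> : (fun x => f x - \sum_(i <- B) coef f i * u i x) =
  (fun x => (f x - g x) + (g x - \sum_(i <- B) coef f i * u i x)).
  by apply/funext => x; ring.
apply: (le_trans (nsqD_le2 _ _ _)).
- by apply: cmeasurableB; [case: hf|case: hg].
- by apply: cmeasurableB; [case: hg|case: (L2_part (coef f) B)].
rewrite fg0 mule0 add0e (@le_trans _ _ (2%:E * (e / 2)%:E)%E)//.
  by rewrite lee_pmul2l.
by rewrite -EFinM lee_fin; lra.
Qed.

(** The residuals of the partial sums tend to zero. *)
Lemma parseval f : L2 mu f ->
  (\esum_(i in [set: I]) (sqn (coef f i))%:E = (sqf mu f / L)%:E)%E.
Proof.
move=> hf; apply/eqP; rewrite eq_le bessel//=.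
apply/lee_addgt0Pr => e e0.
have e' : 0 < e * L by rewrite mulr_gt0.
have /L2_sumP/(_ _ e')[A /(_ A (fsubset_refl _))] := orth_expansion hf.
rewrite sqfE ?orth_residual//; last exact: L2B.
rewrite lee_fin lerBlDl => h.
apply: (@le_trans _ _ ((\sum_(i <- A) sqn (coef f i))%:E + e%:E)%E).
  rewrite -EFinD lee_fin ler_pdivrMr// mulrDl; rewrite mulrC in h.
  by rewrite (le_trans h)// [e * L + _]addrC// mulrC.
by rewrite leeD2r// fset_sum_le_esum// => i; exact: sqn_ge0.
Qed.

End Orthogonal.
End Synthesis.

(** * Changes of variables and periodization *)

Section RestrictedMeasure.
Context {R : realType} {d : measure_display} {T : measurableType d}.
Variables (mu : {measure set T -> \bar R}) (D : set T) (mD : measurable D).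

Lemma ge0_integral_mrestr (f : T -> \bar R) : measurable_fun setT f ->
  (forall x, (0 <= f x)%E) ->
  (\int[mrestr mu mD]_x f x = \int[mu]_(x in D) f x)%E.
Proof.
move=> mf f0; rewrite -(setUv D) ge0_integral_setU//; last 3 first.
- exact: measurableC.
- by rewrite setUv.
- by apply/disj_setPS; rewrite setICr.
rewrite (_ : \int[_]_(x in ~` D) _ = 0)%E ?adde0; last first.
  apply: null_set_integral; [exact: measurableC| |].
    exact: measurable_funTS.
  by change (mu (~` D `&` D) = 0%E); rewrite setICl measure0.
apply: eq_measure_integral => A mA AD; change (mu (A `&` D) = mu A).
by rewrite (setIidl AD).
Qed.

Lemma nsq_mrestr (f : T -> R[i]) : cmeasurable f ->
  nsq (mrestr mu mD) f = (\int[mu]_(x in D) (sqn (f x))%:E)%E.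
Proof.
move=> mf; apply: ge0_integral_mrestr; first exact: measurable_sqnE.
by move=> x; rewrite lee_fin sqn_ge0.
Qed.

Lemma Rintegral_mrestr (f : T -> R) : measurable_fun setT f ->
  \int[mrestr mu mD]_x f x = \int[mu]_(x in D) f x.
Proof.
move=> mf; rewrite /Rintegral integralE [in RHS]integralE.
have mfE : measurable_fun setT (EFin \o f) by exact/measurable_EFinP.
by rewrite !ge0_integral_mrestr//; [exact: measurable_funeneg|exact: measurable_funepos].
Qed.

Lemma ae_mrestr (P : T -> Prop) :
  {ae mu, forall x, D x -> P x} <-> {ae (mrestr mu mD), forall x, P x}.
Proof.
split=> -[N [mN N0 hN]].
- exists (N `|` ~` D); split.
  + by apply: measurableU => //; exact: measurableC.
  + rewrite /mrestr setIUl setICl setU0; apply: (subset_measure0 _ mN) => //.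
    exact: measurableI.
  + move=> x /= nP; have [Dx|] := pselect (D x); last by right.
    by left; apply: hN => /= /(_ Dx).
- exists (N `&` D); split=> //; first exact: measurableI.
  move=> x /= /not_implyP[Dx nP]; split => //; exact: hN.
Qed.

Definition cutoff (f : T -> R[i]) : T -> R[i] := fun x => if x \in D then f x else 0.

Lemma cutoffE (f : T -> R[i]) x : cutoff f x = (\1_D x)%:C * f x.
Proof.
rewrite /cutoff indicE; case: (x \in D); first by rewrite mul1r.
by rewrite mul0r.
Qed.

Lemma cmeasurable_cutoff f : cmeasurable f -> cmeasurable (cutoff f).
Proof.
move=> mf; have -> : cutoff f = (fun x => (\1_D x)%:C * f x).
  by apply/funext => x; exact: cutoffE.
by apply: cmeasurableM => //; apply: cmeasurable_real.
Qed.

Lemma sqn_cutoff f x : sqn (cutoff f x) <= sqn (f x).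
Proof. by rewrite /cutoff; case: ifP => // _; rewrite sqn0 sqn_ge0. Qed.

Lemma L2_cutoff f : L2 mu f -> L2 mu (cutoff f).
Proof.
move=> hf; apply: (L2_le _ hf); last exact: sqn_cutoff.
by apply: cmeasurable_cutoff; case: hf.
Qed.

Lemma nsq_cutoff f : nsq mu (cutoff f) = (\int[mu]_(x in D) (sqn (f x))%:E)%E.
Proof.
rewrite [RHS]integral_mkcond; apply: eq_integral => x _.
by rewrite patchE /cutoff; case: ifP => // _; rewrite sqn0.
Qed.

Lemma nsq_cutoff_mrestr f : cmeasurable f ->
  nsq mu (cutoff f) = nsq (mrestr mu mD) f.
Proof. by move=> mf; rewrite nsq_cutoff nsq_mrestr. Qed.

Lemma cintegral_cutoff f : cintegral mu D f = cintegral mu setT (cutoff f).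
Proof.
apply: complex_ext => /=; rewrite Rintegral_mkcond; apply: eq_Rintegral => x _;
  by rewrite patchE /cutoff; case: ifP.
Qed.

Lemma cintegral_mrestr f : cmeasurable f ->
  cintegral (mrestr mu mD) setT f = cintegral mu D f.
Proof. by move=> [fr fi]; apply: complex_ext; rewrite /= Rintegral_mrestr. Qed.

Lemma L2_mrestr f : L2 mu f -> L2 (mrestr mu mD) f.
Proof.
move=> hf; have mf := L2_cmeas hf; apply/L2P; split => //.
rewrite -nsq_cutoff_mrestr//; apply: L2_lty; exact: L2_cutoff.
Qed.

End RestrictedMeasure.

Section MeasurePreserving.
Context {R : realType} {d : measure_display} {T : measurableType d}.
Variable (mu : {measure set T -> \bar R}).

(** Stated on integrals of nonnegative functions, where integrability is not
    at issue; other integrals follow by positive and negative parts. *)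
Definition measure_preserving (p : T -> T) : Prop :=
  measurable_fun setT p /\
  forall f : T -> \bar R, measurable_fun setT f -> (forall x, (0 <= f x)%E) ->
    (\int[mu]_x f (p x) = \int[mu]_x f x)%E.

Variable p : T -> T.
Hypothesis hp : measure_preserving p.

Lemma nsq_preserving f : cmeasurable f -> nsq mu (fun x => f (p x)) = nsq mu f.
Proof.
move=> mf; apply: (hp.2 (fun x => (sqn (f x))%:E)); first exact: measurable_sqnE.
by move=> x; rewrite lee_fin sqn_ge0.
Qed.

Lemma L2_preserving f : L2 mu f -> L2 mu (fun x => f (p x)).
Proof.
move=> /L2P[mf ff]; apply/L2P; rewrite nsq_preserving//; split => //.
by apply: cmeasurable_comp => //; case: hp.
Qed.

Lemma Rintegral_preserving (f : T -> R) : measurable_fun setT f ->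
  \int[mu]_x f (p x) = \int[mu]_x f x.
Proof.
move=> mf; rewrite /Rintegral integralE [in RHS]integralE.
have mfE : measurable_fun setT (EFin \o f) by exact/measurable_EFinP.
have h1 : (\int[mu]_x (fun y => (f (p y))%:E)^\+ x = \int[mu]_x (fun y => (f y)%:E)^\+ x)%E.
  rewrite -[RHS](hp.2 _ (measurable_funepos mfE) (funepos_ge0 _)).
  by apply: eq_integral => x _; rewrite !funeposE.
have h2 : (\int[mu]_x (fun y => (f (p y))%:E)^\- x = \int[mu]_x (fun y => (f y)%:E)^\- x)%E.
  rewrite -[RHS](hp.2 _ (measurable_funeneg mfE) (funeneg_ge0 _)).
  by apply: eq_integral => x _; rewrite !funenegE.
by rewrite h1 h2.
Qed.

Lemma cintegral_preserving f : cmeasurable f ->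
  cintegral mu setT (fun x => f (p x)) = cintegral mu setT f.
Proof.
move=> [fr fi]; apply: complex_ext => /=.
  exact: (Rintegral_preserving fr).
exact: (Rintegral_preserving fi).
Qed.

Lemma ae_preserving (P : T -> Prop) :
  {ae mu, forall x, P x} -> {ae mu, forall x, P (p x)}.
Proof.
move=> [N [mN N0 hN]]; exists (p @^-1` N); split.
- by rewrite -[X in measurable X]setTI; exact: hp.1.
- have mpN : measurable (p @^-1` N) by rewrite -[X in measurable X]setTI; exact: hp.1.
  have mi : measurable_fun setT (fun x => (\1_N x)%:E : \bar R).
    by apply/measurable_EFinP; exact: measurable_indic.
  have mi0 x : (0 <= (\1_N x)%:E :> \bar R)%E by rewrite lee_fin.
  have := hp.2 _ mi mi0; rewrite [X in _ = X]integral_indic// setIT N0 => <-.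
  rewrite [RHS](_ : _ = \int[mu]_x (\1_(p @^-1` N) x)%:E)%E//.
  by rewrite integral_indic// setIT.
- by move=> x; exact: hN.
Qed.

End MeasurePreserving.

Section LebesguePreserving.
Context {R : realType}.
Local Notation mu := (@lebesgue_measure R).

(** Half-open intervals determine Lebesgue measure, hence the image measure. *)
Lemma lebesgue_preserving (p : line R -> line R) : measurable_fun setT p ->
  (forall a b : R, a <= b -> mu (p @^-1` `]a, b]) = (b - a)%:E) ->
  measure_preserving mu p.
Proof.
move=> mp hp; split=> // f mf f0.
pose mp_ := isMeasurableFun.Build _ _ _ _ p mp.
pose P : {mfun line R >-> line R} := HB.pack p mp_.
rewrite [RHS](eq_measure_integral (pushforward mu P)); first by rewrite ge0_integral_pushforward.
move=> A mA _; apply: (@lebesgue_measure_unique R (pushforward mu P)) => // X.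
move=> /ocitvP[->|[[a b] /= ab ->]]; first by rewrite !measure0.
rewrite lebesgue_measure_itv/= lte_fin ab -EFinD.
by rewrite -hp// ltW.
Qed.

Lemma shift_preserving (c : R) : measure_preserving mu (fun x => x + c).
Proof.
apply: lebesgue_preserving.
  by apply: measurable_funD => //; exact: measurable_cst.
move=> a b ab; rewrite (_ : _ @^-1` _ = `]a - c, b - c]%classic).
  rewrite lebesgue_measure_itv/= lte_fin ltrD2r; move: ab; rewrite le_eqVlt.
  move=> /predU1P[->|ab]; first by rewrite ltxx subrr.
  by rewrite ab -EFinD; congr EFin; ring.
by apply/seteqP; split => x /=; rewrite !in_itv/= ltrBlDr lerBrDr.
Qed.

Lemma reflect_preserving (c : R) : measure_preserving mu (fun x => c - x).
Proof.
apply: lebesgue_preserving.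
  by apply: measurable_funB => //; exact: measurable_cst.
move=> a b ab; rewrite (_ : _ @^-1` _ = `[c - b, c - a[%classic).
  rewrite lebesgue_measure_itv/= lte_fin ltrD2l ltrN2; move: ab; rewrite le_eqVlt.
  move=> /predU1P[->|ab]; first by rewrite ltxx subrr.
  by rewrite ab -EFinD; congr EFin; ring.
apply/seteqP; split => x /=; rewrite !in_itv/=; move=> /andP[h1 h2];
  by apply/andP; split; lra.
Qed.

(** A shear acts on each vertical line by a measure-preserving map. *)
Lemma shear_preserving (p : plane R -> line R) : measurable_fun setT p ->
  (forall x, measure_preserving mu (fun y => p (x, y))) ->
  measure_preserving (mu2 R) (fun z => (z.1, p z)).
Proof.
move=> mp hp; have mq : measurable_fun setT (fun z : plane R => (z.1, p z)).
  by apply/measurable_fun_pairP; split => //=; exact: measurable_fst.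
split=> // f mf f0.
rewrite (fubini_tonelli1 (fun z => f (z.1, p z)))//; last exact: (measurableT_comp mf mq).
rewrite (fubini_tonelli1 f)//; apply: eq_integral => x _; rewrite /fubini_F /=.
apply: ((hp x).2 (fun y => f (x, y))) => //.
exact: (measurableT_comp mf (pair1_measurable x)).
Qed.

Lemma swap_preserving (f : plane R -> \bar R) : measurable_fun setT f ->
  (forall x, (0 <= f x)%E) ->
  (\int[mu2 R]_z f (z.2, z.1) = \int[mu2 R]_z f z)%E.
Proof.
move=> mf f0; rewrite (fubini_tonelli1 (fun z => f (z.2, z.1)))//; last first.
  apply: (measurableT_comp mf); exact: measurable_swap.
by rewrite (fubini_tonelli2 f).
Qed.

Lemma plane_shift_preserving (c : plane R) :
  measure_preserving (mu2 R) (fun z => (z.1 + c.1, z.2 + c.2)).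
Proof.
have mq : measurable_fun setT (fun z : plane R => (z.1 + c.1, z.2 + c.2)).
  apply/measurable_fun_pairP; split => /=; apply: measurable_funD;
    [exact: measurable_fst|exact: measurable_cst|exact: measurable_snd|exact: measurable_cst].
split=> // f mf f0.
rewrite (fubini_tonelli1 (fun z : plane R => f (z.1 + c.1, z.2 + c.2)))//; last exact: (measurableT_comp mf mq).
rewrite (fubini_tonelli1 f)// -[RHS](shift_preserving c.1).2; last 2 first.
- exact: measurable_fun_fubini_tonelli_F.
- by move=> x; apply: integral_ge0.
apply: eq_integral => x _; rewrite /fubini_F /=.
apply: ((shift_preserving c.2).2 (fun y => f (x + c.1, y))) => //.
exact: (measurableT_comp mf (pair1_measurable _)).
Qed.

End LebesguePreserving.

Section CountableSums.
Context {R : realType} {d : measure_display} {T : measurableType d}.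
Variable (mu : {measure set T -> \bar R}) (I : countType).

(** Turning sums over a countable index set into series gives access to
    monotone convergence. *)
Lemma esum_count (a : I -> \bar R) : (forall i, (0 <= a i)%E) ->
  (\esum_(i in [set: I]) a i =
   \sum_(n <oo) (if @pickle_inv I n is Some i then a i else 0))%E.
Proof.
move=> a0; rewrite nneseries_esumT; last by move=> n; case: (@pickle_inv I n).
pose b n := (if @pickle_inv I n is Some i then a i else 0)%E.
have b0 n : (0 <= b n)%E by rewrite /b; case: (@pickle_inv I n).
transitivity (\esum_(n in range (@choice.pickle I)) b n)%E.
  rewrite (reindex_esum [set: I] (range (@choice.pickle I)) (@choice.pickle I)); last first.
    apply: (@inj_bij _ _ setT) => x y _ _ /(congr1 (@choice.unpickle I)).
    by rewrite !choice.pickleK => -[].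
  by apply: eq_esum => i _; rewrite /b pickleK_inv.
rewrite esum_mkcond; apply: eq_esum => n _; rewrite -/(b n).
case: ifPn => // /negP h; rewrite /b; case E : (@pickle_inv I n) => [i|]//.
exfalso; apply: h; rewrite inE; exists i => //.
by have := @pickle_invK I n; rewrite /oapp E.
Qed.

Lemma integral_esum (D : set T) (f : I -> T -> \bar R) : measurable D ->
  (forall i, measurable_fun D (f i)) -> (forall i x, (0 <= f i x)%E) ->
  (\int[mu]_(x in D) (\esum_(i in [set: I]) f i x) =
   \esum_(i in [set: I]) (\int[mu]_(x in D) f i x))%E.
Proof.
move=> mD mf f0; under eq_integral do rewrite esum_count//.
rewrite integral_nneseries//; last 2 first.
- by move=> n; case: (@pickle_inv I n) => [i|]; [exact: mf|exact: measurable_cst].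
- by move=> n x _; case: (@pickle_inv I n).
rewrite esum_count; last by move=> i; apply: integral_ge0.
congr (limn _); apply/funext => n; apply: eq_bigr => k _.
by case: (@pickle_inv I k) => // ; rewrite integral0.
Qed.

Lemma measurable_esum (f : I -> T -> \bar R) :
  (forall i, measurable_fun setT (f i)) -> (forall i x, (0 <= f i x)%E) ->
  measurable_fun setT (fun x => \esum_(i in [set: I]) f i x)%E.
Proof.
move=> mf f0; under eq_fun do rewrite esum_count//.
apply: ge0_emeasurable_sum => [n x _ _|n _]; first by case: (@pickle_inv I n).
by case: (@pickle_inv I n) => [i|]; [exact: mf|exact: measurable_cst].
Qed.

Lemma integral_tiling (D : I -> set T) (f : T -> \bar R) :
  (forall i, measurable (D i)) ->
  (forall x, exists2 i, D i x & forall j, D j x -> j = i) ->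
  measurable_fun setT f -> (forall x, (0 <= f x)%E) ->
  (\int[mu]_x f x = \esum_(i in [set: I]) (\int[mu]_(x in D i) f x))%E.
Proof.
move=> mD hD mf f0.
under [RHS]eq_esum do rewrite integral_mkcond.
rewrite -integral_esum//; last 2 first.
- by move=> i; apply/(measurable_restrictT _ _).1 => //; exact: measurable_funTS.
- by move=> i x; rewrite patchE; case: ifP.
apply: eq_integral => x _; have [i Dix hi] := hD x.
transitivity (\esum_(j in [set i]) (f \_ (D j)) x)%E.
  by rewrite esum_set1 patchE; [rewrite mem_set|case: ifP].
rewrite esum_mkcond; apply: eq_esum => j _; rewrite patchE.
case: ifPn => // /negP ij; case: ifPn => // jx.
by exfalso; apply: ij; rewrite inE /=; apply: hi; rewrite inE in jx.
Qed.

End CountableSums.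

Section Periodization.
Context {R : realType}.

Lemma tile_uniq (a p x : R) : 0 < p ->
  exists2 k : int, (a + k%:~R * p <= x < a + k%:~R * p + p) &
    forall j : int, (a + j%:~R * p <= x < a + j%:~R * p + p) -> j = k.
Proof.
have E (k : int) : (k + 1)%:~R = k%:~R + 1 :> R by rewrite intrD.
move=> p0; exists (Num.floor ((x - a) / p)).
  have /andP[h1 h2] := floor_itv ((x - a) / p).
  move: h1 h2; set k := Num.floor _; rewrite E ler_pdivlMr// ltr_pdivrMr// mulrDl mul1r.
  by move=> *; apply/andP; split; lra.
move=> j /andP[h1 h2]; apply/esym/floor_def; rewrite E ler_pdivlMr// ltr_pdivrMr//.
by rewrite mulrDl mul1r; apply/andP; split; lra.
Qed.

Lemma integral_shift_itv (a p c : R) (f : line R -> \bar R) :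
  measurable_fun setT f -> (forall x, (0 <= f x)%E) ->
  (\int[mu1 R]_(x in `[(a + c)%R, (a + c + p)%R[) f x =
   \int[mu1 R]_(x in `[a, (a + p)%R[) f (x + c)%R)%E.
Proof.
move=> mf f0; rewrite integral_mkcond [RHS]integral_mkcond.
rewrite -(shift_preserving c).2; last 2 first.
- by apply/(measurable_restrictT _ _).1 => //; exact: measurable_funTS.
- by move=> x; rewrite patchE; case: ifP.
apply: eq_integral => x _; rewrite !patchE.
rewrite (_ : (x + c \in `[a + c, a + c + p[%classic) = (x \in `[a, a + p[%classic))//.
by apply/idP/idP; rewrite !inE /= !in_itv /= => /andP[h1 h2]; apply/andP; split; lra.
Qed.

(** The half-open translates of a period tile the line, and each piece is
    shifted back to the first one. *)
Lemma integral_periodize (a p : R) (f : line R -> \bar R) : 0 < p ->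
  measurable_fun setT f -> (forall x, (0 <= f x)%E) ->
  (\int[mu1 R]_x f x =
   \int[mu1 R]_(x in `[a, (a + p)%R[)
     (\esum_(k in [set: int]) f (x + k%:~R * p)%R))%E.
Proof.
move=> p0 mf f0.
rewrite (@integral_tiling R _ (line R) (mu1 R) int
  (fun k : int => `[a + k%:~R * p, a + k%:~R * p + p[%classic))//; last first.
  move=> x; have [k h1 h2] := tile_uniq a x p0; exists k; first by rewrite /= in_itv.
  by move=> j; rewrite /= in_itv/=; exact: h2.
rewrite integral_esum//.
  by apply: eq_esum => k _; rewrite integral_shift_itv.
move=> k; apply: measurable_funTS; apply: (measurableT_comp mf).
by apply: measurable_funD => //; exact: measurable_cst.
Qed.

Lemma integral_periodize2 (a b p q : R) (f : plane R -> \bar R) : 0 < p -> 0 < q ->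
  measurable_fun setT f -> (forall x, (0 <= f x)%E) ->
  (\int[mu2 R]_x f x =
   \int[mu2 R]_(x in `[a, (a + p)%R[ `*` `[b, (b + q)%R[)
     (\esum_(k in [set: int * int]) f (x.1 + k.1%:~R * p, x.2 + k.2%:~R * q)%R))%E.
Proof.
move=> p0 q0 mf f0.
have mBox (a' b' : R) : measurable (`[a', a' + p[ `*` `[b', b' + q[ : set (plane R)).
  by apply: measurableX; exact: measurable_itv.
have mS (k : int * int) : measurable_fun setT (fun x : plane R => f (x.1 + k.1%:~R * p, x.2 + k.2%:~R * q)).
  exact: (measurableT_comp mf (plane_shift_preserving (k.1%:~R * p, k.2%:~R * q)).1).
rewrite (@integral_tiling R _ (plane R) (mu2 R) (int * int)%type
  (fun k => `[a + k.1%:~R * p, a + k.1%:~R * p + p[ `*` `[b + k.2%:~R * q, b + k.2%:~R * q + q[))//; last first.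
  move=> [x y]; have [k h1 h2] := tile_uniq a x p0; have [l g1 g2] := tile_uniq b y q0.
  exists (k, l); first by split; rewrite /= in_itv.
  by move=> [k' l'] [] /=; rewrite !in_itv/= => /h2 -> /g2 ->.
rewrite integral_esum//; last by move=> k; exact: measurable_funTS.
apply: eq_esum => k _; rewrite integral_mkcond [RHS]integral_mkcond.
rewrite -(plane_shift_preserving (k.1%:~R * p, k.2%:~R * q)).2; last 2 first.
- by apply/(measurable_restrictT _ _).1 => //; exact: measurable_funTS.
- by move=> x; rewrite patchE; case: ifP.
apply: eq_integral => x _; rewrite !patchE.
set A := (X in (if X then _ else _) = _); set B := (X in _ = (if X then _ else _)).
suff -> : A = B by [].
by apply/idP/idP; rewrite /A /B !inE /= !in_itv /= => -[/andP[h1 h2] /andP[h3 h4]];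
  split; apply/andP; split; lra.
Qed.

End Periodization.

(** * Fourier series *)

Section Characters.
Context {R : realType}.
Implicit Types (s t : R).

Lemma cexp2piD s t : cexp2pi (s + t) = cexp2pi s * cexp2pi t.
Proof.
by apply: complex_ext => /=; rewrite !mulrDr ?cosD ?sinD; ring.
Qed.

Lemma cexp2pi0 : cexp2pi 0 = 1 :> R[i].
Proof. by apply: complex_ext; rewrite /= mulr0 ?cos0 ?sin0. Qed.

Lemma cexp2piN s : cexp2pi (- s) = (cexp2pi s)^*.
Proof. by apply: complex_ext; rewrite /= mulrN ?cosN ?sinN. Qed.

Lemma sqn_cexp2pi s : sqn (cexp2pi s) = 1.
Proof. by rewrite /sqn /= cos2Dsin2. Qed.

Lemma cexp2pi_nat (n : nat) : cexp2pi (n%:R : R) = 1.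
Proof.
elim: n => [|n ih]; first exact: cexp2pi0.
rewrite -natr1 cexp2piD ih mul1r; apply: complex_ext; rewrite /= mulr1.
  by rewrite mulr_natl cos2pi.
by rewrite mulr_natl sin2pi.
Qed.

Lemma cexp2pi_int (k : int) : cexp2pi (k%:~R : R) = 1.
Proof.
case: k => n; first exact: cexp2pi_nat.
by rewrite NegzE rmorphN/= cexp2piN cexp2pi_nat rmorph1.
Qed.

Lemma measurable_cexp2pi d (T : measurableType d) (h : T -> R) :
  measurable_fun setT h -> cmeasurable (fun x => cexp2pi (h x)).
Proof.
move=> mh; have m2 : measurable_fun setT (fun x => 2 * pi * h x).
  by apply: measurable_funM => //; exact: measurable_cst.
split => /=.
  apply: (measurableT_comp _ m2); apply: continuous_measurable_fun; exact: continuous_cos.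
apply: (measurableT_comp _ m2); apply: continuous_measurable_fun; exact: continuous_sin.
Qed.

End Characters.

Section SmoothStep.
Context {R : realType}.
Implicit Types y : R.

Definition step3 y := 3 * y ^+ 2 - 2 * y ^+ 3.

Lemma step3_itv y : 0 <= y <= 1 -> 0 <= step3 y <= 1.
Proof.
move=> /andP[y0 y1]; rewrite /step3; apply/andP; split.
  rewrite (_ : _ - _ = y ^+ 2 * (3 - 2 * y)); last by ring.
  by rewrite mulr_ge0 ?sqr_ge0//; lra.
rewrite -subr_ge0 (_ : _ - _ = (1 - y) ^+ 2 * (1 + 2 * y)); last by ring.
by rewrite mulr_ge0 ?sqr_ge0//; lra.
Qed.

Lemma step3_onem y : step3 (1 - y) = 1 - step3 y.
Proof. by rewrite /step3; ring. Qed.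

Lemma iter_step3_itv n y : 0 <= y <= 1 -> 0 <= iter n step3 y <= 1.
Proof. by move=> hy; elim: n => //= n; exact: step3_itv. Qed.

Lemma iter_step3_onem n y : iter n step3 (1 - y) = 1 - iter n step3 y.
Proof. by elim: n => //= n ->; exact: step3_onem. Qed.

Lemma iter_step3_lt n y : 0 <= y < 2^-1 ->
  iter n step3 y <= y * (y * (3 - 2 * y)) ^+ n.
Proof.
move=> /andP[y0 y1]; set r := y * (3 - 2 * y).
have r0 : 0 <= r by rewrite /r mulr_ge0//; lra.
have r1 : r <= 1.
  by rewrite -subr_ge0 /r (_ : _ - _ = (1 - y) * (1 - 2 * y)); [rewrite mulr_ge0//; lra|ring].
elim: n => [|n ih] /=; first by rewrite mulr1.
have /andP[z0 z1] : 0 <= iter n step3 y <= 1 by apply: iter_step3_itv; apply/andP; split; lra.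
have zy : iter n step3 y <= y.
  by rewrite (le_trans ih)// ler_piMr// exprn_ile1.
move: z0 zy ih; set z := iter n step3 y => z0 zy ih.
rewrite /step3 (_ : _ - _ = z * (z * (3 - 2 * z))); last by ring.
rewrite exprSr (mulrA y) ler_pM//; first by rewrite mulr_ge0//; lra.
rewrite -subr_ge0 /r (_ : _ - _ = (y - z) * (3 - 2 * (y + z))); last by ring.
by rewrite mulr_ge0//; lra.
Qed.

Lemma iter_step3_cvg0 y : 0 <= y < 2^-1 -> (fun n => iter n step3 y) @ \oo --> (0 : R).
Proof.
move=> hy; have /andP[y0 y1] := hy.
have r0 : 0 <= y * (3 - 2 * y) by rewrite mulr_ge0//; lra.
have r1 : y * (3 - 2 * y) < 1.
  by rewrite -subr_gt0 (_ : _ - _ = (1 - y) * (1 - 2 * y)); [rewrite mulr_gt0//; lra|ring].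
apply: (@squeeze_cvgr _ _ _ _ (cst 0) (fun n => y * (y * (3 - 2 * y)) ^+ n)).
- apply: nearW => n; rewrite iter_step3_lt// andbT.
  by have /andP[] : 0 <= iter n step3 y <= 1 by apply: iter_step3_itv; apply/andP; split; lra.
- exact: cvg_cst.
- rewrite -[X in _ --> X](mulr0 y); apply: cvgM; first exact: cvg_cst.
  by apply: cvg_expr; rewrite ger0_norm.
Qed.

(** The iterates of [step3] on [[0, 1]] tend to the indicator of
    [[y > 1/2]]: this is how polynomials in one trigonometric function come to
    approximate indicators of arcs. *)
Lemma iter_step3_cvg1 y : 2^-1 < y <= 1 -> (fun n => iter n step3 y) @ \oo --> (1 : R).
Proof.
move=> /andP[y0 y1]; rewrite (_ : (fun n => _) = (fun n => 1 - iter n step3 (1 - y))).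
  rewrite -[X in _ --> X](subr0 1); apply: cvgB; first exact: cvg_cst.
  by apply: iter_step3_cvg0; apply/andP; split; lra.
by apply/funext => n; rewrite iter_step3_onem subKr.
Qed.

Definition step3_poly (p0 : {poly R}) n := iter n (fun p => 3%:P * p ^+ 2 - 2%:P * p ^+ 3) p0.

Lemma horner_step3 p0 n u : (step3_poly p0 n).[u] = iter n step3 p0.[u].
Proof.
elim: n => //= n ih.
by rewrite hornerD hornerN !hornerM !hornerC -/(step3_poly p0 n) ih /step3; ring.
Qed.

End SmoothStep.

Section FourierUniqueness.
Context {R : realType}.
Variables (a nu : R).
Hypothesis nu0 : 0 < nu.
Local Notation p := (nu^-1).
Local Notation mu := (mu1 R).
Local Notation D := `[a, a + p[%classic.
Let mD : measurable (D : set (line R)). Proof. exact: measurable_itv. Qed.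

Let p0 : 0 < p. Proof. by rewrite invr_gt0. Qed.

(** Iterating [step3] on an affine function of the cosine centered at the arc
    gives bounded polynomials in that cosine that tend to the indicator of the
    arc; dominated convergence then applies. *)
Lemma arc_integral0 (f : line R -> R) (c e : R) :
  mu.-integrable D (EFin \o f) ->
  (forall (x0 : R) (P : {poly R}),
     \int[mu]_(x in D) (f x * P.[cos (2 * pi * (nu * (x - x0)))]) = 0) ->
  a <= c -> c < e -> e <= a + p ->
  \int[mu]_(x in D) (f x * \1_(`]c, e[) x) = 0.
Proof.
move=> fi hf ac ce eb; pose x0 := (c + e) / 2; pose r := (e - c) / 2.
pose u (x : R) := cos (2 * pi * (nu * (x - x0))).
pose c0 := cos (2 * pi * (nu * r)).
(* The affine rescaling takes the value 1/2 at the ends of the arc and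
   exceeds it inside only, so that the iterates of step3 tend to the
   indicator. *)
pose P0 : {poly R} := 4^-1%:P * ('X - c0%:P) + 2^-1%:P.
pose y x := P0.[u x].
have yE x : y x = 4^-1 * (u x - c0) + 2^-1 by rewrite /y /P0 !hornerE.
have hy x : 0 <= y x <= 1.
  have := cos_max (2 * pi * (nu * (x - x0))); rewrite -/(u x).
  have := cos_max (2 * pi * (nu * r)); rewrite -/c0 !ler_norml yE.
  by move=> /andP[? ?] /andP[? ?]; apply/andP; split; lra.
have mf : measurable_fun D f by apply/measurable_EFinP; exact: measurable_int fi.
have mu_ : measurable_fun setT (u : line R -> R).
  apply: (measurableT_comp (f := @cos R)).
    by apply: continuous_measurable_fun; exact: continuous_cos.
  do 2 (apply: measurable_funM; first exact: measurable_cst).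
  by apply: measurable_funB => //; exact: measurable_cst.
have my : measurable_fun setT (y : line R -> R).
  have -> : y = (fun x => 4^-1 * (u x - c0) + 2^-1) by apply/funext => x; exact: yE.
  apply: measurable_funD => //; apply: measurable_funM => //.
  by apply: measurable_funB.
have mstep n : measurable_fun setT (fun x : line R => iter n step3 (y x)).
  elim: n => //= n ih; rewrite /step3; apply: measurable_funB;
    by apply: measurable_funM => //; exact: measurable_funX.
have pin x : x \in D -> x != a -> x != c -> x != e ->
    (fun n => iter n step3 (y x)) @ \oo --> (\1_(`]c, e[) x : R).
  rewrite inE /= in_itv /= => /andP[ax xb] xa xc xe.
  have ax' : a < x by rewrite lt_neqAle eq_sym xa.
  have pi0 := pi_gt0 R.
  have rP : 0 < r by rewrite /r; lra.
  have r2 : 2 * r <= p by rewrite /r; lra.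
  have t0 : 0 < nu * r by rewrite mulr_gt0.
  have t1 : nu * r <= 2^-1.
    by rewrite -(ler_pM2l p0) mulKf ?gt_eqF//; lra.
  have pos (s : R) : 0 <= s -> 0 <= 2 * pi * s by move=> s0; rewrite !mulr_ge0// ltW.
  have inI (s : R) : 0 <= s <= 2^-1 -> 2 * pi * s \in `[0, pi].
    move=> /andP[s0 s1]; rewrite in_itv /= pos//=.
    have : pi * s <= pi * 2^-1 by rewrite ler_pM2l.
    by lra.
  pose z := nu * `|x - x0|.
  have uE : u x = cos (2 * pi * z).
    rewrite /u /z; case: (ger0P (x - x0)) => // _.
    by rewrite mulrN mulrN cosN.
  have z0 : 0 <= z by rewrite mulr_ge0// ltW.
  have z1 : z < 1 - nu * r.
    rewrite -(ltr_pM2l p0) mulrBr mulr1 !mulKf ?gt_eqF//.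
    by rewrite ltr_norml /x0 /r; apply/andP; split; lra.
  have lt_mono (s t : R) : 0 <= s <= 2^-1 -> 0 <= t <= 2^-1 -> s < t ->
      cos (2 * pi * t) < cos (2 * pi * s).
    move=> hs ht st; rewrite ltr_cos ?inI//.
    have : pi * s < pi * t by rewrite ltr_pM2l.
    by lra.
  have cos_refl (s : R) : cos (2 * pi * s) = cos (2 * pi * (1 - s)).
    rewrite -[RHS]cosN (_ : - (2 * pi * (1 - s)) = 2 * pi * s - pi *+ 2); last first.
      by rewrite -mulr_natl; ring.
    by rewrite -[RHS]cosD2pi subrK.
  have [xin|xin] := boolP (c < x < e).
    rewrite indicE mem_set /= ?in_itv//; apply: iter_step3_cvg1.
    have /andP[_ ->] := hy x; rewrite andbT yE.
    suff : c0 < u x by lra.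
    have zr : z < nu * r.
      rewrite /z ltr_pM2l// ltr_norml /x0 /r; move: xin => /andP[? ?].
      by apply/andP; split; lra.
    by rewrite uE /c0; apply: lt_mono => //; apply/andP; split; lra.
  rewrite indicE memNset /= ?in_itv; last exact/negP.
  apply: iter_step3_cvg0; have /andP[-> _] := hy x; rewrite /= yE.
  suff : u x < c0 by lra.
  have zr : nu * r < z.
    rewrite /z ltr_pM2l// lt_neqAle; apply/andP; split.
      apply/negP => /eqP rE; move: xc xe; case: (ger0P (x - x0)) rE => _ rE /eqP xc /eqP xe.
        by apply: xe; move: rE; rewrite /r /x0; lra.
      by apply: xc; move: rE; rewrite /r /x0; lra.
    rewrite leNgt; apply: contra xin; rewrite ltr_norml /x0 /r => /andP[? ?].
    by apply/andP; split; lra.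
  rewrite uE /c0; have [z2|z2] := leP z 2^-1.
    by apply: lt_mono => //; apply/andP; split; lra.
  by rewrite cos_refl; apply: lt_mono; try (apply/andP; split); lra.
have int0 n : (\int[mu]_(x in D) (f x * iter n step3 (y x))%:E = 0)%E.
  have := hf x0 (step3_poly P0 n); rewrite /Rintegral.
  under eq_integral do rewrite horner_step3.
  have fin : (\int[mu]_(x in D) (f x * iter n step3 (y x))%:E)%E \is a fin_num.
    apply: integrable_fin_num => //; apply: le_integrable fi => //.
      by apply/measurable_EFinP; apply: measurable_funM => //; exact: measurable_funTS.
    move=> x _ /=; rewrite lee_fin normrM ler_piMr//.
    by have /andP[? ?] := iter_step3_itv n (hy x); rewrite ger0_norm.
  by move=> h; rewrite -(fineK fin) [X in X%:E]h.
have aeD : {ae mu, forall x, D x ->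
    (fun n => (f x * iter n step3 (y x))%:E) @ \oo --> (f x * \1_(`]c, e[) x)%:E}.
  exists ([set a] `|` [set c] `|` [set e]); split.
  - by do 2 (apply: measurableU => //).
  - apply: countable_lebesgue_measure0; apply: finite_set_countable.
    by rewrite !finite_setU; split; [split|].
  - move=> x /= /not_implyP[Dx hx].
    have [->|xa] := eqVneq x a; first by left; left.
    have [->|xc] := eqVneq x c; first by left; right.
    have [->|xe] := eqVneq x e; first by right.
    exfalso; apply: hx; apply/fine_cvgP; split; first exact: nearW.
    apply: cvgM; first exact: cvg_cst.
    by apply: pin => //; rewrite inE.
have [] := @dominated_convergence _ _ _ mu D mD (fun n x => (f x * iter n step3 (y x))%:E)
  (fun x => (f x * \1_(`]c, e[) x)%:E) (fun x => `|(f x)%:E|)%E.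
- by move=> n; apply/measurable_EFinP; apply: measurable_funM => //; exact: measurable_funTS.
- apply/measurable_EFinP; apply: measurable_funM => //; apply: measurable_funTS; exact: measurable_indic.
- exact: aeD.
- exact: integrable_abse.
- apply: aeW => x n _ /=; rewrite lee_fin normrM ler_piMr//.
  by have /andP[? ?] := iter_step3_itv n (hy x); rewrite ger0_norm.
move=> _ _; under [X in X @ _ --> _]eq_fun do rewrite int0.
move=> h; rewrite /Rintegral; suff -> : (\int[mu]_(x in D) (f x * \1_(`]c, e[) x)%:E = 0)%E by [].
by rewrite -(cvg_lim _ h)//; apply/cvg_lim => //; exact: cvg_cst.
Qed.

(** Integrals over all arcs determine the indefinite integral, and Lebesgue's
    differentiation theorem recovers the function. *)
Lemma fourier_total_real (f : line R -> R) : measurable_fun setT f ->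
  mu.-integrable D (EFin \o f) ->
  (forall (x0 : R) (P : {poly R}),
     \int[mu]_(x in D) (f x * P.[cos (2 * pi * (nu * (x - x0)))]) = 0) ->
  {ae mu, forall x, D x -> f x = 0}.
Proof.
move=> mf fi hf; pose g := f \_ D.
have gi : mu.-integrable setT (EFin \o g).
  by rewrite /g -restrict_EFin; apply/(integrable_mkcond _ mD).
have gint0 (x : R) : \int[mu]_(t in `]-oo, x]) g t = 0.
  rewrite /g -Rintegral_mkcondr setIC.
  have [xa|ax] := leP x a.
    rewrite /Rintegral (@integral_Sset1 _ _ _ a)// => t [] /=; rewrite !in_itv/=.
    by move=> /andP[at_ _] tx; lra.
  pose e := Num.min x (a + p).
  have ae : a < e by rewrite lt_min ax ltrDl.
  have ep : e <= a + p by rewrite ge_min lexx orbT.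
  have := arc_integral0 fi hf (lexx a) ae ep.
  rewrite (_ : (fun t => f t * _) = f \_ `]a, e[%classic); last first.
    by apply/funext => t; rewrite patchE indicE; case: ifP => _; rewrite ?mulr1 ?mulr0.
  rewrite -Rintegral_mkcondr => h.
  have mfE (E : set (line R)) : measurable_fun E (fun t => (f t)%:E).
    by apply: measurable_funTS; exact/measurable_EFinP.
  rewrite (_ : D `&` `]a, e[%classic = `]a, e[%classic) in h; last first.
    apply/seteqP; split => t /= []//; rewrite !in_itv/= => /andP[ta te].
    by split; rewrite ?ta ?te//; apply/andP; split; lra.
  rewrite (_ : D `&` _ = [set` Interval (BSide true a) (BSide (~~ (x < a + p)) e)]); last first.
    rewrite /e; apply/seteqP; split => t /=; rewrite !in_itv/= minElt.
      by move=> [/andP[? ?] ?]; case: ifPn => /= h'; apply/andP; split; lra.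
    by case: ifPn => /= h' /andP[? ?]; (split; [apply/andP; split|]); lra.
  by rewrite /Rintegral (integral_itv_bndoo _ _ (mfE _)) -[LHS]/(Rintegral _ _ _).
have := @FTC1Ny R g _ _.
have gii (y : R) : mu.-integrable `]-oo, y] (EFin \o g).
  by apply: integrableS gi => //; exact: measurable_itv.
move=> /(_ gii (open_integrable_locally openT gi)).
apply: filterS; first exact: (ae_filter_ringOfSetsType mu).
move=> x [_]; rewrite (_ : (fun x => _) = cst 0); last first.
  by apply/funext => y; exact: gint0.
by rewrite derive1_cst => gx Dx; rewrite gx /g patchE mem_set.
Qed.

End FourierUniqueness.

Lemma esumZl {R : realType} {I : choiceType} (c : R) (a : I -> R) : 0 <= c ->
  (forall i, 0 <= a i) ->
  (\esum_(i in [set: I]) (c * a i)%:E = c%:E * \esum_(i in [set: I]) (a i)%:E)%E.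
Proof.
have key (b : I -> R) (k : R) : 0 < k -> (forall i, 0 <= b i) ->
    (\esum_(i in [set: I]) (k * b i)%:E <= k%:E * \esum_(i in [set: I]) (b i)%:E)%E.
  move=> k0 b0; apply: esum_le_fset => [i|A]; first by rewrite mulr_ge0// ltW.
  by rewrite -mulr_sumr EFinM lee_pmul2l// fset_sum_le_esum.
rewrite le_eqVlt => /predU1P[<- _|c0 a0].
  by rewrite mul0e esum1// => i _; rewrite mul0r.
apply/eqP; rewrite eq_le key//=.
rewrite -lee_pdivlMl// (le_trans _ (key _ c^-1 _ _)) ?invr_gt0//; last first.
  by move=> i; rewrite mulr_ge0// ltW.
by under [leRHS]eq_esum do rewrite mulKf ?gt_eqF//.
Qed.

Section ParametricIntegral.
Context {R : realType} {d1 d2 : measure_display}.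
Context {T1 : measurableType d1} {T2 : measurableType d2}.
Variable m2 : {sigma_finite_measure set T2 -> \bar R}.

Lemma measurable_Rintegral_param (K : T1 * T2 -> R) : measurable_fun setT K ->
  measurable_fun setT (fun x => \int[m2]_y K (x, y)).
Proof.
move=> mK; have mKE : measurable_fun setT (EFin \o K) by exact/measurable_EFinP.
apply: (@measurableT_comp _ _ _ _ _ _ fine) => //.
rewrite (_ : (fun x => _) = (fun x => \int[m2]_y (EFin \o K)^\+ (x, y) -
   \int[m2]_y (EFin \o K)^\- (x, y))%E); last first.
  apply/funext => x; rewrite integralE; congr (_ - _)%E;
    apply: eq_integral => y _; rewrite ?funeposE ?funenegE//.
apply: emeasurable_funB.
- apply: (measurable_fun_fubini_tonelli_F (EFin \o K)^\+%E) => //.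
  exact: measurable_funepos.
- apply: (measurable_fun_fubini_tonelli_F (EFin \o K)^\-%E) => //.
  exact: measurable_funeneg.
Qed.

Lemma cmeasurable_param (K : T1 * T2 -> R[i]) : cmeasurable K ->
  cmeasurable (fun x => cintegral m2 setT (fun y => K (x, y))).
Proof.
by move=> [Kr Ki]; split; [exact: (measurable_Rintegral_param Kr)|exact: (measurable_Rintegral_param Ki)].
Qed.

End ParametricIntegral.

Section FourierBasis.
Context {R : realType}.
Variables (a nu : R).
Hypothesis nu0 : 0 < nu.
Local Notation p := (nu^-1).
Local Notation mu := (mu1 R).
Local Notation D := `[a, a + p[%classic.

Definition echar (k : int) : line R -> R[i] := fun t => cexp2pi (k%:~R * nu * t).

Lemma measurable_period_itv : measurable (D : set (line R)).
Proof. exact: measurable_itv. Qed.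
Local Notation mD := measurable_period_itv.
Local Notation m := (mrestr mu mD).

Let p0 : 0 < p. Proof. by rewrite invr_gt0. Qed.
Let mDp : m setT = p%:E.
Proof.
rewrite /= /mrestr setTI lebesgue_measure_itv /= lte_fin ltrDl p0 -EFinD.
by congr EFin; ring.
Qed.

Lemma measurable_echar k : cmeasurable (echar k).
Proof.
apply: measurable_cexp2pi; apply: measurable_funM => //; exact: measurable_cst.
Qed.

Lemma L2_bounded (g : line R -> R[i]) (C : R) : cmeasurable g ->
  (forall x, sqn (g x) <= C) -> L2 m g.
Proof.
move=> mg hg; apply/L2P; split => //.
apply: (@le_lt_trans _ _ (\int[m]_x C%:E)%E).
  apply: ge0_le_integral => //; [by move=> x _; rewrite lee_fin sqn_ge0|
    exact: measurable_sqnE|by move=> x _; rewrite lee_fin].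
rewrite integral_cst// [X in (_ * X)%E](_ : _ = p%:E); last exact: mDp.
by rewrite -EFinM ltry.
Qed.

Lemma L2_echar k : L2 m (echar k).
Proof.
apply: (@L2_bounded _ 1); first exact: measurable_echar.
by move=> x; rewrite sqn_cexp2pi.
Qed.

Let int_cos_sin (k : int) : k != 0 ->
  (\int[mu]_(t in D) cos (2 * pi * (k%:~R * nu * t)) = 0) /\
  (\int[mu]_(t in D) sin (2 * pi * (k%:~R * nu * t)) = 0).
Proof.
move=> k0; pose c := 2 * pi * (k%:~R * nu).
have c0 : c != 0.
  apply: mulf_neq0; last by rewrite mulf_neq0 ?intr_eq0// gt_eqF.
  by rewrite mulf_neq0// gt_eqF// pi_gt0.
have cE t : 2 * pi * (k%:~R * nu * t) = c * t by rewrite /c; ring.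
have per t : cos (c * (t + p)) = cos (c * t) /\ sin (c * (t + p)) = sin (c * t).
  have : cexp2pi (k%:~R * nu * (t + p)) = cexp2pi (k%:~R * nu * t).
    rewrite mulrDr -(mulrA _ nu p) mulfV ?gt_eqF// mulr1 cexp2piD.
    by rewrite cexp2pi_int mulr1.
  by rewrite /cexp2pi !cE => -[-> ->].
have ab : a < a + p by rewrite ltrDl.
have dlin (x : R) : is_derive x 1 (fun t => c * t) c.
  by apply: is_derive_eq; rewrite /GRing.scale /=; ring.
split.
- under eq_Rintegral do rewrite cE.
  rewrite /Rintegral integral_itv_bndo_bndc; last first.
    apply: measurable_funTS; apply/measurable_EFinP.
    apply: (measurableT_comp (f := @cos R)); first by apply: continuous_measurable_fun; exact: continuous_cos.
    by apply: measurable_funM => //; exact: measurable_cst.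
  have dF (x : R) : is_derive x 1 (fun t => c^-1 * sin (c * t)) (cos (c * x)).
    apply: is_derive_eq; rewrite /GRing.scale /=.
    by field.
  rewrite (@continuous_FTC2 R _ (fun t => c^-1 * sin (c * t)))//.
  + by rewrite (per a).2 -EFinB subrr.
  + apply: continuous_subspaceT => x; apply: continuous_comp.
      by apply: continuousM; [exact: cvg_cst|exact: cvg_id].
    exact: continuous_cos.
  + have cF : continuous (fun t => c^-1 * sin (c * t)).
      by move=> x; apply/differentiable_continuous/derivable1_diffP; apply: ex_derive.
    by split => [x _||]; [exact: ex_derive|exact/cvg_at_right_filter/cF|exact/cvg_at_left_filter/cF].
  + by move=> x _; rewrite derive1E; apply: derive_val.
- under eq_Rintegral do rewrite cE.
  rewrite /Rintegral integral_itv_bndo_bndc; last first.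
    apply: measurable_funTS; apply/measurable_EFinP.
    apply: (measurableT_comp (f := @sin R)); first by apply: continuous_measurable_fun; exact: continuous_sin.
    by apply: measurable_funM => //; exact: measurable_cst.
  have dF (x : R) : is_derive x 1 (fun t => (- c^-1) * cos (c * t)) (sin (c * x)).
    apply: is_derive_eq; rewrite /GRing.scale /=.
    by field.
  rewrite (@continuous_FTC2 R _ (fun t => (- c^-1) * cos (c * t)))//.
  + by rewrite (per a).1 -EFinB subrr.
  + apply: continuous_subspaceT => x; apply: continuous_comp.
      by apply: continuousM; [exact: cvg_cst|exact: cvg_id].
    exact: continuous_sin.
  + have cF : continuous (fun t => (- c^-1) * cos (c * t)).
      by move=> x; apply/differentiable_continuous/derivable1_diffP; apply: ex_derive.
    by split => [x _||]; [exact: ex_derive|exact/cvg_at_right_filter/cF|exact/cvg_at_left_filter/cF].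
  + by move=> x _; rewrite derive1E; apply: derive_val.
Qed.

Lemma echarB i j t : echar i t * (echar j t)^* = echar (i - j) t.
Proof.
by rewrite /echar -cexp2piN -cexp2piD rmorphB/=; congr cexp2pi; ring.
Qed.

Lemma echar_orth i j :
  inner m (echar i) (echar j) = if i == j then p%:C else 0.
Proof.
have -> : inner m (echar i) (echar j) = cintegral m setT (echar (i - j)).
  by congr cintegral; apply/funext => t; exact: echarB.
have [->|ij] := eqVneq i j.
  rewrite subrr; apply: complex_ext => /=.
    rewrite Rintegral_mrestr; last by case: (measurable_echar 0).
    under eq_Rintegral do rewrite !mul0r mulr0 cos0.
    rewrite Rintegral_cst ?mul1r; last exact: mD.
    by rewrite [X in fine X](_ : _ = p%:E)//; move: mDp; rewrite /= /mrestr setTI.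
  rewrite Rintegral_mrestr; last by case: (measurable_echar 0).
  under eq_Rintegral do rewrite !mul0r mulr0 sin0.
  by rewrite Rintegral_cst ?mul0r//; exact: mD.
have := int_cos_sin; move=> /(_ (i - j)); rewrite subr_eq0 => /(_ ij)[h1 h2].
by apply: complex_ext => /=; rewrite Rintegral_mrestr//; case: (measurable_echar (i - j)).
Qed.

(** Each translated cosine is a combination of two characters, so the
    orthogonality to all characters passes to all polynomials in translated
    cosines, as [fourier_total_real] requires of both parts of f. *)
Lemma echar_total (f : line R -> R[i]) : L2 m f ->
  (forall k, inner m f (echar k) = 0) -> nsq m f = 0%E.
Proof.
move=> hf hk; have mf := L2_cmeas hf.
pose u x0 (x : line R) := cos (2 * pi * (nu * (x - x0))).
have mu_ x0 : measurable_fun setT (u x0).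
  apply: (measurableT_comp (f := @cos R)).
    by apply: continuous_measurable_fun; exact: continuous_cos.
  do 2 (apply: measurable_funM; first exact: measurable_cst).
  by apply: measurable_funB => //; exact: measurable_cst.
have hu x0 x : `|u x0 x| <= 1 by exact: cos_max.
have L2u x0 n k : L2 m (fun x => ((u x0 x ^+ n)%:C * echar k x)).
  apply: (@L2_bounded _ 1).
    apply: cmeasurableM; last exact: measurable_echar.
    by apply: cmeasurable_real; exact: measurable_funX.
  move=> x; rewrite sqnM sqn_cexp2pi mulr1 sqnR -exprM mulnC exprM.
  by rewrite exprn_ile1// ?sqr_ge0// -real_normK ?num_real// expr_le1.
pose w x0 : R[i] := cexp2pi (nu * x0).
have uE x0 x : (u x0 x)%:C = 2^-1%:C * ((w x0)^* * echar 1 x + w x0 * (echar 1 x)^*).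
  rewrite /w /echar -!cexp2piN -!cexp2piD mul1r.
  have -> : - (nu * x0) + nu * x = nu * (x - x0) by ring.
  have -> : nu * x0 + - (nu * x) = - (nu * (x - x0)) by ring.
  by apply: complex_ext; rewrite /= mulrN ?cosN ?sinN /u /=; field.
have Z x0 n : forall k, inner m f (fun x => (u x0 x ^+ n)%:C * echar k x) = 0.
  elim: n => [|n ih] k.
    rewrite -[RHS](hk k); congr inner; apply/funext => x.
    by rewrite expr0 mul1r.
  rewrite (_ : (fun x => _) = (fun x =>
      (2^-1%:C * (w x0)^*) * ((u x0 x ^+ n)%:C * echar (k + 1) x) +
      (2^-1%:C * w x0) * ((u x0 x ^+ n)%:C * echar (k - 1) x))).
    rewrite innerDr//; try exact: L2Z.
    by rewrite !innerZr// !ih !mulr0 addr0.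
  apply/funext => x; rewrite exprSr rmorphM/= uE -echarB.
  have -> : echar (k + 1) x = echar k x * echar 1 x.
    by rewrite /echar -cexp2piD intrD; congr cexp2pi; ring.
  by ring.
have ZP x0 (P : {poly R}) : inner m f (fun x => (P.[u x0 x])%:C) = 0.
  rewrite (_ : (fun x => _) = fun x =>
     \sum_(i <- iota 0 (size P)) (P`_i)%:C * ((u x0 x ^+ i)%:C * echar 0 x)).
    rewrite inner_sumr//; last by move=> i; exact: L2Z.
    by rewrite big1_seq// => i _; rewrite innerZr// Z mulr0.
  apply/funext => x; rewrite horner_coef -(big_mkord xpredT (fun i => P`_i * u x0 x ^+ i)).
  rewrite /index_iota subn0 rmorph_sum; apply: eq_bigr => i _.
  by rewrite /echar !mul0r cexp2pi0 mulr1 rmorphM.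
have fi : cintegrable m f.
  have h1 : L2 m (fun=> 1).
    by apply: (@L2_bounded _ 1) => [|x]; [exact: cmeasurable_cst|rewrite sqnR expr1n].
  have := L2_mulJ_integrable hf h1; congr cintegrable; apply/funext => x.
  by rewrite rmorph1 mulr1.
have intD (g : line R -> R) : measurable_fun setT g ->
    m.-integrable setT (EFin \o g) -> mu.-integrable D (EFin \o g).
  move=> mg /integrableP[_ h]; apply/integrableP; split.
    by apply: measurable_funTS; exact/measurable_EFinP.
  rewrite -(ge0_integral_mrestr _ mD)//.
  by apply: measurableT_comp => //; exact/measurable_EFinP.
have mP x0 (P : {poly R}) : measurable_fun setT (fun x => P.[u x0 x]).
  under eq_fun do rewrite horner_coef.
  apply: measurable_sum => i; apply: measurable_funM; first exact: measurable_cst.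
  exact: measurable_funX.
have re0 : {ae mu, forall x, D x -> complex.Re (f x) = 0}.
  apply: (fourier_total_real nu0); [by case: mf|by apply: intD; [case: mf|case: fi]|].
  move=> x0 P; rewrite -(Rintegral_mrestr _ mD); last first.
    by apply: measurable_funM => //; [case: mf|exact: mP].
  have := congr1 (@complex.Re R) (ZP x0 P); rewrite /= => h; rewrite -[RHS]h.
  by apply: eq_Rintegral => x _; rewrite cReM cReJ cImJ /=; ring.
have im0 : {ae mu, forall x, D x -> complex.Im (f x) = 0}.
  apply: (fourier_total_real nu0); [by case: mf|by apply: intD; [case: mf|case: fi]|].
  move=> x0 P; rewrite -(Rintegral_mrestr _ mD); last first.
    by apply: measurable_funM => //; [case: mf|exact: mP].
  have := congr1 (@complex.Im R) (ZP x0 P); rewrite /= => h; rewrite -[RHS]h.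
  by apply: eq_Rintegral => x _; rewrite cImM cReJ cImJ /=; ring.
apply: nsq_eq0_ae => //; apply/(ae_mrestr _ mD).
have ae_f := ae_filter_ringOfSetsType mu.
by apply: filterS2 re0 im0 => x h1 h2 Dx; apply: complex_ext; [exact: h1|exact: h2].
Qed.

Lemma fourier_parseval f : L2 m f ->
  (\esum_(k in [set: int]) (sqn (inner m f (echar k)))%:E = (p * sqf m f)%:E)%E.
Proof.
move=> hf; have := parseval L2_echar p0 echar_orth echar_total hf.
have pc : p%:C != 0 by rewrite (inj_eq (@complexI _)) gt_eqF.
have E k : sqn (inner m f (echar k)) = p ^+ 2 * sqn (coef m echar p f k).
  by rewrite -sqnR -sqnM mulrC divfK.
move=> h; transitivity (\esum_(k in [set: int]) (p ^+ 2 * sqn (coef m echar p f k))%:E)%E.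
  by apply: eq_esum => k _; rewrite E.
rewrite esumZl ?sqr_ge0//; last by move=> k; exact: sqn_ge0.
by rewrite h -EFinM; congr EFin; field; rewrite gt_eqF.
Qed.

End FourierBasis.

(** * The spreading function as an isometry *)

Section NormLimits.
Context {R : realType} {d : measure_display} {T : measurableType d}.
Variable mu : {measure set T -> \bar R}.
Implicit Types (f g : T -> R[i]).

(** This closes the approximation arguments based on [sqnD_le]: with e the
    quality of the approximation, the right side tends to c. *)
Lemma ler_interp (x c : R) : 0 <= c ->
  (forall e, 0 < e -> x <= (1 + e) * c + (1 + e^-1) * e ^+ 2) -> x <= c.
Proof.
move=> c0 h; apply/ler_addgt0Pr => e e0.
pose k := Num.min 1 (e / (c + 2)).
have c2 : 0 < c + 2 by lra.
have k0 : 0 < k by rewrite /k lt_min ltr01 divr_gt0.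
have k1 : k <= 1 by rewrite /k ge_min lexx.
have ke : k * (c + 2) <= e by rewrite -ler_pdivlMr// /k ge_min lexx orbT.
apply: (le_trans (h k k0)).
rewrite (_ : (1 + k) * c + (1 + k^-1) * k ^+ 2 = c + (k * c + k ^+ 2 + k)); last first.
  by field; rewrite gt_eqF.
rewrite lerD2l (le_trans _ ke)// mulrDr -addrA lerD2l.
have k2 : k ^+ 2 <= k by rewrite expr2 ler_piMl// ltW.
by lra.
Qed.

Lemma nsq_le_approx f (c : R) : 0 <= c -> L2 mu f ->
  (forall e : R, 0 < e -> exists g, [/\ L2 mu g,
     (nsq mu (fun x => (f x - g x)%R) <= e%:E)%E & (nsq mu g <= c%:E)%E]) ->
  (nsq mu f <= c%:E)%E.
Proof.
move=> c0 hf h; rewrite (sqfE hf) lee_fin; apply: ler_interp => // e e0.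
have [g [hg g1 g2]] := h (e ^+ 2) (exprn_gt0 _ e0).
have mfg : cmeasurable (fun x => f x - g x) by apply: cmeasurableB; [case: hf|case: hg].
have := nsqD_le mu e0 (L2_cmeas hg) mfg.
rewrite (_ : (fun x => g x + (f x - g x)) = f); last by apply/funext => x; ring.
rewrite (sqfE hf) => /le_trans; rewrite -lee_fin; apply.
rewrite [leRHS]EFinD; apply: leeD; rewrite EFinM lee_wpmul2l// lee_fin.
  by lra.
by rewrite addr_ge0// invr_ge0 ltW.
Qed.

(** Continuity of the squared norm along a common approximation of two
    functions whose approximants have equal norms. *)
Lemma nsq_eq_approx d' (T' : measurableType d') (nu : {measure set T' -> \bar R})
    f (g : T' -> R[i]) : L2 mu f -> L2 nu g ->
  (forall e : R, 0 < e -> exists (f' : T -> R[i]) (g' : T' -> R[i]), [/\ L2 mu f', L2 nu g',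
     (nsq mu (fun x => (f x - f' x)%R) <= e%:E)%E,
     (nsq nu (fun x => (g x - g' x)%R) <= e%:E)%E & nsq mu f' = nsq nu g']) ->
  nsq mu f = nsq nu g.
Proof.
move=> hf hg h.
have key d1 (T1 : measurableType d1) (m1 : {measure set T1 -> \bar R}) d2
  (T2 : measurableType d2) (m2 : {measure set T2 -> \bar R}) (u : T1 -> R[i]) (v : T2 -> R[i]) :
  L2 m1 u -> L2 m2 v ->
  (forall e : R, 0 < e -> exists (u' : T1 -> R[i]) (v' : T2 -> R[i]), [/\ L2 m1 u', L2 m2 v',
     (nsq m1 (fun x => (u x - u' x)%R) <= e%:E)%E,
     (nsq m2 (fun x => (v x - v' x)%R) <= e%:E)%E & nsq m1 u' = nsq m2 v']) ->
  (nsq m1 u <= nsq m2 v)%E.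
  move=> hu hv huv; rewrite (sqfE hu) (sqfE hv) lee_fin.
  apply/ler_addgt0Pr => r r0.
  apply: ler_interp; first by rewrite addr_ge0 ?sqf_ge0// ltW.
  move=> e e0; pose k := Num.min (e ^+ 2) (Num.min 1 (r / (sqf m2 v + 2)) ^+ 2).
  set b := Num.min 1 _ in k.
  have v2 : 0 < sqf m2 v + 2 by rewrite ltr_wpDl// sqf_ge0.
  have b0 : 0 < b by rewrite /b lt_min ltr01 divr_gt0.
  have b1 : b <= 1 by rewrite /b ge_min lexx.
  have br : b * (sqf m2 v + 2) <= r by rewrite -ler_pdivlMr// /b ge_min lexx orbT.
  have k0 : 0 < k by rewrite /k lt_min !exprn_gt0.
  have ke : k <= e ^+ 2 by rewrite /k ge_min lexx.
  have kb : k <= b ^+ 2 by rewrite /k ge_min lexx orbT.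
  have [u' [v' [hu' hv' h1 h2 h3]]] := huv k k0.
  have m1' : cmeasurable (fun x => u x - u' x) by apply: cmeasurableB; [case: hu|case: hu'].
  have m2' : cmeasurable (fun x => v' x - v x) by apply: cmeasurableB; [case: hv'|case: hv].
  have := nsqD_le m1 e0 (L2_cmeas hu') m1'.
  rewrite (_ : (fun x => u' x + (u x - u' x)) = u); last by apply/funext => x; ring.
  have := nsqD_le m2 b0 (L2_cmeas hv) m2'.
  rewrite (_ : (fun x => v x + (v' x - v x)) = v'); last by apply/funext => x; ring.
  rewrite nsqBC in h2; rewrite h3 (sqfE hu) (sqfE hv) (sqfE hv').
  move: h1 h2; rewrite (sqfE (L2B hu hu')) (sqfE (L2B hv' hv)).
  rewrite -!EFinM -!EFinD !lee_fin => h1 h2 h4 h5.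
  apply: (le_trans h5); apply: lerD.
    rewrite ler_wpM2l; [by []|by lra|].
    apply: (le_trans h4).
    apply: (@le_trans _ _ ((1 + b) * sqf m2 v + (1 + b^-1) * b ^+ 2)).
      rewrite lerD2l ler_wpM2l//; first by rewrite addr_ge0// invr_ge0 ltW.
      exact: le_trans h2 kb.
    rewrite (_ : (1 + b) * _ + _ = sqf m2 v + (b * sqf m2 v + b ^+ 2 + b)); last first.
      by field; rewrite gt_eqF.
    rewrite lerD2l (le_trans _ br)// mulrDr -addrA lerD2l.
    have b2 : b ^+ 2 <= b by rewrite expr2 ler_piMl// ltW.
    by lra.
  rewrite ler_wpM2l//; first by rewrite addr_ge0// invr_ge0 ltW.
  exact: le_trans h1 ke.
apply/eqP; rewrite eq_le; apply/andP; split; first exact: key.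
apply: key => // e /h[f' [g' [? ? ? ? ?]]]; by exists g', f'.
Qed.

Lemma nsq_cutoff_lim (D : nat -> set T) f : (forall n, measurable (D n)) ->
  (forall x, exists N, forall n, (N <= n)%N -> D n x) -> L2 mu f ->
  forall e : R, 0 < e -> exists N, forall n, (N <= n)%N ->
    (nsq mu (fun x => (f x - cutoff (D n) f x)%R) <= e%:E)%E.
Proof.
move=> mD hD hf e e0; have mf := L2_cmeas hf.
have mc n : cmeasurable (fun x => f x - cutoff (D n) f x).
  by apply: cmeasurableB => //; exact: cmeasurable_cutoff.
have [] := @dominated_convergence _ _ _ mu setT measurableT
  (fun n x => (sqn (f x - cutoff (D n) f x))%:E) (fun=> 0%E) (fun x => (sqn (f x))%:E).
- by move=> n; exact: measurable_sqnE.
- exact: measurable_cst.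
- apply: aeW => x _; have [N hN] := hD x; apply: cvg_near_cst.
  exists N => // n /= /hN Dx; by rewrite /cutoff mem_set// subrr sqn0.
- exact: L2_integrable_sqn.
- apply: aeW => x n _; rewrite gee0_abs ?lee_fin ?sqn_ge0//.
  by rewrite /cutoff; case: ifP => _; rewrite ?subrr ?sqn0 ?subr0// sqn_ge0.
move=> _ _; rewrite integral0 => /fine_cvgP[[N1 _ hN1] /cvgrPdist_lt/(_ _ e0)[N2 _ hN2]].
exists (maxn N1 N2) => n; rewrite geq_max => /andP[/hN1 n1 /hN2 /=].
rewrite sub0r normrN => h; rewrite -[leLHS]fineK// lee_fin.
by rewrite (le_trans (ler_norm _))// ltW.
Qed.

Lemma ge0_ae_lty (F : T -> \bar R) : measurable_fun setT F ->
  (forall x, (0 <= F x)%E) -> (\int[mu]_x F x < +oo)%E ->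
  {ae mu, forall x, (F x < +oo)%E}.
Proof.
move=> mF F0 hF.
have : mu.-integrable setT F.
  by apply/integrableP; split => //; under eq_integral do rewrite gee0_abs//.
move/(integrable_ae measurableT); apply: filterS => x /(_ Logic.I).
by rewrite ge0_fin_numE.
Qed.

End NormLimits.

Section Plancherel.
Context {R : realType}.
Local Notation mu := (mu1 R).
Implicit Types f : line R -> R[i].

Definition fourier f : line R -> R[i] :=
  fun xi => cintegral mu setT (fun t => f t * cexp2pi (- (xi * t))).

Lemma cmeasurable_snd f : cmeasurable f -> cmeasurable (fun z : plane R => f z.2).
Proof. by move=> mf; apply: (cmeasurable_comp mf); exact: measurable_snd. Qed.

Lemma cmeasurable_fst f : cmeasurable f -> cmeasurable (fun z : plane R => f z.1).
Proof. by move=> mf; apply: (cmeasurable_comp mf); exact: measurable_fst. Qed.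

Lemma cmeasurable_fourier f : cmeasurable f -> cmeasurable (fourier f).
Proof.
move=> mf; apply: (@cmeasurable_param _ _ _ _ _ mu (fun z : plane R => f z.2 * cexp2pi (- (z.1 * z.2)))).
apply: cmeasurableM; first exact: cmeasurable_snd.
apply: measurable_cexp2pi; apply: measurable_funN; apply: measurable_funM.
  exact: measurable_fst.
exact: measurable_snd.
Qed.

(** Plancherel for compactly supported functions: Parseval's identity for the
    Fourier series of [f(t) e^{-2 i pi xi t}] on one interval, integrated
    over [xi] in one dual period. *)
Lemma plancherel_compact (a nu : R) f : 0 < nu -> L2 mu f ->
  (forall t, ~ (a <= t < a + nu^-1) -> f t = 0) ->
  nsq mu (fourier f) = nsq mu f.
Proof.
move=> nu0 hf supp; have mf := L2_cmeas hf.
pose m := mrestr mu (measurable_period_itv a nu).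
pose fx x t := f t * cexp2pi (- (x * t)).
have sqfx x t : sqn (fx x t) = sqn (f t) by rewrite sqnM sqn_cexp2pi mulr1.
have me x : cmeasurable (fun t : line R => cexp2pi (- (x * t))).
  by apply: measurable_cexp2pi; apply: measurable_funN; apply: measurable_funM.
have mfx x : cmeasurable (fx x) by exact: cmeasurableM.
have hfx x : L2 mu (fx x) by apply: (L2_le _ hf) => // t; rewrite sqfx.
have cutf (g : line R -> R[i]) : cutoff (`[a, a + nu^-1[%classic : set (line R)) (fun t : line R => f t * g t) =
    (fun t : line R => f t * g t).
  apply/funext => t; rewrite /cutoff; case: ifPn => // /negP; rewrite inE /= in_itv /= => ht.
  by rewrite supp ?mul0r.
have E x k : inner m (fx x) (echar nu k) = fourier f (x + k%:~R * nu).
  rewrite /inner cintegral_mrestr; last first.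
    by apply: cmeasurableM => //; apply: cmeasurableJ; exact: measurable_echar.
  rewrite cintegral_cutoff; congr cintegral.
  rewrite (_ : (fun x0 => _) = fun t : line R => f t * (cexp2pi (- (x * t)) * (echar nu k t)^*)).
    rewrite cutf; apply/funext => t; congr (_ * _).
    by rewrite /echar -cexp2piN -cexp2piD; congr cexp2pi; ring.
  by apply/funext => t; rewrite /fx mulrA.
have nE x : nsq m (fx x) = nsq mu f.
  rewrite -nsq_cutoff_mrestr// cutf; by apply: nsq_eq => t; rewrite sqfx.
have P x : (\esum_(k in [set: int]) (sqn (fourier f (x + k%:~R * nu)))%:E =
    (nu^-1)%:E * nsq mu f)%E.
  have := fourier_parseval nu0 (L2_mrestr (measurable_period_itv a nu) (hfx x)).
  rewrite EFinM -/m -(nE x) (sqfE (L2_mrestr _ (hfx x))) => <-.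
  by apply: eq_esum => k _; rewrite E.
rewrite {1}/nsq (integral_periodize 0 nu0); last 2 first.
- by apply: measurable_sqnE; exact: cmeasurable_fourier.
- by move=> x; rewrite lee_fin sqn_ge0.
under eq_integral do rewrite P.
rewrite integral_cst//= lebesgue_measure_itv/= add0r lte_fin nu0 oppr0 adde0.
by rewrite muleC muleA -EFinM mulfV ?gt_eqF// mul1e.
Qed.

End Plancherel.

Section Spreading.
Context {R : realType}.
Local Notation mu := (mu1 R).
Implicit Types (kappa eta : plane R -> R[i]) (f g h : line R -> R[i]).

Lemma ae_fst (P : R -> Prop) : {ae mu, forall x, P x} ->
  {ae mu2 R, forall z, P z.1}.
Proof.
move=> [N [mN N0 hN]]; exists (N `*` setT); split.
- exact: measurableX.
- by rewrite product_measure1E//= N0 mul0e.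
- by move=> z /= hz; split => //; exact: hN.
Qed.

Definition shear (z : plane R) : plane R := (z.2, z.2 - z.1).

Lemma measure_preserving_shear : measure_preserving (mu2 R) shear.
Proof.
have mp : measurable_fun setT (fun z : plane R => z.1 - z.2).
  by apply: measurable_funB; [exact: measurable_fst|exact: measurable_snd].
have sp := @shear_preserving R (fun z => z.1 - z.2) mp (fun x => reflect_preserving x).
have msh : measurable_fun setT shear.
  apply/measurable_fun_pairP; split => /=; first exact: measurable_snd.
  by apply: measurable_funB; [exact: measurable_snd|exact: measurable_fst].
split=> // f mf f0; rewrite -[RHS]sp.2//.
by rewrite -[RHS]swap_preserving//; exact: (measurableT_comp mf sp.1).
Qed.

Definition strip (N : nat) : set (plane R) := [set z | - N%:R <= z.1 <= N%:R].

Lemma measurable_strip N : measurable (strip N).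
Proof.
rewrite (_ : strip N = (`[- N%:R, N%:R]%classic : set (line R)) `*` setT).
  by apply: measurableX => //; exact: measurable_itv.
by apply/seteqP; split => [z /=|z [] /=]; rewrite in_itv/=.
Qed.

(** The truncations whose limit in norm is the spreading function. *)
Definition tspread N kappa : plane R -> R[i] := fun x =>
  cintegral mu `[- N%:R, N%:R]
    (fun t => kappa (t, t - x.1) * cexp2pi (- (x.2 * t))).

Lemma tspreadE N kappa x : tspread N kappa x =
  fourier (fun t => cutoff (strip N) kappa (shear (x.1, t))) x.2.
Proof.
rewrite /tspread cintegral_cutoff; congr cintegral; apply/funext => t.
rewrite /cutoff /shear /= (_ : ((t, t - x.1) \in strip N) = (t \in (`[- N%:R, N%:R]%classic : set R))).
  by case: ifP => // _; rewrite mul0r.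
by apply/idP/idP; rewrite !inE /strip /= ?in_itv.
Qed.

Lemma cmeasurable_slice kappa x : cmeasurable kappa ->
  cmeasurable (fun t : line R => kappa (shear (x, t))).
Proof.
move=> mk; apply: (cmeasurable_comp mk); apply: (measurableT_comp measure_preserving_shear.1).
exact: pair1_measurable.
Qed.

Lemma cmeasurable_tspread N kappa : cmeasurable kappa ->
  cmeasurable (tspread N kappa).
Proof.
move=> mk; rewrite (_ : tspread N kappa = fun x =>
  cintegral mu setT (fun t => cutoff (strip N) kappa (shear (x.1, t)) * cexp2pi (- (x.2 * t)))).
  apply: (@cmeasurable_param _ _ _ _ _ mu (fun z : plane R * line R =>
    cutoff (strip N) kappa (shear (z.1.1, z.2)) * cexp2pi (- (z.1.2 * z.2)))).
  have m11 : measurable_fun setT (fun z : plane R * line R => z.1.1).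
    by apply: (measurableT_comp measurable_fst); exact: measurable_fst.
  have m12 : measurable_fun setT (fun z : plane R * line R => z.1.2).
    by apply: (measurableT_comp measurable_snd); exact: measurable_fst.
  have m2 : measurable_fun setT (fun z : plane R * line R => z.2).
    exact: measurable_snd.
  apply: cmeasurableM.
    apply: (cmeasurable_comp (cmeasurable_cutoff (measurable_strip N) mk)).
    apply: (measurableT_comp measure_preserving_shear.1).
    by apply/measurable_fun_pairP; split; [exact: m11|exact: m2].
  apply: measurable_cexp2pi; apply: measurable_funN; apply: measurable_funM.
    exact: m12.
  exact: m2.
by apply/funext => x; exact: tspreadE.
Qed.

(** The shear turns the oblique lines along which the spreading function is
    computed into vertical ones, where Tonelli's theorem applies. *)
Lemma ae_slice_L2 kappa : L2 (mu2 R) kappa ->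
  {ae mu, forall b, L2 mu (fun t => kappa (shear (b, t)))}.
Proof.
move=> hk; have mk := L2_cmeas hk.
have hs := L2_preserving measure_preserving_shear hk.
have mE := measurable_sqnE (L2_cmeas hs).
have E : nsq (mu2 R) (fun z => kappa (shear z)) =
  (\int[mu]_b nsq mu (fun t => kappa (shear (b, t))))%E.
  apply: (fubini_tonelli1 (fun z => (sqn (kappa (shear z)))%:E)) => //.
  by move=> z; rewrite lee_fin sqn_ge0.
have := ge0_ae_lty (mu := mu) (F := fun b => nsq mu (fun t => kappa (shear (b, t)))) _ _ _.
have hm : measurable_fun setT (fun b => nsq mu (fun t => kappa (shear (b, t)))).
  apply: (measurable_fun_fubini_tonelli_F (fun z => (sqn (kappa (shear z)))%:E)) => //.
  by move=> z; rewrite lee_fin sqn_ge0.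
move=> /(_ hm (fun b => nsq_ge0 _ _)); rewrite -E => /(_ (L2_lty hs)).
by apply: filterS => b hb; apply/L2P; split => //; exact: cmeasurable_slice.
Qed.

(** Tonelli: Plancherel in the frequency variable for almost every time lag,
    then the measure-preserving change of variables [(b, t) -> (t, t - b)]. *)
Lemma nsq_tspread N kappa : L2 (mu2 R) kappa ->
  nsq (mu2 R) (tspread N kappa) = nsq (mu2 R) (cutoff (strip N) kappa).
Proof.
move=> hk; have mk := L2_cmeas hk.
have hc := L2_cutoff (measurable_strip N) hk.
have mT := cmeasurable_tspread N mk.
rewrite -(nsq_preserving measure_preserving_shear (L2_cmeas hc)).
have hs := L2_preserving measure_preserving_shear hc.
rewrite /nsq (fubini_tonelli1 (fun z => (sqn (tspread N kappa z))%:E))//; last 2 first.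
- exact: measurable_sqnE.
- by move=> z; rewrite lee_fin sqn_ge0.
rewrite (fubini_tonelli1 (fun z => (sqn (cutoff (strip N) kappa (shear z)))%:E))//; last 2 first.
- exact: measurable_sqnE (L2_cmeas hs).
- by move=> z; rewrite lee_fin sqn_ge0.
apply: ge0_ae_eq_integral => //.
- apply: (measurable_fun_fubini_tonelli_F (fun z => (sqn (tspread N kappa z))%:E)) => //.
  + exact: measurable_sqnE.
  + by move=> z; rewrite lee_fin sqn_ge0.
- apply: (measurable_fun_fubini_tonelli_F (fun z => (sqn (cutoff (strip N) kappa (shear z)))%:E)) => //.
  + exact: measurable_sqnE (L2_cmeas hs).
  + by move=> z; rewrite lee_fin sqn_ge0.
- by move=> b _; apply: integral_ge0 => z _; rewrite lee_fin sqn_ge0.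
- by move=> b _; apply: integral_ge0 => z _; rewrite lee_fin sqn_ge0.
apply: filterS (ae_slice_L2 hc) => b hb _; rewrite /fubini_F.
have nu0 : 0 < (N%:R *+ 2 + 1 : R)^-1 by rewrite invr_gt0 ltr_wpDl// mulrn_wge0.
transitivity (nsq mu (fourier (fun t => cutoff (strip N) kappa (shear (b, t))))).
  by apply: eq_integral => nu _; rewrite tspreadE.
apply: (plancherel_compact (a := - N%:R) nu0 hb) => t.
rewrite invrK => ht; rewrite /cutoff; case: ifPn => //; rewrite inE /strip /= => /andP[h1 h2].
by exfalso; apply: ht; rewrite h1 /= -mulr_natl; lra.
Qed.

Lemma L2_tspread N kappa : L2 (mu2 R) kappa -> L2 (mu2 R) (tspread N kappa).
Proof.
move=> hk; apply/L2P; split; first by apply: cmeasurable_tspread; case: hk.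
by rewrite nsq_tspread//; apply: L2_lty; apply: L2_cutoff => //; exact: measurable_strip.
Qed.

Lemma strip_absorbing (z : plane R) : exists N, forall n, (N <= n)%N -> strip n z.
Proof.
exists (Num.bound `|z.1|) => n hn; rewrite /strip /= -ler_norml.
by rewrite (le_trans (ltW (archi_boundP _)))// ler_nat.
Qed.

Lemma spreading_functionP kappa eta : L2 (mu2 R) kappa ->
  spreading_function kappa eta <-> L2 (mu2 R) eta /\
  forall e : R, 0 < e -> exists N, forall n, (N <= n)%N ->
    (nsq (mu2 R) (fun x => (eta x - tspread n kappa x)%R) <= e%:E)%E.
Proof.
move=> hk; rewrite /spreading_function; split => -[h1 h2]; split => //.
  move=> e e0; have /L2norm_cvg0P/(_ e e0)[N _ hN] := h2.
  by exists N => n nN; apply: ltW; exact: hN.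
apply/L2norm_cvg0P => e e0; have e2 : 0 < e / 2 by rewrite divr_gt0.
have [N hN] := h2 _ e2; exists N => // n /= nN.
by rewrite (le_lt_trans (hN _ nN))// lte_fin; lra.
Qed.

(** By [nsq_tspread] the truncations to strips have the same norm before and
    after the transform, and both converge. *)
Lemma spreading_isometry kappa eta : L2 (mu2 R) kappa ->
  spreading_function kappa eta -> nsq (mu2 R) eta = nsq (mu2 R) kappa.
Proof.
move=> hk /(spreading_functionP _ hk)[he h]; apply: nsq_eq_approx => // e e0.
have [N1 h1] := h e e0.
have [N2 h2] := nsq_cutoff_lim measurable_strip strip_absorbing hk e0.
pose N := maxn N1 N2; exists (tspread N kappa), (cutoff (strip N) kappa); split.
- exact: L2_tspread.
- by apply: L2_cutoff => //; exact: measurable_strip.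
- by apply: h1; exact: leq_maxl.
- by apply: h2; exact: leq_maxr.
- exact: nsq_tspread.
Qed.

(** On the bounded support of f the exponential is square-integrable. *)
Lemma fourier_integrable (N : nat) f xi : L2 mu f ->
  (forall t, ~ (- N%:R <= t <= N%:R) -> f t = 0) ->
  cintegrable mu (fun t => f t * cexp2pi (- (xi * t))).
Proof.
move=> hf supp; pose D : set (line R) := `[- N%:R, N%:R]%classic.
have mD : measurable D by exact: measurable_itv.
pose g := cutoff D (fun t : line R => cexp2pi (xi * t)).
have hg : L2 mu g.
  apply/L2P; split.
    apply: cmeasurable_cutoff => //; apply: measurable_cexp2pi.
    by apply: measurable_funM => //; exact: measurable_cst.
  rewrite nsq_cutoff; under eq_integral do rewrite sqn_cexp2pi.
  by rewrite integral_cst//= mul1e /D lebesgue_measure_itv/=; case: ifP => _; rewrite ltry.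
have := L2_mulJ_integrable hf hg; congr cintegrable; apply/funext => t.
rewrite /g /cutoff; case: ifPn => [_|/negP]; first by rewrite cexp2piN.
by rewrite inE /D /= in_itv /= => ht; rewrite supp// !mul0r.
Qed.

Lemma tspread_lin N k1 k2 (c : R[i]) : L2 (mu2 R) k1 -> L2 (mu2 R) k2 ->
  {ae mu2 R, forall x, tspread N (fun z => k1 z + c * k2 z) x =
     tspread N k1 x + c * tspread N k2 x}.
Proof.
move=> h1 h2.
have a1 := ae_fst (ae_slice_L2 (L2_cutoff (measurable_strip N) h1)).
have a2 := ae_fst (ae_slice_L2 (L2_cutoff (measurable_strip N) h2)).
have ae_f := ae_filter_ringOfSetsType (mu2 R).
apply: filterS2 a1 a2 => x hx1 hx2; rewrite !tspreadE.
have supp (k : plane R -> R[i]) (t : R) : ~ (- N%:R <= t <= N%:R) -> cutoff (strip N) k (shear (x.1, t)) = 0.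
  by move=> ht; rewrite /cutoff memNset.
have i1 := fourier_integrable x.2 hx1 (supp k1).
have i2 := fourier_integrable x.2 hx2 (supp k2).
rewrite /fourier -cintegralZ// -cintegralD//; last exact: cintegrableZ.
congr cintegral; apply/funext => t; rewrite /cutoff; case: ifP => _.
  by rewrite mulrDl mulrA.
by rewrite !mul0r mulr0 addr0.
Qed.

Lemma spreading_lin k1 k2 e1 e2 (c : R[i]) : L2 (mu2 R) k1 -> L2 (mu2 R) k2 ->
  spreading_function k1 e1 -> spreading_function k2 e2 ->
  spreading_function (fun z => k1 z + c * k2 z) (fun z => e1 z + c * e2 z).
Proof.
move=> hk1 hk2 /(spreading_functionP _ hk1)[he1 s1] /(spreading_functionP _ hk2)[he2 s2].
have hk : L2 (mu2 R) (fun z => k1 z + c * k2 z) by apply: L2D => //; exact: L2Z.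
apply/(spreading_functionP _ hk); split; first by apply: L2D => //; exact: L2Z.
move=> e e0; have e4 : 0 < e / 4 by rewrite divr_gt0.
have ec : 0 < e / (4 * (sqn c + 1)) by rewrite divr_gt0// mulr_gt0// ltr_wpDl// sqn_ge0.
have [N1 h1] := s1 _ e4; have [N2 h2] := s2 _ ec.
exists (maxn N1 N2) => n; rewrite geq_max => /andP[/h1 n1 /h2 n2].
have hT1 := L2_tspread n hk1; have hT2 := L2_tspread n hk2.
have hd1 := L2B he1 hT1; have hd2 := L2B he2 hT2.
rewrite (nsq_ae_eq (g := fun x => (e1 x - tspread n k1 x) + c * (e2 x - tspread n k2 x))); first last.
- by apply: filterS (tspread_lin n c hk1 hk2) => x ->; ring.
- by case: (L2D hd1 (L2Z c hd2)).
- apply: cmeasurableB; first by case: (L2D he1 (L2Z c he2)).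
  by apply: cmeasurable_tspread; case: hk.
apply: (le_trans (nsqD_le2 _ (L2_cmeas hd1) (L2_cmeas (L2Z c hd2)))).
rewrite nsqZ; last by case: hd2.
apply: (@le_trans _ _ (2%:E * (e / 4)%:E + 2%:E * ((sqn c)%:E * (e / (4 * (sqn c + 1)))%:E))%E).
  apply: leeD; rewrite lee_pmul2l//.
  by apply: lee_wpmul2l => //; rewrite lee_fin sqn_ge0.
rewrite -!EFinM -EFinD lee_fin.
have sc := sqn_ge0 c.
have : sqn c * (e / (4 * (sqn c + 1))) <= e / 4.
  rewrite (_ : e / (4 * _) = (e / 4) / (sqn c + 1)); last by field; rewrite gt_eqF// ltr_wpDl.
  by rewrite mulrA ler_pdivrMr ?ltr_wpDl// mulrC ler_wpM2l ?lerDl// ltW.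
by lra.
Qed.

Lemma spreadingB k1 k2 e1 e2 : L2 (mu2 R) k1 -> L2 (mu2 R) k2 ->
  spreading_function k1 e1 -> spreading_function k2 e2 ->
  spreading_function (fun z => k1 z - k2 z) (fun z => e1 z - e2 z).
Proof.
move=> h1 h2 s1 s2; have := spreading_lin (-1) h1 h2 s1 s2.
by congr spreading_function; apply/funext => z; rewrite mulN1r.
Qed.

Lemma spreading0 : spreading_function (fun=> 0) (fun=> 0 : R[i]).
Proof.
apply/(spreading_functionP _ (L20 _)); split; first exact: L20.
move=> e e0; exists 0%N => n _; rewrite (_ : (fun x => _) = fun=> 0).
  by rewrite nsq0 lee_fin ltW.
apply/funext => x; rewrite /tspread cintegral_cutoff.
rewrite (_ : cutoff _ _ = fun=> 0); first by rewrite cintegral0 subrr.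
by apply/funext => t; rewrite /cutoff mul0r; case: ifP.
Qed.

Lemma spreading_sum (I : Type) (s : seq I) (c : I -> R[i]) (k e : I -> plane R -> R[i]) :
  (forall i, L2 (mu2 R) (k i)) -> (forall i, spreading_function (k i) (e i)) ->
  spreading_function (fun z => \sum_(i <- s) c i * k i z) (fun z => \sum_(i <- s) c i * e i z).
Proof.
move=> hk hs; elim: s => [|i s ih].
  under eq_fun do rewrite big_nil.
  by under [X in spreading_function _ X]eq_fun do rewrite big_nil; exact: spreading0.
have hS : L2 (mu2 R) (fun z => \sum_(i <- s) c i * k i z).
  by apply: L2_bigsum => j; exact: L2Z.
have := spreading_lin (c i) hS (hk i) ih (hs i).
by congr spreading_function; apply/funext => z; rewrite big_cons addrC.
Qed.

Definition tensor h g : plane R -> R[i] := fun z => h z.1 * (g z.2)^*.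

Lemma nsq_tensor h g : L2 mu h -> L2 mu g ->
  nsq (mu2 R) (tensor h g) = (nsq mu h * nsq mu g)%E.
Proof.
move=> hh hg; have mt : cmeasurable (tensor h g).
  apply: cmeasurableM; first by apply: cmeasurable_fst; case: hh.
  by apply: cmeasurableJ; apply: cmeasurable_snd; case: hg.
rewrite {1}/nsq (fubini_tonelli1 (fun z => (sqn (tensor h g z))%:E)); last 2 first.
- exact: measurable_sqnE.
- by move=> z; rewrite lee_fin sqn_ge0.
rewrite (sqfE hg) /nsq -ge0_integralZr ?lee_fin ?sqf_ge0//; last 2 first.
- by apply: measurable_sqnE; case: hh.
- by move=> x _; rewrite lee_fin sqn_ge0.
apply: eq_integral => t _; rewrite /fubini_F /tensor /=.
under eq_integral do rewrite sqnM sqn_conj EFinM.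
rewrite ge0_integralZl ?lee_fin ?sqn_ge0//; last 2 first.
- by apply: measurable_sqnE; case: hg.
- by move=> x _; rewrite lee_fin sqn_ge0.
by congr (_ * _)%E; rewrite -(sqfE hg).
Qed.

Lemma L2_tensor h g : L2 mu h -> L2 mu g -> L2 (mu2 R) (tensor h g).
Proof.
move=> hh hg; apply/L2P; split.
  apply: cmeasurableM; first by apply: cmeasurable_fst; case: hh.
  by apply: cmeasurableJ; apply: cmeasurable_snd; case: hg.
by rewrite nsq_tensor// (sqfE hh) (sqfE hg) -EFinM ltry.
Qed.

Lemma L2_tfshift (z : plane R) f : L2 mu f -> L2 mu (tfshift z f).
Proof.
move=> hf; apply: (L2_le _ (L2_preserving (shift_preserving (- z.1)) hf)).
  apply: cmeasurableM; last by case: (L2_preserving (shift_preserving (- z.1)) hf).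
  by apply: measurable_cexp2pi; apply: measurable_funM => //; exact: measurable_cst.
by move=> t; rewrite /tfshift /modulation sqnM sqn_cexp2pi mul1r.
Qed.

Lemma nsq_tfshift (z : plane R) f : cmeasurable f -> nsq mu (tfshift z f) = nsq mu f.
Proof.
move=> mf; rewrite -[RHS](nsq_preserving (shift_preserving (- z.1)) mf).
by apply: nsq_eq => t; rewrite /tfshift /modulation sqnM sqn_cexp2pi mul1r.
Qed.

End Spreading.

(** * Integral operators and tensor products *)

Section IntegralOperators.
Context {R : realType}.
Local Notation mu := (mu1 R).
Implicit Types (kappa : plane R -> R[i]) (f g h w : line R -> R[i]).

Lemma Rintegral_fubini (F : plane R -> R) : (mu2 R).-integrable setT (EFin \o F) ->
  \int[mu2 R]_z F z = \int[mu]_x \int[mu]_y F (x, y).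
Proof.
move=> hF; rewrite /Rintegral -(integral12_prod_meas1 hF); congr fine.
apply: ae_eq_integral => //.
- exact: (measurable_int mu (integrable_fubini_F hF)).
- apply/measurable_EFinP; apply: (@measurable_Rintegral_param _ _ _ _ _ mu F).
  by apply/measurable_EFinP; exact: measurable_int hF.
- apply: filterS (ae_integrable1 hF) => x hx _; rewrite /fubini_F.
  by rewrite fineK//; exact: integrable_fin_num hx.
Qed.

Lemma cintegral_fubini (F : plane R -> R[i]) : cintegrable (mu2 R) F ->
  cintegral (mu2 R) setT F =
  cintegral mu setT (fun x => cintegral mu setT (fun y => F (x, y))).
Proof. by move=> [Fr Fi]; apply: complex_ext => /=; rewrite Rintegral_fubini. Qed.

Definition kernel_op kappa w : line R -> R[i] :=
  fun t => cintegral mu setT (fun s => kappa (t, s) * w s).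

Lemma kernel_opE kappa w t : kernel_op kappa w t = inner mu (fun s => kappa (t, s)) (fun s => (w s)^*).
Proof. by congr cintegral; apply/funext => s; rewrite conjCK. Qed.

Lemma L2J w : L2 mu w -> L2 mu (fun s => (w s)^*).
Proof.
move=> hw; apply: (L2_le _ hw); first by apply: cmeasurableJ; case: hw.
by move=> s; rewrite sqn_conj.
Qed.

Lemma sqfJ w : sqf mu (fun s => (w s)^*) = sqf mu w.
Proof. by rewrite /sqf; congr fine; apply: nsq_eq => s; rewrite sqn_conj. Qed.

Lemma nsq_plane kappa : cmeasurable kappa ->
  nsq (mu2 R) kappa = (\int[mu]_t nsq mu (fun s => kappa (t, s)))%E.
Proof.
move=> mk; apply: (fubini_tonelli1 (fun z => (sqn (kappa z))%:E)).
  exact: measurable_sqnE.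
by move=> z; rewrite lee_fin sqn_ge0.
Qed.

Lemma cmeasurable_section kappa t : cmeasurable kappa ->
  cmeasurable (fun s : line R => kappa (t, s)).
Proof. by move=> mk; apply: (cmeasurable_comp mk); exact: pair1_measurable. Qed.

Lemma measurable_nsq_section kappa : cmeasurable kappa ->
  measurable_fun setT (fun t => nsq mu (fun s => kappa (t, s))).
Proof.
move=> mk; apply: (measurable_fun_fubini_tonelli_F (fun z => (sqn (kappa z))%:E)).
  exact: measurable_sqnE.
by move=> z; rewrite lee_fin sqn_ge0.
Qed.

Lemma ae_section_L2 kappa : L2 (mu2 R) kappa ->
  {ae mu, forall t, L2 mu (fun s => kappa (t, s))}.
Proof.
move=> hk; have mk := L2_cmeas hk.
have := ge0_ae_lty (mu := mu) (measurable_nsq_section mk) (fun t => nsq_ge0 _ _).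
rewrite -nsq_plane// => /(_ (L2_lty hk)).
by apply: filterS => t ht; apply/L2P; split => //; exact: cmeasurable_section.
Qed.

Lemma cmeasurable_kernel_op kappa w : cmeasurable kappa -> cmeasurable w ->
  cmeasurable (kernel_op kappa w).
Proof.
move=> mk mw; apply: (@cmeasurable_param _ _ _ _ _ mu (fun z : plane R => kappa z * w z.2)).
by apply: cmeasurableM => //; exact: cmeasurable_snd.
Qed.

(** Cauchy-Schwarz on each section of the kernel. *)
Lemma nsq_kernel_op_le kappa w : L2 (mu2 R) kappa -> L2 mu w ->
  (nsq mu (kernel_op kappa w) <= nsq (mu2 R) kappa * nsq mu w)%E.
Proof.
move=> hk hw; have mk := L2_cmeas hk; have mw := L2_cmeas hw.
rewrite (nsq_plane mk) (sqfE hw) -ge0_integralZr ?lee_fin ?sqf_ge0//; last 2 first.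
- exact: measurable_nsq_section.
- by move=> t _; exact: nsq_ge0.
apply: ae_ge0_le_integral => //.
- by move=> t _; rewrite lee_fin sqn_ge0.
- by apply: measurable_sqnE; exact: cmeasurable_kernel_op.
- by move=> t _; rewrite mule_ge0 ?nsq_ge0// lee_fin sqf_ge0.
- apply: emeasurable_funM; [exact: measurable_nsq_section|exact: measurable_cst].
apply: filterS (ae_section_L2 hk) => t ht _.
by rewrite (sqfE ht) -EFinM lee_fin kernel_opE -(sqfJ w) inner_CS//; exact: L2J.
Qed.

Lemma L2_kernel_op kappa w : L2 (mu2 R) kappa -> L2 mu w -> L2 mu (kernel_op kappa w).
Proof.
move=> hk hw; apply/L2P; split; first by apply: cmeasurable_kernel_op; [case: hk|case: hw].
by rewrite (le_lt_trans (nsq_kernel_op_le hk hw))// (sqfE hk) (sqfE hw) -EFinM ltry.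
Qed.

Lemma kernel_op_lin k1 k2 (c : R[i]) w : L2 (mu2 R) k1 -> L2 (mu2 R) k2 -> L2 mu w ->
  {ae mu, forall t, kernel_op (fun z => k1 z + c * k2 z) w t = kernel_op k1 w t + c * kernel_op k2 w t}.
Proof.
move=> h1 h2 hw; have ae_f := ae_filter_ringOfSetsType mu.
apply: filterS2 (ae_section_L2 h1) (ae_section_L2 h2) => t ht1 ht2.
have hwJ := L2J hw.
rewrite !kernel_opE -innerZl// -innerDl//; last exact: L2Z.
Qed.

(** Both sides integrate kappa(t, s) w(s) conj(g(t)); Fubini applies because
    that function is a product of two square-integrable functions on the
    plane. *)
Lemma inner_tensor kappa g w : L2 (mu2 R) kappa -> L2 mu g -> L2 mu w ->
  inner (mu2 R) kappa (tensor g w) = inner mu (kernel_op kappa w) g.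
Proof.
move=> hk hg hw; rewrite /inner cintegral_fubini; last first.
  by apply: L2_mulJ_integrable => //; exact: L2_tensor.
apply: cintegral_ae.
- apply: (@cmeasurable_param _ _ _ _ _ mu (fun z : plane R => kappa z * (tensor g w z)^*)).
  by apply: cmeasurableM; [case: hk|apply: cmeasurableJ; case: (L2_tensor hg hw)].
- by apply: cmeasurableM; [case: (L2_kernel_op hk hw)|apply: cmeasurableJ; case: hg].
apply: filterS (ae_section_L2 hk) => t ht.
rewrite mulrC kernel_opE -cintegralZ; last by apply: L2_mulJ_integrable => //; exact: L2J.
by congr cintegral; apply/funext => s; rewrite /tensor conjM !conjCK /=; ring.
Qed.

Lemma kernel_op_tensor h g w t : L2 mu g -> L2 mu w ->
  kernel_op (tensor h g) w t = h t * inner mu w g.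
Proof.
move=> hg hw; rewrite -cintegralZ; last exact: L2_mulJ_integrable.
by congr cintegral; apply/funext => s; rewrite /tensor /=; ring.
Qed.

Lemma inner_tensor2 h g h' g' : L2 mu h -> L2 mu g -> L2 mu h' -> L2 mu g' ->
  inner (mu2 R) (tensor h g) (tensor h' g') = inner mu h h' * inner mu g' g.
Proof.
move=> hh hg hh' hg'; rewrite inner_tensor//; last exact: L2_tensor.
rewrite (_ : kernel_op _ _ = fun t => inner mu g' g * h t).
  by rewrite innerZl// mulrC.
by apply/funext => t; rewrite kernel_op_tensor// mulrC.
Qed.

Lemma ae_forall_count (I : countType) d (T : measurableType d) (m : {measure set T -> \bar R})
    (P : I -> T -> Prop) :
  (forall i, {ae m, forall x, P i x}) -> {ae m, forall x, forall i, P i x}.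
Proof.
move=> h; have : {ae m, forall x, forall n, if @pickle_inv I n is Some i then P i x else True}.
  apply/ae_foralln => n; case: (@pickle_inv I n) => [i|]; first exact: h.
  exact: aeW.
apply: filterS => x hx i; have := hx (choice.pickle i).
by rewrite pickleK_inv.
Qed.

Section Box.
Variables (a b nu nu' : R).
Hypotheses (nu0 : 0 < nu) (nu'0 : 0 < nu').
Local Notation I := (`[a, a + nu^-1[%classic : set (line R)).
Local Notation J := (`[b, b + nu'^-1[%classic : set (line R)).
Let mI : measurable I := measurable_period_itv a nu.
Let mJ : measurable J := measurable_period_itv b nu'.

Definition cchar (c s : R) (k : int) : line R -> R[i] :=
  cutoff (`[c, c + s^-1[%classic : set (line R)) (echar s k).

Lemma L2_cchar (c s : R) k : 0 < s -> L2 mu (cchar c s k).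
Proof.
move=> s0; apply/L2P; split.
  apply: cmeasurable_cutoff; first exact: (measurable_period_itv c s).
  exact: measurable_echar.
rewrite (nsq_cutoff_mrestr _ (measurable_period_itv c s)); last exact: measurable_echar.
exact: L2_lty (L2_echar c s0 k).
Qed.

Lemma inner_cchar (c s : R) k (f : line R -> R[i]) : cmeasurable f ->
  inner mu f (cchar c s k) = inner (mrestr mu (measurable_period_itv c s)) f (echar s k).
Proof.
move=> mf; rewrite /inner cintegral_mrestr; last first.
  by apply: cmeasurableM => //; apply: cmeasurableJ; exact: measurable_echar.
rewrite [RHS]cintegral_cutoff; congr cintegral; apply/funext => t.
by rewrite /cchar /cutoff; case: ifP => // _; rewrite rmorph0 mulr0.
Qed.

(** A function on a rectangle is determined by its inner products with tensor
    products of characters, by two applications of the one-dimensional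
    totality: first in the second variable, then in the first. *)
Lemma box_total kappa : L2 (mu2 R) kappa ->
  (forall z, ~ (I `*` J) z -> kappa z = 0) ->
  (forall k l, inner (mu2 R) kappa (tensor (cchar a nu k) (cchar b nu' l)) = 0) ->
  nsq (mu2 R) kappa = 0%E.
Proof.
move=> hk supp h; have mk := L2_cmeas hk.
have K0 l : {ae mu, forall t, I t -> kernel_op kappa (cchar b nu' l) t = 0}.
  have hL := L2_kernel_op hk (L2_cchar b l nu'0); have mL := L2_cmeas hL.
  have e0 := echar_total nu0 (L2_mrestr mI hL).
  have /e0/(nsq_eq0 mL) z0 : forall k, inner (mrestr mu mI) (kernel_op kappa (cchar b nu' l)) (echar nu k) = 0.
    move=> k; rewrite -[LHS](inner_cchar a nu k mL) -inner_tensor//; exact: L2_cchar.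
  exact: (ae_mrestr _ mI _).2 z0.
have /ae_forall_count KA := K0.
apply/eqP; rewrite eq_le nsq_ge0 andbT (nsq_plane mk).
rewrite (_ : \int[mu]_t _ = 0)%E//.
have ae_f := ae_filter_ringOfSetsType mu.
rewrite (@ge0_ae_eq_integral _ _ _ mu setT _ (fun=> 0%E)) ?integral0//.
- exact: measurable_nsq_section.
- by move=> t _; exact: nsq_ge0.
apply: filterS2 KA (ae_section_L2 hk) => t ht hL _.
have [tI|tI] := pselect (I t); last first.
  rewrite (_ : (fun s => _) = fun=> 0) ?nsq0//.
  by apply/funext => s; rewrite supp// => -[].
have mL := L2_cmeas hL.
have cutE : cutoff J (fun s => kappa (t, s)) = (fun s => kappa (t, s)).
  apply/funext => s; rewrite /cutoff; case: ifPn => // /negP sJ.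
  by rewrite supp// => -[_ /= h']; apply: sJ; rewrite inE.
rewrite -[in LHS]cutE (nsq_cutoff_mrestr _ mJ)//.
pose cj (k : line R -> R[i]) := fun s => (k s)^*.
have tot := echar_total nu'0 (L2_mrestr mJ hL); apply: tot => l.
have := ht (- l) tI; rewrite kernel_opE => hz; rewrite -[LHS](inner_cchar b nu' l mL) -[RHS]hz.
congr inner; apply/funext => s; rewrite /cchar /cutoff; case: ifP => _; last by rewrite rmorph0.
by rewrite /echar -cexp2piN rmorphN/=; congr cexp2pi; ring.
Qed.

End Box.

(** Restricted to large boxes the kernel vanishes by [box_total], and the
    boxes exhaust the plane. *)
Lemma tensor_total kappa : L2 (mu2 R) kappa ->
  (forall g w, L2 mu g -> L2 mu w -> inner (mu2 R) kappa (tensor g w) = 0) ->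
  nsq (mu2 R) kappa = 0%E.
Proof.
move=> hk h; have mk := L2_cmeas hk.
pose s N : R := (N%:R *+ 2 + 1)^-1.
have s0 N : 0 < s N by rewrite invr_gt0 ltr_wpDl// mulrn_wge0.
pose I N : set (line R) := `[- N%:R, - N%:R + (s N)^-1[%classic.
have mI N : measurable (I N) := measurable_period_itv (- N%:R) (s N).
pose D N : set (plane R) := I N `*` I N.
have mD N : measurable (D N) by apply: measurableX.
have hD z : exists N, forall n, (N <= n)%N -> D n z.
  exists (maxn (Num.bound `|z.1|) (Num.bound `|z.2|)) => n; rewrite geq_max => /andP[n1 n2].
  have H (x : R) : (Num.bound `|x| <= n)%N -> I n x.
    move=> xn; rewrite /I /= in_itv /= /s invrK.
    have : `|x| <= n%:R.
      by rewrite (le_trans (ltW (archi_boundP _)))// ler_nat.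
    by rewrite ler_norml => /andP[? ?]; apply/andP; split => //; rewrite -mulr_natl; lra.
  by split; exact: H.
have z0 N : nsq (mu2 R) (cutoff (D N) kappa) = 0%E.
  apply: (@box_total (- N%:R) (- N%:R) (s N) (s N)) => //.
  - exact: L2_cutoff.
  - by move=> z hz; rewrite /cutoff memNset.
  move=> k l; rewrite -[RHS](h (cchar (- N%:R) (s N) k) (cchar (- N%:R) (s N) l)); last 2 first.
  - exact: L2_cchar.
  - exact: L2_cchar.
  congr cintegral; apply/funext => z; rewrite /cutoff; case: ifPn => // /negP hz.
  rewrite mul0r /tensor /cchar /cutoff; case: ifPn => [h1|_]; last by rewrite mul0r rmorph0 mulr0.
  case: ifPn => [h2|_]; last by rewrite rmorph0 mulr0 rmorph0 mulr0.
  by exfalso; apply: hz; rewrite inE; split; [rewrite inE in h1|rewrite inE in h2].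
apply/eqP; rewrite eq_le nsq_ge0 andbT; apply: nsq_le_approx => // e e0.
have [N /(_ N (leqnn N)) hN] := nsq_cutoff_lim mD hD hk e0.
exists (cutoff (D N) kappa); split => //; last by rewrite z0.
exact: L2_cutoff.
Qed.

End IntegralOperators.

Section HilbertSchmidt.
Context {R : realType}.
Local Notation mu := (mu1 R).
Implicit Types (kappa : plane R -> R[i]) (f g h w : line R -> R[i]) (H G : @operator R).

Lemma HS_kernelP H kappa : HS_kernel H kappa <-> L2 (mu2 R) kappa /\
  forall f, L2 mu f -> {ae mu, forall t, H f t = kernel_op kappa f t}.
Proof. by []. Qed.

Lemma HS_kernelB H G k1 k2 : HS_kernel H k1 -> HS_kernel G k2 ->
  HS_kernel (fun f t => H f t - G f t) (fun z => k1 z - k2 z).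
Proof.
move=> [h1 H1] [h2 H2]; split; first exact: L2B.
move=> f hf; have ae_f := ae_filter_ringOfSetsType mu.
have := kernel_op_lin (-1) h1 h2 hf.
rewrite (_ : (fun z => k1 z + -1 * k2 z) = (fun z => k1 z - k2 z)); last first.
  by apply/funext => z; rewrite mulN1r.
move=> L; apply: filterS3 (H1 f hf) (H2 f hf) L => t -> -> E.
by rewrite mulN1r in E; exact: (esym E).
Qed.

(** Two kernels of one operator have the same inner products with all tensor
    products. *)
Lemma HS_kernel_unique H k1 k2 : HS_kernel H k1 -> HS_kernel H k2 ->
  nsq (mu2 R) (fun z => k1 z - k2 z) = 0%E.
Proof.
move=> h1 h2; have [hd Hd] := HS_kernelB h1 h2.
apply: tensor_total => // g w hg hw; rewrite inner_tensor//.
have hK := L2_kernel_op hd hw.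
rewrite -[RHS](cintegral0 mu); apply: cintegral_ae.
- by apply: cmeasurableM; [case: hK|apply: cmeasurableJ; case: hg].
- exact: cmeasurable_cst.
apply: filterS (Hd w hw) => t; rewrite subrr => E.
by rewrite -[kernel_op _ _ _]E mul0r.
Qed.

Lemma L2norm_nsq d (T : measurableType d) (m : {measure set T -> \bar R}) (f : T -> R[i]) :
  L2norm m f = (nsq m f `^ 2^-1)%E.
Proof. by rewrite -L2norm_poweR -poweRrM mulfV// poweRe1// L2norm_ge0. Qed.

(** The infimum ranges over kernels that agree almost everywhere. *)
Lemma HS_normE H kappa : HS_kernel H kappa -> HS_norm H = L2norm (mu2 R) kappa.
Proof.
move=> hk; rewrite /HS_norm.
rewrite (_ : [set L2norm (mu2 R) k | k in HS_kernel H] = [set L2norm (mu2 R) kappa]) ?ereal_inf1//.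
apply/seteqP; split => [_ [k hk' <-]|_ -> /=]; last by exists kappa.
rewrite /= !L2norm_nsq; congr (_ `^ _)%E.
apply: nsq_ae_eq; [by case: hk' => -[]|by case: hk => -[]|].
have := nsq_eq0 _ (HS_kernel_unique hk' hk).
have m1 : cmeasurable (fun z => k z - kappa z).
  by apply: cmeasurableB; [case: hk' => -[]|case: hk => -[]].
by move=> /(_ m1); apply: filterS => z /eqP; rewrite subr_eq0 => /eqP.
Qed.

End HilbertSchmidt.

(** * The short-time Fourier transform *)

Section ShortTime.
Context {R : realType}.
Local Notation mu := (mu1 R).
Implicit Types (f g h w : line R -> R[i]).

Definition truncation (N : nat) f : line R -> R[i] :=
  cutoff (`[- N%:R, N%:R]%classic : set (line R)) f.

Lemma measurable_truncation_itv (N : nat) : measurable (`[- N%:R, N%:R]%classic : set (line R)).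
Proof. exact: measurable_itv. Qed.

Lemma L2_truncation N f : L2 mu f -> L2 mu (truncation N f).
Proof. by apply: L2_cutoff; exact: measurable_truncation_itv. Qed.

Lemma nsq_truncation_lim f : L2 mu f ->
  forall e : R, 0 < e -> exists N, forall n, (N <= n)%N ->
    (nsq mu (fun x => (f x - truncation n f x)%R) <= e%:E)%E.
Proof.
apply: nsq_cutoff_lim; first exact: measurable_truncation_itv.
move=> x; exists (Num.bound `|x|) => n hn /=; rewrite in_itv/= -ler_norml.
by rewrite (le_trans (ltW (archi_boundP _)))// ler_nat.
Qed.

Lemma STFT_fourier g f (x : plane R) :
  STFT g f x = fourier (fun t => tensor f g (shear (x.1, t))) x.2.
Proof.
congr cintegral; apply/funext => t.
by rewrite /tfshift /modulation /translation /tensor /shear /= conjM cexp2piN; ring.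
Qed.

Lemma cmeasurable_STFT g f : cmeasurable f -> cmeasurable g -> cmeasurable (STFT g f).
Proof.
move=> mf mg; rewrite (_ : STFT g f = fun x =>
  cintegral mu setT (fun t => tensor f g (shear (x.1, t)) * cexp2pi (- (x.2 * t)))); last first.
  by apply/funext => x; exact: STFT_fourier.
apply: (@cmeasurable_param _ _ _ _ _ mu (fun z : plane R * line R =>
  tensor f g (shear (z.1.1, z.2)) * cexp2pi (- (z.1.2 * z.2)))).
have m11 : measurable_fun setT (fun z : plane R * line R => z.1.1).
  by apply: (measurableT_comp measurable_fst); exact: measurable_fst.
have m12 : measurable_fun setT (fun z : plane R * line R => z.1.2).
  by apply: (measurableT_comp measurable_snd); exact: measurable_fst.
have m2 : measurable_fun setT (fun z : plane R * line R => z.2).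
  exact: measurable_snd.
apply: cmeasurableM.
  apply: (@cmeasurable_comp _ _ _ _ _ (fun z : plane R * line R => shear (z.1.1, z.2)) (tensor f g)).
    by apply: cmeasurableM; [exact: cmeasurable_fst|apply: cmeasurableJ; exact: cmeasurable_snd].
  apply: (measurableT_comp measure_preserving_shear.1).
  by apply/measurable_fun_pairP; split; [exact: m11|exact: m2].
apply: measurable_cexp2pi; apply: measurable_funN; apply: measurable_funM.
  exact: m12.
exact: m2.
Qed.

Lemma tspread_tensor N g f : tspread N (tensor f g) = STFT g (truncation N f).
Proof.
apply/funext => x; rewrite tspreadE STFT_fourier; congr fourier; apply/funext => t.
rewrite /tensor /truncation /cutoff /shear /=.
rewrite (_ : ((t, t - x.1) \in strip N) = (t \in (`[- N%:R, N%:R]%classic : set R))).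
  by case: ifP => // _; rewrite mul0r.
by apply/idP/idP; rewrite !inE /strip /= ?in_itv.
Qed.

Lemma STFTB g f1 f2 x : L2 mu f1 -> L2 mu f2 -> L2 mu g ->
  STFT g (fun t => f1 t - f2 t) x = STFT g f1 x - STFT g f2 x.
Proof. by move=> h1 h2 hg; apply: innerBl => //; exact: L2_tfshift. Qed.

Lemma STFT_le g f x : L2 mu f -> L2 mu g ->
  sqn (STFT g f x) <= sqf mu f * sqf mu g.
Proof.
move=> hf hg; rewrite (le_trans (inner_CS hf (L2_tfshift x hg)))//.
by rewrite {2}/sqf nsq_tfshift//; case: hg.
Qed.

(** Fatou's lemma along the truncations of [f]. *)
Lemma nsq_STFT_le g f : L2 mu f -> L2 mu g ->
  (nsq (mu2 R) (STFT g f) <= (sqf mu f * sqf mu g)%:E)%E.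
Proof.
move=> hf hg; have mV := cmeasurable_STFT (L2_cmeas hf) (L2_cmeas hg).
have mVn n : cmeasurable (STFT g (truncation n f)).
  by apply: cmeasurable_STFT; [case: (L2_truncation n hf)|case: hg].
have cv x : (fun n => (sqn (STFT g (truncation n f) x))%:E) @ \oo --> (sqn (STFT g f x))%:E.
  have re n : `|complex.Re (STFT g f x) - complex.Re (STFT g (truncation n f) x)| ^+ 2 <=
      sqf mu (fun t => f t - truncation n f t) * sqf mu g.
    rewrite -cReN -cReD -STFTB//; last exact: L2_truncation.
    apply: le_trans (Re_sqn _) (STFT_le _ _ hg); exact/L2B/L2_truncation.
  have im n : `|complex.Im (STFT g f x) - complex.Im (STFT g (truncation n f) x)| ^+ 2 <=
      sqf mu (fun t => f t - truncation n f t) * sqf mu g.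
    rewrite -cImN -cImD -STFTB//; last exact: L2_truncation.
    apply: le_trans (Im_sqn _) (STFT_le _ _ hg); exact/L2B/L2_truncation.
  have aux (u : R) (v : nat -> R) : (forall n, `|u - v n| ^+ 2 <=
      sqf mu (fun t => f t - truncation n f t) * sqf mu g) -> v @ \oo --> u.
    move=> huv; apply/cvgrPdist_le => e e0.
    have e' : 0 < e ^+ 2 / (sqf mu g + 1) by rewrite divr_gt0 ?exprn_gt0// ltr_wpDl// sqf_ge0.
    have [N hN] := nsq_truncation_lim hf e'; exists N => // n /= /hN.
    rewrite (sqfE (L2B hf (L2_truncation n hf))) lee_fin ler_pdivlMr; last by rewrite ltr_wpDl// sqf_ge0.
    move=> h; have : `|u - v n| ^+ 2 <= e ^+ 2.
      by rewrite (le_trans (huv n))// (le_trans _ h)// ler_wpM2l ?sqf_ge0// lerDl.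
    by rewrite ler_pXn2r// nnegrE; exact: ltW.
  have := @cvg_sqn _ (fun n => STFT g (truncation n f) x) (STFT g f x) 0 0 (aux _ _ re) (aux _ _ im).
  by rewrite subr0; under eq_fun do rewrite subr0.
rewrite {1}/nsq (_ : (\int[mu2 R]_x _)%E = (\int[mu2 R]_x limn_einf (fun n => (sqn (STFT g (truncation n f) x))%:E))%E); last first.
  by apply: eq_integral => x _; rewrite is_cvg_limn_einfE ?(cvg_lim _ (cv x))//; apply/cvg_ex; eexists; exact: cv.
apply: (le_trans (fatou _ _ _ _)) => //.
- by move=> n; apply: measurable_sqnE.
- by move=> n x _; rewrite lee_fin sqn_ge0.
apply: (le_trans (limn_einf_sup _)).
rewrite limn_esup_lim; apply: lime_le; first exact: is_cvg_esups.
apply: nearW => k; apply: ge_ereal_sup => _ [n _ <-].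
rewrite -[leLHS]/(nsq (mu2 R) (STFT g (truncation n f))) -tspread_tensor nsq_tspread; last exact: L2_tensor.
apply: (@le_trans _ _ (nsq (mu2 R) (tensor f g))).
  apply: le_nsq; last by move=> z; exact: sqn_cutoff.
    by apply: cmeasurable_cutoff; [exact: measurable_strip|case: (L2_tensor hf hg)].
  by case: (L2_tensor hf hg).
by rewrite nsq_tensor// (sqfE hf) (sqfE hg) -EFinM.
Qed.

Lemma L2_STFT g f : L2 mu f -> L2 mu g -> L2 (mu2 R) (STFT g f).
Proof.
move=> hf hg; apply/L2P; split; first by apply: cmeasurable_STFT; [case: hf|case: hg].
by rewrite (le_lt_trans (nsq_STFT_le hf hg))// ltry.
Qed.

(** The transform of the kernel truncated to a strip is the short-time
    Fourier transform of the truncated function, and the short-time Fourier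
    transform is continuous in the function by [nsq_STFT_le]. *)
Lemma spreading_tensor g f : L2 mu f -> L2 mu g ->
  spreading_function (tensor f g) (STFT g f).
Proof.
move=> hf hg; apply/(spreading_functionP _ (L2_tensor hf hg)); split; first exact: L2_STFT.
move=> e e0; have e' : 0 < e / (sqf mu g + 1) by rewrite divr_gt0// ltr_wpDl// sqf_ge0.
have [N hN] := nsq_truncation_lim hf e'; exists N => n /hN h.
have hd := L2B hf (L2_truncation n hf).
rewrite tspread_tensor (_ : (fun x => _) = STFT g (fun t => f t - truncation n f t)); last first.
  by apply/funext => x; rewrite STFTB//; exact: L2_truncation.
rewrite (le_trans (nsq_STFT_le hd hg))// lee_fin.
move: h; rewrite (sqfE hd) lee_fin ler_pdivlMr; last by rewrite ltr_wpDl// sqf_ge0.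
by apply: le_trans; rewrite ler_wpM2l ?sqf_ge0// lerDl.
Qed.

(** The character of the time-frequency plane attached to z by the symplectic
    form. *)
Definition symp (z x : plane R) : R[i] := cexp2pi (z.2 * x.1 - z.1 * x.2).

(** Covariance: a simultaneous time-frequency shift of window and function
    only multiplies the transform by a character. *)
Lemma STFT_covariance g f (z x : plane R) : L2 mu f -> L2 mu g ->
  STFT (tfshift z g) (tfshift z f) x = symp z x * STFT g f x.
Proof.
move=> hf hg; have hi := L2_mulJ_integrable hf (L2_tfshift x hg).
rewrite /STFT {2}/inner -cintegralZ// /inner.
have mF : cmeasurable (fun t => tfshift z f t * (tfshift x (tfshift z g) t)^*).
  apply: cmeasurableM; first by case: (L2_tfshift z hf).
  by apply: cmeasurableJ; case: (L2_tfshift x (L2_tfshift z hg)).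
rewrite -[LHS](cintegral_preserving (shift_preserving z.1) mF).
congr cintegral; apply/funext => t.
rewrite /tfshift /modulation /translation /symp addrK.
rewrite (_ : t + z.1 - x.1 - z.1 = t - x.1); last by ring.
rewrite !conjM -!cexp2piN.
have E : cexp2pi (z.2 * (t + z.1)) * (cexp2pi (- (x.2 * (t + z.1))) * cexp2pi (- (z.2 * (t + z.1 - x.1)))) =
  cexp2pi (z.2 * x.1 - z.1 * x.2) * cexp2pi (- (x.2 * t)).
  by rewrite -!cexp2piD; congr cexp2pi; ring.
transitivity ((cexp2pi (z.2 * (t + z.1)) * (cexp2pi (- (x.2 * (t + z.1))) *
  cexp2pi (- (z.2 * (t + z.1 - x.1))))) * (f t * (g (t - x.1))^*)); first by ring.
by rewrite E; ring.
Qed.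

End ShortTime.

(** * Periodic functions of two variables *)

Section DoubleFourier.
Context {R : realType}.
Variables (b0 nu0 : R).
Hypotheses (b0_gt0 : 0 < b0) (nu0_gt0 : 0 < nu0).
Local Notation mu := (mu1 R).
Implicit Types (k : int * int) (x : plane R).

Definition pshift k x : plane R := (x.1 + k.1%:~R / nu0, x.2 + k.2%:~R / b0).

Definition periodic2 (V : Type) (M : plane R -> V) := forall x k, M (pshift k x) = M x.

Definition character k x : R[i] :=
  cexp2pi (k.2%:~R * nu0 * x.1 - k.1%:~R * b0 * x.2).

Lemma symp_lattice k : symp (lattice b0 nu0 k) = character k.
Proof. by []. Qed.

Lemma character_tensor k : character k = tensor (echar nu0 k.2) (echar b0 k.1).
Proof. by apply/funext => x; rewrite /tensor /echar -cexp2piN -cexp2piD. Qed.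

Lemma sqn_character k x : sqn (character k x) = 1. Proof. exact: sqn_cexp2pi. Qed.

Lemma cmeasurable_character k : cmeasurable (character k).
Proof.
rewrite character_tensor; apply: cmeasurableM.
  by apply: cmeasurable_fst; exact: measurable_echar.
by apply: cmeasurableJ; apply: cmeasurable_snd; exact: measurable_echar.
Qed.

Lemma character_periodic k : periodic2 (character k).
Proof.
move=> x [i j]; rewrite /character /pshift /=.
have -> : k.2%:~R * nu0 * (x.1 + i%:~R / nu0) - k.1%:~R * b0 * (x.2 + j%:~R / b0) =
   (k.2%:~R * nu0 * x.1 - k.1%:~R * b0 * x.2) + (k.2 * i - k.1 * j)%:~R.
  by rewrite intrB !intrM; field; rewrite !gt_eqF.
by rewrite cexp2piD cexp2pi_int mulr1.
Qed.

Lemma pshift_preserving k : measure_preserving (mu2 R) (pshift k).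
Proof. exact: (plane_shift_preserving (k.1%:~R / nu0, k.2%:~R / b0)). Qed.

Lemma pshiftD k l x : pshift k (pshift l x) = pshift (k + l) x.
Proof.
by case: k l => [k1 k2] [l1 l2]; rewrite /pshift /= !intrD; congr (_, _); ring.
Qed.

Lemma pshift0 x : pshift 0 x = x.
Proof. by case: x => x y; rewrite /pshift /= !mul0r !addr0. Qed.

Definition box (a b : R) : set (plane R) :=
  `[a, a + nu0^-1[ `*` `[b, b + b0^-1[.

Lemma measurable_box a b : measurable (box a b).
Proof. by apply: measurableX; exact: measurable_itv. Qed.

Lemma box_period : box 0 0 = period_box b0 nu0.
Proof. by rewrite /box /period_box !add0r. Qed.

Lemma box_centered : box (- (nu0^-1 / 2)) (- (b0^-1 / 2)) = centered_box b0 nu0.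
Proof.
rewrite /box /centered_box; congr (_ `*` _).
  by rewrite (_ : - (nu0^-1 / 2) + nu0^-1 = nu0^-1 / 2)//; lra.
by rewrite (_ : - (b0^-1 / 2) + b0^-1 = b0^-1 / 2)//; lra.
Qed.

Lemma box_uniq a b x : exists2 k, box a b (pshift k x) &
  forall l, box a b (pshift l x) -> l = k.
Proof.
have p0 : 0 < nu0^-1 by rewrite invr_gt0.
have q0 : 0 < b0^-1 by rewrite invr_gt0.
have [k /andP[h1 h2] h3] := tile_uniq a x.1 p0.
have [l /andP[g1 g2] g3] := tile_uniq b x.2 q0.
exists (- k, - l).
  by split; rewrite /= in_itv/= intrN mulNr; apply/andP; split; lra.
move=> [i j] []; rewrite /= !in_itv/= => /andP[i1 i2] /andP[j1 j2].
have -> : k = - i by rewrite -(h3 (- i))//; rewrite intrN mulNr; apply/andP; split; lra.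
have -> : l = - j by rewrite -(g3 (- j))//; rewrite intrN mulNr; apply/andP; split; lra.
by rewrite !opprK.
Qed.

Lemma integral_unfold a b (F : plane R -> \bar R) : measurable_fun setT F ->
  (forall x, (0 <= F x)%E) ->
  (\int[mu2 R]_x F x =
   \int[mu2 R]_(x in box a b) (\esum_(k in [set: int * int]) F (pshift k x)))%E.
Proof. by move=> mF F0; apply: integral_periodize2; rewrite ?invr_gt0. Qed.

(** Cutting the function off outside the first box and unfolding over the
    second one: by periodicity exactly one translate contributes at each
    point. *)
Lemma integral_box_change a b a' b' (F : plane R -> \bar R) : measurable_fun setT F ->
  (forall x, (0 <= F x)%E) -> periodic2 F ->
  (\int[mu2 R]_(x in box a b) F x = \int[mu2 R]_(x in box a' b') F x)%E.
Proof.
move=> mF F0 pF; rewrite integral_mkcond (integral_unfold a' b'); last 2 first.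
- by apply/(measurable_restrictT _ _).1 => //; [exact: measurable_box|exact: measurable_funTS].
- by move=> x; rewrite patchE; case: ifP.
apply: eq_integral => x _; have [k hk hu] := box_uniq a b x.
transitivity (\esum_(l in [set k]) (F \_ (box a b)) (pshift l x))%E.
  rewrite [RHS]esum_mkcond; apply: eq_esum => l _; case: ifPn => // /negP lk.
  rewrite patchE; case: ifPn => // /[!inE] /hu E; exfalso; apply: lk.
  by rewrite inE.
by rewrite esum_set1 patchE ?mem_set// pF.
Qed.

Lemma ae_periodic a b (P : plane R -> Prop) : (forall x k, P (pshift k x) -> P x) ->
  {ae mu2 R, forall x, box a b x -> P x} -> {ae mu2 R, forall x, P x}.
Proof.
move=> pP h.
have /(@ae_forall_count R (int * int)%type) : forall k, {ae mu2 R, forall x, box a b (pshift k x) -> P (pshift k x)}.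
  by move=> k; exact: (ae_preserving (pshift_preserving k) h).
apply: filterS => x hx; have [k hk _] := box_uniq a b x.
exact/(pP _ k)/hx.
Qed.

Section FixedBox.
Variables (a b : R).
Local Notation m := (mrestr (mu2 R) (measurable_box a b)).
Let L := nu0^-1 * b0^-1.

Lemma area_gt0 : 0 < L. Proof. by rewrite mulr_gt0// invr_gt0. Qed.

Let ctensor k := tensor (cchar a nu0 k.2) (cchar b b0 k.1).

Let ctensorE k : ctensor k = cutoff (box a b) (character k).
Proof.
apply/funext => x; rewrite /ctensor /tensor /cchar character_tensor /tensor /cutoff.
case: ifPn => h1; last by rewrite mul0r ifF//; apply/negP; rewrite inE => -[h2 _];
  move/negP: h1; apply; rewrite inE.
case: ifPn => h2; last by rewrite rmorph0 mulr0 ifF//; apply/negP; rewrite inE => -[_ h3];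
  move/negP: h2; apply; rewrite inE.
by rewrite ifT//; rewrite inE in h1; rewrite inE in h2; rewrite inE.
Qed.

Let inner_box f k : cmeasurable f -> inner m f (character k) = inner (mu2 R) f (ctensor k).
Proof.
move=> mf; rewrite /inner cintegral_mrestr; last first.
  by apply: cmeasurableM => //; apply: cmeasurableJ; exact: cmeasurable_character.
rewrite [LHS]cintegral_cutoff; congr cintegral; apply/funext => x.
by rewrite ctensorE /cutoff; case: ifP => // _; rewrite rmorph0 mulr0.
Qed.

Lemma L2_character k : L2 m (character k).
Proof.
apply/L2P; split; first exact: cmeasurable_character.
rewrite -nsq_cutoff_mrestr; last exact: cmeasurable_character.
rewrite -ctensorE; apply: L2_lty; apply: L2_tensor; exact: L2_cchar.
Qed.

Lemma character_orth i j :
  inner m (character i) (character j) = if i == j then L%:C else 0.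
Proof.
have E : inner m (character i) (character j) = inner (mu2 R) (ctensor i) (ctensor j).
  rewrite inner_box; last exact: cmeasurable_character.
  congr cintegral; apply/funext => x; rewrite !ctensorE /cutoff.
  by case: ifP => // _; rewrite rmorph0 !mulr0.
rewrite E inner_tensor2; try exact: L2_cchar.
have C (c s : R) (k l : int) : 0 < s -> inner mu (cchar c s k) (cchar c s l) = if k == l then (s^-1)%:C else 0.
  move=> s0; rewrite -(echar_orth c s0) inner_cchar; last by case: (L2_cchar c k s0).
  rewrite /inner !cintegral_mrestr; last 2 first.
  - by apply: cmeasurableM; [exact: measurable_echar|apply: cmeasurableJ; exact: measurable_echar].
  - apply: cmeasurableM; first by case: (L2_cchar c k s0).
    by apply: cmeasurableJ; exact: measurable_echar.
  apply: complex_ext => /=; apply: eq_Rintegral => t tD; rewrite /cchar /cutoff tD//.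
rewrite (C a nu0 i.2 j.2 nu0_gt0) (C b b0 j.1 i.1 b0_gt0).
have -> : (i == j) = (i.2 == j.2) && (j.1 == i.1).
  by rewrite andbC (eq_sym j.1); case: (i) (j) => [? ?] [? ?].
have M (x y : R) : x%:C * y%:C = (x * y)%:C :> R[i] by rewrite rmorphM.
case: (i.2 == j.2); last by rewrite mul0r.
by case: (j.1 == i.1); [rewrite /= M|rewrite /= mulr0].
Qed.

(** The characters of the box are tensor products of characters of its sides. *)
Lemma character_total f : L2 m f -> (forall k, inner m f (character k) = 0) ->
  nsq m f = 0%E.
Proof.
move=> hf h; have mf := L2_cmeas hf.
have mc := cmeasurable_cutoff (measurable_box a b) mf.
rewrite -nsq_cutoff_mrestr//; apply: (@box_total R a b nu0 b0) => //.
- apply/L2P; split; first exact: mc.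
  by rewrite (nsq_cutoff_mrestr _ (measurable_box a b))//; exact: L2_lty.
- by move=> x hx; rewrite /cutoff memNset.
move=> k l; rewrite -[RHS](h (l, k)) inner_box//; congr cintegral; apply/funext => x.
rewrite -[tensor _ _]/(ctensor (l, k)) ctensorE /cutoff; case: ifP => // _.
by rewrite rmorph0 !mulr0.
Qed.

End FixedBox.

Lemma L2_box_change a b a' b' f : periodic2 f -> cmeasurable f ->
  nsq (mrestr (mu2 R) (measurable_box a b)) f = nsq (mrestr (mu2 R) (measurable_box a' b')) f.
Proof.
move=> pf mf; rewrite !nsq_mrestr//; apply: integral_box_change.
- exact: measurable_sqnE.
- by move=> x; rewrite lee_fin sqn_ge0.
- by move=> x k; rewrite pf.
Qed.

(** The representative of a point in the box with lower left corner (a, b). *)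
Definition wrap (a b : R) x : plane R :=
  (x.1 - (Num.floor ((x.1 - a) * nu0))%:~R / nu0,
   x.2 - (Num.floor ((x.2 - b) * b0))%:~R / b0).

Lemma wrapE a b x : wrap a b x = pshift (- Num.floor ((x.1 - a) * nu0), - Num.floor ((x.2 - b) * b0)) x.
Proof. by rewrite /wrap /pshift /= !intrN !mulNr. Qed.

Lemma floor_itv_lin (c s t : R) : 0 < s ->
  c <= t - (Num.floor ((t - c) * s))%:~R / s < c + s^-1.
Proof.
move=> s0; have E (k : int) : (k + 1)%:~R = k%:~R + 1 :> R by rewrite intrD.
have /andP[] := floor_itv ((t - c) * s); set k := Num.floor _; rewrite E.
rewrite -ler_pdivrMr// -ltr_pdivlMr// mulrDl mul1r => h1 h2.
by apply/andP; split; lra.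
Qed.

Lemma wrap_box a b x : box a b (wrap a b x).
Proof. by split; rewrite /= in_itv/=; exact: floor_itv_lin. Qed.

Lemma wrap_pshift a b k x : wrap a b (pshift k x) = wrap a b x.
Proof.
have [l h1 h2] := box_uniq a b x.
have := wrap_box a b (pshift k x); rewrite wrapE pshiftD => /h2 ->.
by have := wrap_box a b x; rewrite wrapE => /h2 ->.
Qed.

Lemma wrap_id a b x : box a b x -> wrap a b x = x.
Proof.
move=> hx; have [l h1 h2] := box_uniq a b x.
have := wrap_box a b x; rewrite wrapE => /h2 ->.
by rewrite -[RHS]pshift0 (h2 0)// pshift0.
Qed.

Lemma measurable_floorR : measurable_fun setT (fun t : line R => (Num.floor t)%:~R : R).
Proof.
apply: (@nondecreasing_measurable R setT (fun t : R => (Num.floor t)%:~R)) => //.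
by move=> x y xy; rewrite ler_int; exact: le_floor.
Qed.

Lemma measurable_wrap a b : measurable_fun setT (wrap a b).
Proof.
have F (c s : R) : measurable_fun setT (fun t : line R => t - (Num.floor ((t - c) * s))%:~R / s).
  apply: measurable_funB => //; apply: measurable_funM; last exact: measurable_cst.
  apply: (measurableT_comp measurable_floorR); apply: measurable_funM; last exact: measurable_cst.
  by apply: measurable_funB => //; exact: measurable_cst.
apply/measurable_fun_pairP; split.
  by apply: (measurableT_comp (F a nu0)); exact: measurable_fst.
by apply: (measurableT_comp (F b b0)); exact: measurable_snd.
Qed.

(** Square-summable coefficients define a periodic function: wrap the sum of
    the series on one box. *)
Lemma periodic_synthesis a b c : ell2 c -> exists M, [/\ cmeasurable M,
    periodic2 M, L2 (mrestr (mu2 R) (measurable_box a b)) M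
  & L2_sum (mrestr (mu2 R) (measurable_box a b)) (fun k x => c k * character k x) M].
Proof.
move=> hc; have [f hf hs] := orth_synthesis (L2_character a b) area_gt0 (character_orth a b) hc.
pose M x := f (wrap a b x).
have mM : cmeasurable M by apply: cmeasurable_comp; [case: hf|exact: measurable_wrap].
have Mf : {ae mrestr (mu2 R) (measurable_box a b), forall x, M x = f x}.
  by apply/(ae_mrestr _ _); apply: aeW => x hx; rewrite /M wrap_id.
exists M; split => //.
- by move=> x k; rewrite /M wrap_pshift.
- apply/L2P; split => //; rewrite (nsq_ae_eq mM (L2_cmeas hf) Mf); exact: L2_lty.
apply/L2_sumP => e e0; have /L2_sumP/(_ e e0)[A hA] := hs; exists A => B /hA.
congr (_ <= _)%E; apply: nsq_ae_eq.
- apply: cmeasurableB; first by case: hf.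
  by apply: cmeasurable_sum => i; apply: cmeasurableM; [exact: cmeasurable_cst|exact: cmeasurable_character].
- apply: cmeasurableB => //.
  by apply: cmeasurable_sum => i; apply: cmeasurableM; [exact: cmeasurable_cst|exact: cmeasurable_character].
by apply: filterS Mf => x ->.
Qed.

Lemma L2_sum_box_change a b a' b' c M : cmeasurable M -> periodic2 M ->
  L2_sum (mrestr (mu2 R) (measurable_box a b)) (fun k x => c k * character k x) M ->
  L2_sum (mrestr (mu2 R) (measurable_box a' b')) (fun k x => c k * character k x) M.
Proof.
move=> mM pM /L2_sumP h; apply/L2_sumP => e e0; have [A hA] := h e e0.
exists A => B /hA.
have pF : periodic2 (fun x => M x - \sum_(i <- B) c i * character i x).
  by move=> x k; rewrite pM; congr (_ - _); apply: eq_bigr => i _; rewrite character_periodic.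
have mF : cmeasurable (fun x => M x - \sum_(i <- B) c i * character i x).
  apply: cmeasurableB => //.
  by apply: cmeasurable_sum => i; apply: cmeasurableM; [exact: cmeasurable_cst|exact: cmeasurable_character].
by have -> := L2_box_change a b a' b' pF mF.
Qed.

End DoubleFourier.

(** * Gabor multipliers and their spreading functions *)

Section L2SumFacts.
Context {R : realType} {d : measure_display} {T : measurableType d}.
Variables (mu : {measure set T -> \bar R}) (I : choiceType).
Implicit Types (u : I -> T -> R[i]) (f g : T -> R[i]).

Lemma L2_sum_unique u f g : (forall i, L2 mu (u i)) -> L2 mu f -> L2 mu g ->
  L2_sum mu u f -> L2_sum mu u g -> nsq mu (fun x => (f x - g x)%R) = 0%E.
Proof.
move=> hu hf hg /L2_sumP Hf /L2_sumP Hg.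
have hs A : L2 mu (fun x => \sum_(i <- A) u i x) by apply: L2_bigsum.
apply/eqP; rewrite eq_le nsq_ge0 andbT; apply/lee_addgt0Pr => e e0; rewrite add0e.
have e4 : 0 < e / 4 by rewrite divr_gt0.
have [A hA] := Hf _ e4; have [B hB] := Hg _ e4.
have {}hA := hA (A `|` B)%fset (fsubsetUl _ _).
have {}hB := hB (A `|` B)%fset (fsubsetUr _ _).
have -> : (fun x => (f x - g x)%R) =
  (fun x => ((f x - \sum_(i <- (A `|` B)%fset) u i x) + (\sum_(i <- (A `|` B)%fset) u i x - g x))%R).
  by apply/funext => x; ring.
apply: le_trans (nsqD_le2 _ _ _) _.
- by case: (L2B hf (hs (A `|` B)%fset)).
- by case: (L2B (hs (A `|` B)%fset) hg).
rewrite [X in (_ + 2 * X)%E]nsqBC.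
rewrite (_ : e%:E = (2 * (e / 4)%:E + 2 * (e / 4)%:E)%E); last by rewrite -!EFinM -EFinD; congr EFin; lra.
by apply: leeD; apply: lee_pmul => //; rewrite ?nsq_ge0.
Qed.

Lemma L2_sum_L2 u f : (forall i, L2 mu (u i)) -> cmeasurable f -> L2_sum mu u f -> L2 mu f.
Proof.
move=> hu mf /L2_sumP h; have [A hA] := h 1 ltr01.
apply: (L2_close mf (L2_bigsum A hu)); apply: le_lt_trans (hA A (fsubset_refl _)) _.
exact: ltry.
Qed.

End L2SumFacts.

Section Gabor.
Context {R : realType}.
Variables (b0 nu0 : R).
Hypotheses (b0_gt0 : 0 < b0) (nu0_gt0 : 0 < nu0).
Variables (g h : line R -> R[i]).
Local Notation mu := (mu1 R).
Hypotheses (hg : L2 mu g) (hh : L2 mu h).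
Implicit Types (x : plane R) (k : int * int) (c : int * int -> R[i]) (M : plane R -> R[i]).

Local Notation V := (STFT g h).
Local Notation pshift := (pshift b0 nu0).
Local Notation character := (character b0 nu0).
Local Notation lat := (lattice b0 nu0).

Let mV : cmeasurable V. Proof. by apply: cmeasurable_STFT; [case: hh|case: hg]. Qed.

(** The kernel of the rank-one operator that sends f to
    <f, pi(k) g> pi(k) h: one term of a Gabor multiplier. *)
Definition atom k : plane R -> R[i] := tensor (tfshift (lat k) h) (tfshift (lat k) g).

Lemma L2_atom k : L2 (mu2 R) (atom k).
Proof. by apply: L2_tensor; exact: L2_tfshift. Qed.

Lemma spreading_atom k : spreading_function (atom k) (fun x => character k x * V x).
Proof.
have := spreading_tensor (L2_tfshift (lat k) hh) (L2_tfshift (lat k) hg).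
congr spreading_function; apply/funext => x.
by rewrite STFT_covariance// symp_lattice.
Qed.

Lemma kernel_op_atom k f (t : line R) : L2 mu f ->
  kernel_op (atom k) f t = tfshift (lat k) h t * STFT g f (lat k).
Proof. by move=> hf; rewrite kernel_op_tensor//; exact: L2_tfshift. Qed.

Lemma L2_atoms (s : seq (int * int)) c : L2 (mu2 R) (fun z => \sum_(k <- s) c k * atom k z).
Proof. by apply: L2_bigsum => k; apply: L2Z; exact: L2_atom. Qed.

Lemma kernel_op_atoms (s : seq (int * int)) c f : L2 mu f ->
  {ae mu, forall t, kernel_op (fun z => \sum_(k <- s) c k * atom k z) f t =
    \sum_(k <- s) c k * STFT g f (lat k) * tfshift (lat k) h t}.
Proof.
move=> hf; have ae_f := ae_filter_ringOfSetsType mu; elim: s => [|k s IH].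
  apply: aeW => t; rewrite big_nil kernel_opE /inner -[RHS](cintegral0 mu).
  by congr cintegral; apply/funext => s; rewrite big_nil mul0r.
have := kernel_op_lin (c k) (L2_atoms s c) (L2_atom k) hf.
apply: filterS2 IH => t E1 E2; rewrite big_cons -E1.
rewrite (_ : (fun z => _) = (fun z => \sum_(k <- s) c k * atom k z + c k * atom k z)); last first.
  by apply/funext => z; rewrite big_cons addrC.
by rewrite E2 kernel_op_atom// addrC; congr (_ + _); ring.
Qed.

(** Applying an integral operator to a fixed function is continuous in the
    kernel, so the kernel series may be evaluated term by term. *)
Lemma kernel_op_L2_sum c kappa f : L2 (mu2 R) kappa -> L2 mu f ->
  L2_sum (mu2 R) (fun k z => c k * atom k z) kappa ->
  L2_sum mu (fun k t => c k * STFT g f (lat k) * tfshift (lat k) h t) (kernel_op kappa f).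
Proof.
move=> hk hf /L2_sumP H; apply/L2_sumP => e e0.
have s1 : 0 < sqf mu f + 1 by rewrite ltr_wpDl// sqf_ge0.
have [A hA] := H _ (divr_gt0 e0 s1).
exists A => B /hA {}hA; pose S z := \sum_(k <- B) c k * atom k z.
have hS : L2 (mu2 R) S by exact: L2_atoms.
have hD : L2 (mu2 R) (fun z => kappa z + (-1) * S z) by apply: L2D => //; exact: L2Z.
have -> : nsq mu (fun t => (kernel_op kappa f t -
    \sum_(k <- B) c k * STFT g f (lat k) * tfshift (lat k) h t)%R) =
    nsq mu (kernel_op (fun z => kappa z + (-1) * S z) f).
  apply: nsq_ae_eq.
  - apply: cmeasurableB; first by case: (L2_kernel_op hk hf).
    apply: cmeasurable_sum => k; apply: cmeasurableM; first exact: cmeasurable_cst.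
    by case: (L2_tfshift (lat k) hh).
  - by case: (L2_kernel_op hD hf).
  have ae_f := ae_filter_ringOfSetsType mu.
  have := kernel_op_lin (-1) hk hS hf; apply: filterS2 (kernel_op_atoms B c hf) => t E1 ->.
  by rewrite E1 mulN1r.
apply: le_trans (nsq_kernel_op_le hD hf) _.
have -> : nsq (mu2 R) (fun z => kappa z + -1 * S z) = nsq (mu2 R) (fun z => (kappa z - S z)%R).
  by congr nsq; apply/funext => z; rewrite mulN1r.
apply: (@le_trans _ _ ((e / (sqf mu f + 1))%:E * nsq mu f)%E).
  by apply: lee_wpmul2r => //; exact: nsq_ge0.
rewrite sqfE// -EFinM lee_fin mulrAC ler_pdivrMr// ler_wpM2l ?ltW//.
by rewrite ltrDl.
Qed.

(** Both the multiplier and the integral operator send f to the sum of the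
    same series. *)
Lemma gabor_multiplier_kernel c kappa G : L2 (mu2 R) kappa ->
  L2_sum (mu2 R) (fun k z => c k * atom k z) kappa ->
  gabor_multiplier b0 nu0 g h c G -> HS_kernel G kappa.
Proof.
move=> hk hs hG; apply/HS_kernelP; split => // f hf.
have [hGf sGf] := hG f hf; have sK := kernel_op_L2_sum hk hf hs.
have hKf := L2_kernel_op hk hf.
have hu k : L2 mu (fun t => c k * STFT g f (lat k) * tfshift (lat k) h t).
  by apply: L2Z; exact: L2_tfshift.
have := L2_sum_unique hu hGf hKf sGf sK; move=> /(nsq_eq0 (L2_cmeas (L2B hGf hKf))).
have ae_f := ae_filter_ringOfSetsType mu.
by apply: filterS => t /eqP; rewrite subr_eq0 => /eqP.
Qed.

Lemma kernel_op_gabor_multiplier c kappa : L2 (mu2 R) kappa ->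
  L2_sum (mu2 R) (fun k z => c k * atom k z) kappa ->
  gabor_multiplier b0 nu0 g h c (kernel_op kappa).
Proof. by move=> hk hs f hf; split; [exact: L2_kernel_op|exact: kernel_op_L2_sum]. Qed.

Lemma UfunE x : Ufun b0 nu0 g h x = (\esum_(k in [set: int * int]) (sqn (V (pshift k x)))%:E)%E.
Proof. by rewrite /Ufun; apply: eq_esum => k _; rewrite sqn_normc. Qed.

Lemma Ufun_ge0 x : (0 <= Ufun b0 nu0 g h x)%E.
Proof. by rewrite UfunE; apply: esum_ge0 => k _; rewrite lee_fin sqn_ge0. Qed.

Lemma measurable_Ufun : measurable_fun setT (Ufun b0 nu0 g h).
Proof.
rewrite (_ : Ufun _ _ _ _ = fun x => (\esum_(k in [set: int * int]) (sqn (V (pshift k x)))%:E)%E); last first.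
  by apply/funext => x; rewrite UfunE.
apply: measurable_esum => [k|k x]; last by rewrite lee_fin sqn_ge0.
apply: measurable_sqnE; apply: cmeasurable_comp => //.
by case: (pshift_preserving b0 nu0 k).
Qed.

Lemma Ufun_periodic : periodic2 b0 nu0 (Ufun b0 nu0 g h).
Proof.
move=> x l; rewrite !UfunE.
rewrite [RHS](@reindex_esum _ _ _ setT setT (fun k => k + l)).
- by apply: eq_esum => k _; rewrite pshiftD.
- split => //; first by move=> i j _ _ /addIr.
  by move=> k _; exists (k - l) => //; rewrite subrK.
Qed.

Lemma sqn_le_Ufun x : ((sqn (V x))%:E <= Ufun b0 nu0 g h x)%E.
Proof.
rewrite UfunE; have := @fset_sum_le_esum _ _ (fun k => sqn (V (pshift k x))) [fset 0]%fset.
by rewrite big_seq_fset1 pshift0; apply => k; exact: sqn_ge0.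
Qed.

(** Unfolding: the factor M is constant on the orbits of the lattice of
    periods, and what is summed is the definition of U. *)
Lemma nsq_periodic_STFT a b M : cmeasurable M -> periodic2 b0 nu0 M ->
  nsq (mu2 R) (fun x => M x * V x) =
  (\int[mu2 R]_(x in box b0 nu0 a b) ((sqn (M x))%:E * Ufun b0 nu0 g h x))%E.
Proof.
move=> mM pM; rewrite /nsq (integral_unfold b0_gt0 nu0_gt0 a b); last 2 first.
- by apply: measurable_sqnE; exact: cmeasurableM.
- by move=> x; rewrite lee_fin sqn_ge0.
apply: eq_integral => x _; rewrite UfunE -esumZl ?sqn_ge0//; last by move=> k; exact: sqn_ge0.
by apply: eq_esum => k _; rewrite sqnM pM.
Qed.

End Gabor.

Section RieszBounds.
Context {R : realType}.
Variables (b0 nu0 : R).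
Hypotheses (b0_gt0 : 0 < b0) (nu0_gt0 : 0 < nu0).
Variables (g h : line R -> R[i]).
Local Notation mu := (mu1 R).
Hypotheses (hg : L2 mu g) (hh : L2 mu h).
Implicit Types (x : plane R) (k : int * int) (c : int * int -> R[i]) (M : plane R -> R[i]).

Local Notation V := (STFT g h).
Local Notation pshift := (pshift b0 nu0).
Local Notation character := (character b0 nu0).
Local Notation atom := (atom b0 nu0 g h).
Local Notation U := (Ufun b0 nu0 g h).
Local Notation u x := (fine (U x)).
Local Notation mbox a b := (mrestr (mu2 R) (measurable_box b0 nu0 a b)).

Variables (A B : R).
Hypotheses (A_gt0 : 0 < A) (leAB : A <= B).
Hypothesis Ubnd : {ae mu2 R, forall x, (A%:E <= U x <= B%:E)%E}.

Let B_ge0 : 0 <= B. Proof. exact: le_trans (ltW A_gt0) leAB. Qed.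
Let mV : cmeasurable V. Proof. by apply: cmeasurable_STFT; [case: hh|case: hg]. Qed.

Lemma measurable_u : measurable_fun setT (fun x => u x).
Proof. by apply: measurableT_comp => //; exact: measurable_Ufun. Qed.

Lemma measurable_uV : measurable_fun setT (fun x => (u x)^-1).
Proof.
rewrite (_ : (fun x => _) = (fun x => u x `^ (-1))).
  by apply: (measurableT_comp (measurable_powR _)); exact: measurable_u.
by apply/funext => x; rewrite powR_inv1// fine_ge0// Ufun_ge0.
Qed.

Lemma u_bnd : {ae mu2 R, forall x, U x = (u x)%:E /\ A <= u x <= B}.
Proof.
have ae_f := ae_filter_ringOfSetsType (mu2 R).
apply: filterS Ubnd => x; case: (U x) => [r| |]//= /andP[].
by rewrite leye_eq.
Qed.

Lemma nsq_periodic_STFT_le a b M : cmeasurable M -> periodic2 b0 nu0 M ->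
  (nsq (mu2 R) (fun x => (M x * V x)%R) <= B%:E * nsq (mbox a b) M)%E.
Proof.
move=> mM pM; rewrite (nsq_periodic_STFT b0_gt0 nu0_gt0 hg hh a b mM pM) nsq_mrestr//.
rewrite -ge0_integralZl//; last 3 first.
- exact: measurable_box.
- by apply: measurable_funTS; exact: measurable_sqnE.
- by move=> x _; rewrite lee_fin sqn_ge0.
have ae_f := ae_filter_ringOfSetsType (mu2 R).
apply: ae_ge0_le_integral.
- exact: measurable_box.
- by move=> x _; apply: mule_ge0; [rewrite lee_fin sqn_ge0|exact: Ufun_ge0].
- apply: measurable_funTS; apply: emeasurable_funM; first exact: measurable_sqnE.
  exact: measurable_Ufun.
- by move=> x _; rewrite mule_ge0// lee_fin// sqn_ge0.
- by apply: measurable_funTS; apply: measurable_funeM; exact: measurable_sqnE.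
apply: filterS Ubnd => x /andP[_ h2] _; rewrite muleC; apply: lee_wpmul2r => //.
by rewrite lee_fin sqn_ge0.
Qed.

Lemma spreading_atoms (s : seq (int * int)) c :
  spreading_function (fun z => \sum_(k <- s) c k * atom k z)
    (fun x => (\sum_(k <- s) c k * character k x) * V x).
Proof.
have := spreading_sum s c (L2_atom b0 nu0 hg hh) (spreading_atom b0 nu0 hg hh).
congr spreading_function; apply/funext => x; rewrite mulr_suml.
by apply: eq_bigr => k _; rewrite mulrA.
Qed.

Lemma cmeasurable_characters (s : seq (int * int)) c :
  cmeasurable (fun x => \sum_(k <- s) c k * character k x).
Proof.
apply: cmeasurable_sum => k; apply: cmeasurableM; first exact: cmeasurable_cst.
exact: cmeasurable_character.
Qed.

Lemma periodic_characters (s : seq (int * int)) c :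
  periodic2 b0 nu0 (fun x => \sum_(k <- s) c k * character k x).
Proof. by move=> x k; apply: eq_bigr => i _; rewrite character_periodic. Qed.

(** The upper bound on the periodization makes the shifted rank-one kernels a
    Bessel system, so that square-summable coefficients give a kernel. *)
Lemma atoms_synthesis c : ell2 c ->
  exists2 kappa, L2 (mu2 R) kappa & L2_sum (mu2 R) (fun k z => c k * atom k z) kappa.
Proof.
apply: (L2_synthesis (L2_atom b0 nu0 hg hh) (C := B * (nu0^-1 * b0^-1))).
  by rewrite mulr_ge0// ltW// area_gt0.
move=> d S; rewrite -(spreading_isometry (L2_atoms b0 nu0 hg hh S d) (spreading_atoms S d)).
apply: le_trans (nsq_periodic_STFT_le 0 0 (cmeasurable_characters S d) (periodic_characters S d)) _.
rewrite (orth_nsq (L2_character b0_gt0 nu0_gt0 0 0) (character_orth b0_gt0 nu0_gt0 0 0)).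
by rewrite -EFinM mulrA.
Qed.

(** For finite symbols this is the isometry [spreading_isometry]. The bound
    on U lets the multiplication by V act continuously on periodic functions,
    so both sides pass to the limit along the two series. *)
Lemma gabor_distance a b c kappa eta kappa' M :
  L2 (mu2 R) kappa -> spreading_function kappa eta ->
  L2 (mu2 R) kappa' -> L2_sum (mu2 R) (fun k z => c k * atom k z) kappa' ->
  cmeasurable M -> periodic2 b0 nu0 M ->
  L2_sum (mbox a b) (fun k x => c k * character k x) M ->
  nsq (mu2 R) (fun z => (kappa z - kappa' z)%R) =
  nsq (mu2 R) (fun x => (eta x - M x * V x)%R).
Proof.
move=> hk hs hk' hk's mM pM hM.
have heta : L2 (mu2 R) eta by case: hs.
have LM : L2 (mbox a b) M.
  by apply: (L2_sum_L2 _ mM hM) => k; apply: L2Z; exact: L2_character.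
have LMV : L2 (mu2 R) (fun x => M x * V x).
  apply/L2P; split; first exact: cmeasurableM.
  apply: le_lt_trans (nsq_periodic_STFT_le a b mM pM) _.
  by rewrite sqfE// -EFinM ltry.
apply: nsq_eq_approx; [exact: L2B|exact: L2B|move=> e e0].
have B1 : 0 < B + 1 by rewrite ltr_wpDl.
move/L2_sumP: hk's => /(_ e e0)[S1 hS1].
move/L2_sumP: hM => /(_ _ (divr_gt0 e0 B1))[S2 hS2].
have {}hS1 := hS1 _ (fsubsetUl S1 S2); have {}hS2 := hS2 _ (fsubsetUr S1 S2).
move: (S1 `|` S2)%fset hS1 hS2 => S hS1 hS2 {S1 S2}.
have hA := L2_atoms b0 nu0 hg hh S c.
have hsp := spreadingB hk hA hs (spreading_atoms S c).
have LS : L2 (mu2 R) (fun x => (\sum_(k <- S) c k * character k x) * V x).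
  by case: (spreading_atoms S c).
exists (fun z => kappa z - \sum_(k <- S) c k * atom k z).
exists (fun x => eta x - (\sum_(k <- S) c k * character k x) * V x).
split; [exact: L2B|exact: L2B| | |].
- apply: le_trans hS1; rewrite nsqBC le_eqVlt; apply/orP; left; apply/eqP.
  by congr nsq; apply/funext => z; ring.
- rewrite (_ : (fun x => _) = (fun x => - ((M x - \sum_(k <- S) c k * character k x) * V x))); last first.
    by apply/funext => x; ring.
  rewrite nsqN.
  have pD : periodic2 b0 nu0 (fun x => M x - \sum_(k <- S) c k * character k x).
    by move=> x k; rewrite pM; congr (_ - _); exact: periodic_characters.
  have mD := cmeasurableB mM (cmeasurable_characters S c).
  apply: le_trans (nsq_periodic_STFT_le a b mD pD) _.
  apply: (@le_trans _ _ (B%:E * (e / (B + 1))%:E)%E); first exact: lee_wpmul2l.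
  rewrite -EFinM lee_fin mulrA ler_pdivrMr// mulrC ler_wpM2l ?ltW//.
  by rewrite ltrDl.
- by rewrite (spreading_isometry (L2B hk hA) hsp).
Qed.

(** ** The error as an integral over one period *)

Variables (eta : plane R -> R[i]) (a b : R).
Hypothesis heta : L2 (mu2 R) eta.
Local Notation C := (box b0 nu0 a b).
Hypothesis eta_supp : {ae mu2 R, forall x, ~ C x -> eta x = 0}.

(** The fraction of the energy of eta at x that no Gabor multiplier can
    reproduce. *)
Definition loss x : R := 1 - sqn (V x) / u x.

Definition optimal x : R[i] := eta x * (V x)^* / (u x)%:C.

Lemma optimalE x : optimal x = eta x * (V x)^* * ((u x)^-1)%:C.
Proof. by rewrite /optimal fmorphV. Qed.

Lemma loss_bnd x : 0 <= loss x <= 1.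
Proof.
rewrite /loss; have := sqn_le_Ufun b0 nu0 g h x; have := Ufun_ge0 b0 nu0 g h x.
have s0 := sqn_ge0 (V x).
case: (U x) => [r| |]//=; rewrite ?invr0 ?mulr0 ?subr0 ?lexx ?ler01//.
rewrite !lee_fin le_eqVlt => /predU1P[<- _|r0 h1]; first by rewrite invr0 mulr0 subr0 lexx ler01.
by rewrite subr_ge0 ler_pdivrMr// mul1r h1 gerBl divr_ge0// ltW.
Qed.

Lemma measurable_loss : measurable_fun setT loss.
Proof.
apply: measurable_funB; first exact: measurable_cst.
apply: measurable_funM; first exact: measurable_sqn.
exact: measurable_uV.
Qed.

Lemma cmeasurable_optimal : cmeasurable optimal.
Proof.
apply: cmeasurableM; first by apply: cmeasurableM; [case: heta|exact: cmeasurableJ].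
rewrite (_ : (fun x => _) = (fun x => ((u x)^-1)%:C)); last by apply/funext => x; rewrite fmorphV.
by apply: cmeasurable_real; exact: measurable_uV.
Qed.

(** Here r plays the part of U and |m v|^2 is the term of the unshifted
    translate, which is counted in |m|^2 r. *)
Lemma square_completion (e m v : R[i]) (r : R) : r != 0 ->
  sqn (e - m * v) + sqn m * r - sqn (m * v) =
  sqn e * (1 - sqn v / r) + r * sqn (m - e * v^* / r%:C).
Proof.
move=> r0; have -> : e * v^* / r%:C = (e * v^*) * (r^-1)%:C by rewrite fmorphV.
case: e m v => [e1 e2] [m1 m2] [v1 v2].
rewrite /sqn !(cReD, cImD, cReN, cImN, cReM, cImM, cReJ, cImJ) /=.
by field.
Qed.

(** Two families that differ at one index only, in an additive form that
    avoids subtracting possibly infinite sums. *)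
Lemma esum_pick (F G : int * int -> R) (x y : R) : (forall k, 0 <= F k) -> (forall k, 0 <= G k) ->
  0 <= x -> 0 <= y -> F 0 + x = G 0 + y -> (forall k, k != 0 -> F k = G k) ->
  (\esum_(k in [set: int * int]) (F k)%:E + x%:E =
   \esum_(k in [set: int * int]) (G k)%:E + y%:E)%E.
Proof.
move=> F0 G0 x0 y0 E0 E.
have pick (z : R) : 0 <= z -> (z%:E = \esum_(k in [set: int * int]) (if k == 0%R then z else 0)%:E)%E.
  move=> z0; transitivity (\esum_(k in [set (0%R : int * int)]) z%:E)%E.
    by rewrite esum_set1.
  rewrite esum_mkcond; apply: eq_esum => k _; case: eqP => [->|k0].
    by rewrite mem_set.
  by rewrite memNset.
rewrite (pick x)// (pick y)// -!esumD//; last 4 first.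
- by move=> k _; rewrite lee_fin.
- by move=> k _; case: ifP => _; rewrite lee_fin.
- by move=> k _; rewrite lee_fin.
- by move=> k _; case: ifP => _; rewrite lee_fin.
apply: eq_esum => k _; rewrite -!EFinD; congr EFin.
by case: eqP => [->//|/eqP k0]; rewrite !addr0 E.
Qed.

(** On the period containing the support of eta no other translate of eta
    contributes, and the summand is completed to a square. *)
Lemma error_split M : cmeasurable M -> periodic2 b0 nu0 M ->
  (nsq (mu2 R) (fun x => (eta x - M x * V x)%R) =
   \int[mu2 R]_(x in C) (sqn (eta x) * loss x)%:E +
   \int[mu2 R]_(x in C) (u x * sqn (M x - optimal x)%R)%:E)%E.
Proof.
move=> mM pM; have meta := L2_cmeas heta.
have mE : cmeasurable (fun x => eta x - M x * V x) by apply: cmeasurableB => //; exact: cmeasurableM.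
rewrite /nsq (integral_unfold b0_gt0 nu0_gt0 a b); last 2 first.
- exact: measurable_sqnE.
- by move=> x; rewrite lee_fin sqn_ge0.
rewrite -ge0_integralD//; last 5 first.
- exact: measurable_box.
- by move=> x _; rewrite lee_fin mulr_ge0 ?sqn_ge0//; have /andP[] := loss_bnd x.
- apply: measurable_funTS; apply/measurable_EFinP; apply: measurable_funM.
    exact: measurable_sqn.
  exact: measurable_loss.
- by move=> x _; rewrite lee_fin mulr_ge0 ?sqn_ge0// fine_ge0// Ufun_ge0.
- apply: measurable_funTS; apply/measurable_EFinP; apply: measurable_funM.
    exact: measurable_u.
  by apply: measurable_sqn; apply: cmeasurableB => //; exact: cmeasurable_optimal.
have ae_f := ae_filter_ringOfSetsType (mu2 R).
apply: ae_eq_integral.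
- exact: measurable_box.
- apply: measurable_funTS; apply: measurable_esum => [k|k x]; last by rewrite lee_fin sqn_ge0.
  apply: (measurableT_comp (measurable_sqnE mE)); by case: (pshift_preserving b0 nu0 k).
- apply: measurable_funTS; apply/measurable_EFinP; apply: measurable_funD.
    apply: measurable_funM; first exact: measurable_sqn.
    exact: measurable_loss.
  apply: measurable_funM; first exact: measurable_u.
  by apply: measurable_sqn; apply: cmeasurableB => //; exact: cmeasurable_optimal.
have /(@ae_forall_count R (int * int)%type) eta_k :
    forall k, {ae mu2 R, forall x, ~ C (pshift k x) -> eta (pshift k x) = 0}.
  by move=> k; exact: (ae_preserving (pshift_preserving b0 nu0 k) eta_supp).
apply: filterS2 eta_k u_bnd => x etak [uE /andP[uA uB]] Cx.
have u0 : u x != 0 by rewrite gt_eqF// (lt_le_trans A_gt0).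
have [l _ lu] := box_uniq b0_gt0 nu0_gt0 a b x.
have l0 : l = 0 by rewrite (lu 0)// pshift0.
have Nk k : k != 0 -> eta (pshift k x) = 0.
  by move=> k0; apply: etak => /lu; rewrite l0 => /eqP; rewrite (negbTE k0).
have G k : k != 0 -> sqn (eta (pshift k x) - M (pshift k x) * V (pshift k x)) =
    sqn (M x) * sqn (V (pshift k x)).
  by move=> k0; rewrite Nk// sub0r sqnN sqnM pM.
have G0 : sqn (eta (pshift 0 x) - M (pshift 0 x) * V (pshift 0 x)) + sqn (M x * V x) =
   sqn (M x) * sqn (V (pshift 0 x)) + sqn (eta x - M x * V x).
  by rewrite pshift0 addrC sqnM.
have HS := esum_pick (fun k => sqn_ge0 (eta (pshift k x) - M (pshift k x) * V (pshift k x)))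
  (fun k => mulr_ge0 (sqn_ge0 (M x)) (sqn_ge0 (V (pshift k x)))) (sqn_ge0 _) (sqn_ge0 _) G0 G.
rewrite (esumZl (sqn_ge0 (M x)) (fun k => sqn_ge0 (V (pshift k x)))) -UfunE uE in HS.
rewrite -EFinM -EFinD in HS.
move: HS; set S := (\esum_(k in _) _)%E => HS.
have {}HS : S = (sqn (M x) * u x + sqn (eta x - M x * V x) - sqn (M x * V x))%:E.
  by move: HS; case: S => [r| |]//= [<-]; congr EFin; ring.
rewrite HS -EFinD; congr EFin.
by rewrite [sqn (M x) * u x + _]addrC square_completion.
Qed.

End RieszBounds.

(** * The best Gabor multiplier *)

Section BestApproximation.
Context {R : realType}.
Variables (b0 nu0 : R).
Hypotheses (b0_gt0 : 0 < b0) (nu0_gt0 : 0 < nu0).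
Variables (g h : line R -> R[i]).
Local Notation mu := (mu1 R).
Hypotheses (hg : L2 mu g) (hh : L2 mu h).
Implicit Types (x : plane R) (k : int * int) (c m : int * int -> R[i]) (M : plane R -> R[i]).

Local Notation V := (STFT g h).
Local Notation character := (character b0 nu0).
Local Notation atom := (atom b0 nu0 g h).
Local Notation U := (Ufun b0 nu0 g h).
Local Notation u x := (fine (U x)).
Local Notation mbox a b := (mrestr (mu2 R) (measurable_box b0 nu0 a b)).

Variables (A B : R).
Hypotheses (A_gt0 : 0 < A) (leAB : A <= B).
Hypothesis Ubnd : {ae mu2 R, forall x, (A%:E <= U x <= B%:E)%E}.

Variables (H : @operator R) (kappa eta : plane R -> R[i]) (a b : R).
Hypotheses (Hkappa : HS_kernel H kappa) (Heta : spreading_function kappa eta).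
Local Notation C := (box b0 nu0 a b).
Hypothesis eta_supp : {ae mu2 R, forall x, ~ C x -> eta x = 0}.

Local Notation loss := (loss b0 nu0 g h).
Local Notation optimal := (optimal b0 nu0 g h eta).
Local Notation periodic := (periodic2 b0 nu0).
Local Notation fourier_sum c M := (L2_sum (mbox a b) (fun k x => c k * character k x) M).
Local Notation error M := (nsq (mu2 R) (fun x => (eta x - M x * V x)%R)).

Let mV : cmeasurable V. Proof. by apply: cmeasurable_STFT; [case: hh|case: hg]. Qed.
Let hkappa : L2 (mu2 R) kappa. Proof. by case: Hkappa. Qed.
Let heta : L2 (mu2 R) eta. Proof. by case: Heta. Qed.
Let L2char := L2_character b0_gt0 nu0_gt0 a b.
Let charorth := character_orth b0_gt0 nu0_gt0 a b.
Let area0 := area_gt0 b0_gt0 nu0_gt0.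

Lemma l2E m : l2 m <-> ell2 m.
Proof.
rewrite /l2 /ell2; set X := (X in (X < +oo)%E); set Y := (Y in _ <-> _ (Y < +oo)%E).
by have -> : X = Y by apply: eq_esum => k _; rewrite sqn_normc.
Qed.

Lemma HS_distance c G M : ell2 c -> gabor_multiplier b0 nu0 g h c G ->
  cmeasurable M -> periodic M -> fourier_sum c M ->
  HS_norm (fun f t => (H f t - G f t)%R) = L2norm (mu2 R) (fun x => (eta x - M x * V x)%R).
Proof.
move=> hc hG mM pM hM.
have [k hk ks] := atoms_synthesis b0_gt0 nu0_gt0 hg hh A_gt0 leAB Ubnd hc.
rewrite (HS_normE (HS_kernelB Hkappa (gabor_multiplier_kernel hg hh hk ks hG))).
rewrite !L2norm_nsq.
by rewrite (gabor_distance b0_gt0 nu0_gt0 hg hh A_gt0 leAB Ubnd hkappa Heta hk ks mM pM hM).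
Qed.

Lemma error_splitE M : cmeasurable M -> periodic M -> (error M =
   \int[mu2 R]_(x in C) (sqn (eta x) * loss x)%:E +
   \int[mu2 R]_(x in C) (u x * sqn (M x - optimal x)%R)%:E)%E.
Proof. exact: (error_split b0_gt0 nu0_gt0 hg hh A_gt0 Ubnd heta eta_supp). Qed.

Let moptimal := cmeasurable_optimal b0 nu0 hg hh heta.

(** By |V|^2 <= U the modulus of the minimizer is at most |eta| over the
    square root of A. *)
Lemma L2_optimal : L2 (mbox a b) optimal.
Proof.
apply/L2P; split => //; rewrite nsq_mrestr//.
apply: (@le_lt_trans _ _ (\int[mu2 R]_(x in C) ((A^-1)%:E * (sqn (eta x))%:E))%E).
  have ae_f := ae_filter_ringOfSetsType (mu2 R).
  apply: ae_ge0_le_integral.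
  - exact: measurable_box.
  - by move=> x _; rewrite lee_fin sqn_ge0.
  - by apply: measurable_funTS; exact: measurable_sqnE.
  - by move=> x _; rewrite mule_ge0// lee_fin ?sqn_ge0// invr_ge0 ltW.
  - by apply: measurable_funTS; apply: measurable_funeM; apply: measurable_sqnE; case: heta.
  have := u_bnd Ubnd; apply: filterS => x [uE /andP[uA uB]] _.
  have u0 : 0 < u x by rewrite (lt_le_trans A_gt0).
  have := sqn_le_Ufun b0 nu0 g h x; rewrite uE lee_fin => Vu.
  rewrite -EFinM lee_fin optimalE !sqnM sqn_conj sqnR mulrC mulrCA.
  rewrite [A^-1 * _]mulrC ler_wpM2l ?sqn_ge0//.
  apply: (@le_trans _ _ ((u x)^-1 ^+ 2 * u x)).
    by rewrite ler_wpM2l// sqr_ge0.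
  by rewrite expr2 -mulrA mulVf ?gt_eqF// mulr1 lef_pV2.
rewrite ge0_integralZl//; last 4 first.
- exact: measurable_box.
- by apply: measurable_funTS; apply: measurable_sqnE; case: heta.
- by move=> x _; rewrite lee_fin sqn_ge0.
- by rewrite lee_fin invr_ge0 ltW.
rewrite -(nsq_mrestr _ (measurable_box b0 nu0 a b)); last by case: heta.
by rewrite (sqfE (L2_mrestr _ heta)) -EFinM ltry.
Qed.

Definition best_symbol := coef (mbox a b) character (nu0^-1 * b0^-1) optimal.

Lemma ell2_best_symbol : ell2 best_symbol.
Proof. exact: (bessel_ell2 L2char area0 charorth L2_optimal). Qed.

Lemma best_symbol_transform : exists M, [/\ cmeasurable M, periodic M,
  fourier_sum best_symbol M & {ae mu2 R, forall x, C x -> M x = optimal x}].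
Proof.
have [M [mM pM LM hM]] := periodic_synthesis b0_gt0 nu0_gt0 a b ell2_best_symbol.
exists M; split => //.
have hO := orth_expansion L2char area0 charorth (@character_total _ _ _ b0_gt0 nu0_gt0 a b) L2_optimal.
have hu k : L2 (mbox a b) (fun x => best_symbol k * character k x) by apply: L2Z; exact: L2char.
have := L2_sum_unique hu LM L2_optimal hM hO.
move=> /(nsq_eq0 (L2_cmeas (L2B LM L2_optimal))) /(ae_mrestr _ _).
have ae_f := ae_filter_ringOfSetsType (mu2 R).
by apply: filterS => x E Cx; apply/eqP; rewrite -subr_eq0 E.
Qed.

Lemma excess_ge0 M : (0 <= \int[mu2 R]_(x in C) (u x * sqn (M x - optimal x)%R)%:E)%E.
Proof.
by apply: integral_ge0 => x _; rewrite lee_fin mulr_ge0 ?sqn_ge0// fine_ge0// Ufun_ge0.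
Qed.

Lemma measurable_excess M : cmeasurable M ->
  measurable_fun setT (fun x => (u x * sqn (M x - optimal x)%R)%:E).
Proof.
move=> mM; apply/measurable_EFinP; apply: measurable_funM; first exact: measurable_u.
by apply: measurable_sqn; exact: cmeasurableB.
Qed.

Lemma error_optimal M : cmeasurable M -> periodic M ->
  {ae mu2 R, forall x, C x -> M x = optimal x} ->
  error M = (\int[mu2 R]_(x in C) (sqn (eta x) * loss x)%:E)%E.
Proof.
move=> mM pM E; rewrite error_splitE//.
rewrite [X in (_ + X)%E](_ : _ = 0%E) ?adde0//.
rewrite (ae_eq_integral (cst 0%E)) ?integral0//.
- exact: measurable_box.
- by apply: measurable_funTS; exact: measurable_excess.
have ae_f := ae_filter_ringOfSetsType (mu2 R).
by apply: filterS E => x E Cx /=; rewrite E// subrr sqn0 mulr0.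
Qed.

Lemma loss_le : (\int[mu2 R]_(x in C) (sqn (eta x) * loss x)%:E <= nsq (mu2 R) eta)%E.
Proof.
have meta : cmeasurable eta by case: heta.
apply: (@le_trans _ _ (\int[mu2 R]_(x in C) (sqn (eta x))%:E)%E).
  apply: ge0_le_integral.
  - exact: measurable_box.
  - by move=> x _; rewrite lee_fin mulr_ge0 ?sqn_ge0//; have /andP[] := loss_bnd b0 nu0 g h x.
  - apply: measurable_funTS; apply/measurable_EFinP; apply: measurable_funM.
      exact: measurable_sqn.
    exact: measurable_loss.
  - by apply: measurable_funTS; exact: measurable_sqnE.
  - move=> x _; rewrite lee_fin ler_piMr ?sqn_ge0//; by have /andP[] := loss_bnd b0 nu0 g h x.
apply: ge0_subset_integral => //.
- exact: measurable_box.
- exact: measurable_sqnE.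
- by move=> x _; rewrite lee_fin sqn_ge0.
Qed.

Lemma nsq_le_L2norm (f1 f2 : plane R -> R[i]) :
  (L2norm (mu2 R) f1 <= L2norm (mu2 R) f2)%E -> (nsq (mu2 R) f1 <= nsq (mu2 R) f2)%E.
Proof.
by move=> h12; rewrite -!L2norm_sqr !expe2; apply: lee_pmul => //; exact: L2norm_ge0.
Qed.

(** Compare with the symbol of the minimizer: the second term of the error
    must vanish, and U is bounded below. *)
Lemma best_transform m M : best_gabor_multiplier b0 nu0 g h H m ->
  cmeasurable M -> periodic M -> fourier_sum m M ->
  {ae mu2 R, forall x, C x -> M x = optimal x}.
Proof.
move=> [/l2E hm [G [hG best]]] mM pM hM.
have [M' [mM' pM' hM' EM']] := best_symbol_transform.
have [k hk ks] := atoms_synthesis b0_gt0 nu0_gt0 hg hh A_gt0 leAB Ubnd ell2_best_symbol.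
have hK := kernel_op_gabor_multiplier hg hh hk ks.
have := best _ _ ((l2E _).2 ell2_best_symbol) hK.
rewrite (HS_distance hm hG mM pM hM) (HS_distance ell2_best_symbol hK mM' pM' hM').
move=> /nsq_le_L2norm; rewrite (error_optimal mM' pM' EM') error_splitE//.
have := loss_le; rewrite (sqfE heta).
have : (0 <= \int[mu2 R]_(x in C) (sqn (eta x) * loss x)%:E)%E.
  by apply: integral_ge0 => x _; rewrite lee_fin mulr_ge0 ?sqn_ge0//; have /andP[] := loss_bnd b0 nu0 g h x.
case: (\int[mu2 R]_(x in C) (sqn (eta x) * loss x)%:E)%E => [r| |]//= _ _.
have := excess_ge0 M => e0 e1.
have : (\int[mu2 R]_(x in C) `|(u x * sqn (M x - optimal x)%R)%:E|)%E = 0%E.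
  under eq_integral do rewrite gee0_abs ?lee_fin ?mulr_ge0 ?sqn_ge0 ?fine_ge0 ?Ufun_ge0//.
  apply/eqP; rewrite eq_le e0 andbT; move: e1 e0.
  case: (\int[mu2 R]_(x in C) _)%E => [s| |]//=.
  by rewrite -EFinD !lee_fin gerDl.
move=> /(ae_eq_integral_abs (mu2 R) (measurable_box b0 nu0 a b) (measurable_funTS (measurable_excess mM))).
have ae_f := ae_filter_ringOfSetsType (mu2 R).
apply: filterS2 (u_bnd Ubnd) => x [uE /andP[uA _]] E /E [] /eqP.
rewrite mulf_eq0 gt_eqF ?(lt_le_trans A_gt0)//= => /eqP /sqn_eq0 /eqP.
by rewrite subr_eq0 => /eqP.
Qed.

(** The Fourier series of two best symbols agree almost everywhere on a
    period, so their coefficients agree. *)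
Lemma best_unique m : best_gabor_multiplier b0 nu0 g h H m -> m = best_symbol.
Proof.
move=> hm; have [/l2E l2m _] := hm.
have [M [mM pM LM hM]] := periodic_synthesis b0_gt0 nu0_gt0 a b l2m.
rewrite -(coef_L2_sum L2char area0 charorth LM hM).
apply/funext => k; rewrite /best_symbol /coef; congr (_ / _).
have mc := cmeasurable_character b0 nu0 k.
apply: cintegral_ae.
- by apply: cmeasurableM => //; exact: cmeasurableJ.
- by apply: cmeasurableM => //; exact: cmeasurableJ.
have /(ae_mrestr (mu2 R) (measurable_box b0 nu0 a b)) := best_transform hm mM pM hM.
have ae_f := ae_filter_ringOfSetsType (mbox a b).
by apply: filterS => x ->.
Qed.

Lemma best_symbol_best : best_gabor_multiplier b0 nu0 g h H best_symbol.
Proof.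
split; first exact/l2E/ell2_best_symbol.
have [M [mM pM hM EM]] := best_symbol_transform.
have [k hk ks] := atoms_synthesis b0_gt0 nu0_gt0 hg hh A_gt0 leAB Ubnd ell2_best_symbol.
have hK := kernel_op_gabor_multiplier hg hh hk ks.
exists (kernel_op k); split => // m' G' /l2E hm' hG'.
have [M' [mM' pM' LM' hM']] := periodic_synthesis b0_gt0 nu0_gt0 a b hm'.
rewrite (HS_distance hm' hG' mM' pM' hM') (HS_distance ell2_best_symbol hK mM pM hM).
rewrite !L2norm_nsq; apply: gt0_ler_poweR.
- by rewrite invr_ge0.
- by rewrite in_itv/= nsq_ge0 leey.
- by rewrite in_itv/= nsq_ge0 leey.
by rewrite (error_optimal mM pM EM) error_splitE// leeDl// excess_ge0.
Qed.

(** The convergence of the series does not depend on the period on which it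
    is measured, all functions involved being periodic. *)
Lemma symplectic_FT_box m M : symplectic_FT b0 nu0 m M <->
  [/\ cmeasurable M, periodic M & fourier_sum m M].
Proof.
have E : L2_sum (mrestr (mu2 R) (measurable_period_box b0 nu0)) (fun k x => m k * character k x) M <->
    L2_sum (mbox 0 0) (fun k x => m k * character k x) M.
  move: (measurable_period_box b0 nu0) (measurable_box b0 nu0 0 0).
  by rewrite -box_period => m1 m2; rewrite (Prop_irrelevance m1 m2).
split => [[mM pM /E hM]|[mM pM hM]]; split => //.
  exact: (L2_sum_box_change b0_gt0 nu0_gt0 a b mM pM hM).
by apply/E; exact: (L2_sum_box_change b0_gt0 nu0_gt0 0 0 mM pM hM).
Qed.

Lemma symplectic_FT_exists m : ell2 m -> exists M, symplectic_FT b0 nu0 m M.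
Proof.
move=> hm; have [M [mM pM LM hM]] := periodic_synthesis b0_gt0 nu0_gt0 a b hm.
by exists M; apply/symplectic_FT_box.
Qed.

(** ** Error bounds *)

Lemma error_le_nsq M : cmeasurable M -> periodic M ->
  {ae mu2 R, forall x, C x -> M x = optimal x} -> (error M <= nsq (mu2 R) eta)%E.
Proof. by move=> mM pM EM; rewrite error_optimal//; exact: loss_le. Qed.

(** Being finite, the supremum can be pulled out of integrals. *)
Lemma loss_ess_sup (D : set (plane R)) (mD : measurable D) : (0 < mu2 R D)%E ->
  exists2 s : R, ess_sup (mrestr (mu2 R) mD) (defect b0 nu0 g h) = s%:E & 0 <= s.
Proof.
move=> D0; have m0 : (0 < mrestr (mu2 R) mD setT)%E by rewrite /mrestr setTI.
have dE x : defect b0 nu0 g h x = (loss x)%:E by rewrite /defect sqn_normc.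
have h1 : (ess_sup (mrestr (mu2 R) mD) (defect b0 nu0 g h) <= 1)%E.
  by apply/ess_supP; apply: aeW => x; rewrite dE lee_fin; have /andP[] := loss_bnd b0 nu0 g h x.
have h0 : (0 <= ess_sup (mrestr (mu2 R) mD) (defect b0 nu0 g h))%E.
  by apply: ess_sup_gee => //; apply: aeW => x; rewrite dE lee_fin; have /andP[] := loss_bnd b0 nu0 g h x.
case: (ess_sup _ _) h0 h1 => [s| |]//; by exists s.
Qed.

Lemma error_le_ess_sup (mC : measurable C) M : (0 < mu2 R C)%E -> cmeasurable M -> periodic M ->
  {ae mu2 R, forall x, C x -> M x = optimal x} ->
  (error M <= nsq (mu2 R) eta * ess_sup (mrestr (mu2 R) mC) (defect b0 nu0 g h))%E.
Proof.
move=> C0 mM pM EM; rewrite error_optimal//.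
have meta : cmeasurable eta by case: heta.
have := ess_sup_ge (mrestr (mu2 R) mC) (defect b0 nu0 g h).
have [s -> s0] := loss_ess_sup mC C0.
move=> /(ae_mrestr (mu2 R) mC) hs.
apply: (@le_trans _ _ (\int[mu2 R]_(x in C) (s%:E * (sqn (eta x))%:E))%E).
  have ae_f := ae_filter_ringOfSetsType (mu2 R).
  apply: ae_ge0_le_integral.
  - exact: measurable_box.
  - by move=> x _; rewrite lee_fin mulr_ge0 ?sqn_ge0//; have /andP[] := loss_bnd b0 nu0 g h x.
  - apply: measurable_funTS; apply/measurable_EFinP; apply: measurable_funM.
      exact: measurable_sqn.
    exact: measurable_loss.
  - by move=> x _; rewrite mule_ge0// lee_fin ?sqn_ge0.
  - by apply: measurable_funTS; apply: measurable_funeM; exact: measurable_sqnE.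
  apply: filterS hs => x hx Cx; rewrite -EFinM lee_fin mulrC ler_wpM2r ?sqn_ge0//.
  by move: (hx Cx); rewrite /defect lee_fin sqn_normc.
rewrite ge0_integralZl//; last 2 first.
- by apply: measurable_funTS; exact: measurable_sqnE.
- by move=> x _; rewrite lee_fin sqn_ge0.
rewrite muleC; apply: lee_wpmul2r; first by rewrite lee_fin.
apply: ge0_subset_integral => //.
- exact: measurable_sqnE.
- by move=> x _; rewrite lee_fin sqn_ge0.
Qed.

End BestApproximation.

(** * Continuity of the short-time Fourier transform *)

Section Continuity.
Context {R : realType}.
Local Notation mu := (mu1 R).
Implicit Types (f g : line R -> R[i]) (x z : plane R).

Lemma sqn_cexp2piB1 (s : R) : sqn (cexp2pi s - 1) = 2 - 2 * cos (2 * pi * s).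
Proof.
rewrite sqnB sqn_cexp2pi rmorph1 mulr1 /= /sqn /= expr1n expr0n /=.
by ring.
Qed.

Lemma cexp2pi_small (c : R) : 0 < c -> exists2 d : R, 0 < d &
  forall s : R, `|s| < d -> sqn (cexp2pi s - 1) <= c.
Proof.
move=> c0; have := @continuous_cos R 0.
move=> /cvgrPdist_lt /(_ (c / 2)); rewrite divr_gt0// => /(_ isT) /nbhs_ballP[d /= d0 hd].
have p2 : 0 < 2 * pi :> R by rewrite mulr_gt0// pi_gt0.
exists (d / (2 * pi)); first by rewrite divr_gt0.
move=> s hs; have := hd (2 * pi * s).
rewrite /ball /= sub0r normrN normrM (gtr0_norm p2) mulrC -ltr_pdivlMr// => /(_ hs).
rewrite cos0 ger0_norm ?subr_ge0 ?cos_le1// => h.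
by rewrite sqn_cexp2piB1; lra.
Qed.

Lemma sqn_cexp2piB1_le (s : R) : sqn (cexp2pi s - 1) <= 4.
Proof. by rewrite sqn_cexp2piB1; have := cos_geN1 (2 * pi * s); lra. Qed.

Lemma truncation_in N f (t : line R) : `|t| <= N%:R -> truncation N f t = f t.
Proof. by move=> h; rewrite /truncation /cutoff mem_set//= in_itv/= -ler_norml. Qed.

Lemma truncation_out N f (t : line R) : ~ (`|t| <= N%:R) -> truncation N f t = 0.
Proof. by move=> h; rewrite /truncation /cutoff memNset//= in_itv/= -ler_norml. Qed.

Lemma cmeasurable_modulation (s : R) f : cmeasurable f -> cmeasurable (modulation s f).
Proof.
move=> mf; apply: cmeasurableM => //.
by apply: measurable_cexp2pi; apply: measurable_funM => //; exact: measurable_cst.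
Qed.

Lemma cmeasurable_translation (b : R) f : cmeasurable f -> cmeasurable (translation b f).
Proof. by move=> mf; apply: (cmeasurable_comp mf); case: (shift_preserving (- b)). Qed.

(** On a bounded interval the phase is uniformly close to 1; the tails are
    small. *)
Lemma modulation_continuous f (e : R) : L2 mu f -> 0 < e -> exists2 d : R, 0 < d &
  forall s : R, `|s| < d -> (nsq mu (fun t => (modulation s f t - f t)%R) <= e%:E)%E.
Proof.
move=> hf e0; have mf := L2_cmeas hf.
have e8 : 0 < e / 8 by rewrite divr_gt0.
have [N /(_ N (leqnn N)) hN] := nsq_truncation_lim hf e8.
have q1 : 0 < sqf mu f + 1 by rewrite ltr_wpDl// sqf_ge0.
have [c [cE c0]] : exists c, c = e / 2 / (sqf mu f + 1) /\ 0 < c.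
  by exists (e / 2 / (sqf mu f + 1)); rewrite !divr_gt0.
have [d d0 hd] := cexp2pi_small c0.
have N1 : 0 < N%:R + 1 :> R by rewrite ltr_wpDl.
exists (d / (N%:R + 1)); first by rewrite divr_gt0.
move=> s; rewrite ltr_pdivlMr// => hs.
have mc : cmeasurable (truncation N f) by case: (L2_truncation N hf).
have P (t : line R) : sqn (modulation s f t - f t) <= 4 * sqn (f t - truncation N f t) + c * sqn (f t).
  rewrite (_ : modulation s f t - f t = (cexp2pi (s * t) - 1) * f t); last by rewrite /modulation; ring.
  rewrite sqnM; case: (pselect (`|t| <= N%:R)) => ht.
    rewrite (truncation_in _ ht) subrr sqn0 mulr0 add0r ler_wpM2r ?sqn_ge0//; apply: hd.
    rewrite normrM; apply: le_lt_trans hs; rewrite ler_wpM2l//.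
    by rewrite (le_trans ht)// lerDl.
  rewrite (truncation_out _ ht) subr0 ler_wpDr ?mulr_ge0 ?sqn_ge0 ?(ltW c0)//.
  by rewrite ler_wpM2r ?sqn_ge0// sqn_cexp2piB1_le.
have m1 := measurable_sqnE (cmeasurableB mf mc); have m2 := measurable_sqnE mf.
apply: (@le_trans _ _ (4%:E * nsq mu (fun t => (f t - truncation N f t)%R) + c%:E * nsq mu f)%E).
  rewrite /nsq -!ge0_integralZl//; last 3 first.
  - by move=> t _; rewrite lee_fin sqn_ge0.
  - by rewrite lee_fin ltW.
  - by move=> t _; rewrite lee_fin sqn_ge0.
  rewrite -ge0_integralD//; last 4 first.
  - by move=> t _; rewrite mule_ge0 ?lee_fin ?sqn_ge0.
  - exact: measurable_funeM.
  - by move=> t _; rewrite mule_ge0 ?lee_fin ?sqn_ge0 ?ltW.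
  - exact: measurable_funeM.
  apply: ge0_le_integral => //.
  - by move=> t _; rewrite lee_fin sqn_ge0.
  - apply: measurable_sqnE; apply: cmeasurableB => //; exact: cmeasurable_modulation.
  - by apply: emeasurable_funD; exact: measurable_funeM.
  by move=> t _; rewrite -!EFinM -EFinD lee_fin.
apply: (@le_trans _ _ (4%:E * (e / 8)%:E + c%:E * nsq mu f)%E).
  by apply: leeD => //; apply: lee_wpmul2l.
rewrite sqfE// -!EFinM -EFinD lee_fin.
have ce : c * sqf mu f <= e / 2.
  by rewrite cE mulrAC ler_pdivrMr// ler_wpM2l ?divr_ge0 ?(ltW e0)// lerDl.
by move: ce; clear; lra.
Qed.

Lemma compact_integrable f (a nu : R) (xi : R) : 0 < nu -> L2 mu f ->
  (forall t, ~ (a <= t < a + nu^-1) -> f t = 0) ->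
  cintegrable mu (fun t : line R => f t * cexp2pi (- (xi * t))).
Proof.
move=> nu0 hf supp; have := L2_mulJ_integrable (L2_tfshift (0, - xi) hf) (L2_cchar a 0 nu0).
congr cintegrable; apply/funext => t.
rewrite /tfshift /modulation /translation /= subr0 mulNr mulrC /cchar /cutoff.
case: ifPn => ht; first by rewrite /echar !mul0r cexp2pi0 rmorph1 mul1r mulrC.
rewrite rmorph0 mul0r supp ?mul0r// => h; move/negP: ht; apply.
by rewrite inE /= in_itv.
Qed.

(** Plancherel turns translations into modulations. *)
Lemma translation_continuous_compact N f (e : R) : L2 mu f -> 0 < e ->
  exists2 d : R, 0 < d &
  forall b : R, `|b| < d ->
    (nsq mu (fun t => (translation b (truncation N f) t - truncation N f t)%R) <= e%:E)%E.
Proof.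
move=> hf e0; have hc := L2_truncation N hf; have mc := L2_cmeas hc.
pose a : R := - N%:R - 2; pose nu : R := (2 * N%:R + 4)^-1.
have nuV : nu^-1 = 2 * N%:R + 4 by rewrite invrK.
have nu0 : 0 < nu by rewrite invr_gt0 ltr_wpDl// mulr_ge0.
have S0 (t : line R) : ~ (a <= t < a + nu^-1) -> truncation N f t = 0.
  move=> h; apply: truncation_out => ht; apply: h; rewrite nuV /a.
  by move: ht; rewrite ler_norml => /andP[h1 h2]; apply/andP; split; lra.
have Sb (b : R) (t : line R) : `|b| < 1 -> ~ (a <= t < a + nu^-1) -> translation b (truncation N f) t = 0.
  move=> hb h; apply: truncation_out => ht; apply: h; rewrite nuV /a.
  move: ht; rewrite ler_norml => /andP[h1 h2].
  by move: hb; rewrite ltr_norml => /andP[h3 h4]; apply/andP; split; lra.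
have hF : L2 mu (fourier (truncation N f)).
  by apply/L2P; split; [exact: cmeasurable_fourier|rewrite (plancherel_compact nu0 hc S0); exact: L2_lty].
have [d d0 hd] := modulation_continuous hF e0.
exists (Num.min d 1); first by rewrite lt_min d0 ltr01.
move=> b; rewrite lt_min => /andP[hb b1].
have hT : L2 mu (translation b (truncation N f)).
  exact: (L2_preserving (shift_preserving (- b)) hc).
rewrite -(plancherel_compact (a := a) nu0 (L2B hT hc)); last first.
  by move=> t ht; rewrite Sb// S0// subrr.
have := hd (- b); rewrite normrN => /(_ hb); congr (_ <= _)%E; congr nsq.
apply/funext => xi; rewrite /modulation /fourier.
have -> : (fun t : line R => (translation b (truncation N f) t - truncation N f t) * cexp2pi (- (xi * t))) =
   (fun t : line R => translation b (truncation N f) t * cexp2pi (- (xi * t)) - truncation N f t * cexp2pi (- (xi * t))).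
  by apply/funext => t; rewrite mulrBl.
rewrite cintegralB; last 2 first.
- by apply: (compact_integrable (a := a) xi nu0 hT) => t ht; exact: Sb.
- exact: (compact_integrable (a := a) xi nu0 hc).
congr (_ - _); rewrite -cintegralZ; last exact: (compact_integrable (a := a) xi nu0 hc).
have me (s : R) : cmeasurable (fun t : line R => cexp2pi (- (s * t))).
  by apply: measurable_cexp2pi; apply: measurable_funN; apply: measurable_funM => //; exact: measurable_cst.
have mi : cmeasurable (fun t : line R => translation b (truncation N f) t * cexp2pi (- (xi * t))).
  by apply: cmeasurableM; [case: hT|exact: me].
rewrite -[RHS](cintegral_preserving (shift_preserving b) mi); congr cintegral.
apply/funext => t; rewrite /translation addrK mulrCA -cexp2piD.
by congr (_ * cexp2pi _); ring.
Qed.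

(** A compactly supported truncation carries the continuity, and the
    remainder is small uniformly in the translation. *)
Lemma translation_continuous f (e : R) : L2 mu f -> 0 < e -> exists2 d : R, 0 < d &
  forall b : R, `|b| < d -> (nsq mu (fun t => (translation b f t - f t)%R) <= e%:E)%E.
Proof.
move=> hf e0; have mf := L2_cmeas hf.
have e16 : 0 < e / 16 by rewrite divr_gt0.
have e4 : 0 < e / 4 by rewrite divr_gt0.
have [N /(_ N (leqnn N)) hN] := nsq_truncation_lim hf e16.
have [d d0 hd] := translation_continuous_compact N hf e4.
exists d => // b /hd {}hd.
have mc : cmeasurable (truncation N f) by case: (L2_truncation N hf).
have mT := cmeasurable_translation b.
have mr := cmeasurableB mf mc.
have -> : (fun t => (translation b f t - f t)%R) = (fun t => ((translation b (truncation N f) t - truncation N f t) +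
   (translation b (fun t => f t - truncation N f t)%R t - (f t - truncation N f t)))%R).
  by apply/funext => t; rewrite /translation; ring.
have E : nsq mu (translation b (fun t => (f t - truncation N f t)%R)) = nsq mu (fun t => (f t - truncation N f t)%R).
  exact: (nsq_preserving (shift_preserving (- b)) mr).
apply: le_trans (nsqD_le2 _ (cmeasurableB (mT _ mc) mc) (cmeasurableB (mT _ mr) mr)) _.
have h2 := nsqD_le2 mu (mT _ mr) (cmeasurableN mr); rewrite nsqN E in h2.
apply: (@le_trans _ _ (2 * (e / 4)%:E + 2 * (2 * (e / 16)%:E + 2 * (e / 16)%:E))%E).
  apply: leeD; first exact: lee_wpmul2l.
  apply: lee_wpmul2l => //; apply: le_trans h2 _.
  by apply: leeD; apply: lee_wpmul2l.
rewrite -!(EFinM, EFinD) lee_fin.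
lra.
Qed.

(** By Cauchy-Schwarz it suffices that the time-frequency shifts act
    continuously on the window. *)
Lemma STFT_continuous g f x0 (e : R) : L2 mu f -> L2 mu g -> 0 < e -> exists2 d : R, 0 < d &
  forall x, `|x.1 - x0.1| < d -> `|x.2 - x0.2| < d ->
    sqn (STFT g f x - STFT g f x0) <= e.
Proof.
move=> hf hg e0; have mg := L2_cmeas hg.
have q1 : 0 < sqf mu f + 1 by rewrite ltr_wpDl// sqf_ge0.
have c0 : 0 < e / (sqf mu f + 1) / 4 by rewrite !divr_gt0.
have hT : L2 mu (translation x0.1 g) by exact: (L2_preserving (shift_preserving (- x0.1)) hg).
have mT := L2_cmeas hT.
have [d1 d10 h1] := translation_continuous hg c0.
have [d2 d20 h2] := modulation_continuous hT c0.
exists (Num.min d1 d2); first by rewrite lt_min d10 d20.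
move=> x; rewrite !lt_min => /andP[/h1 {}h1 _] /andP[_ /h2 {}h2].
have hx := L2_tfshift x hg; have hx0 := L2_tfshift x0 hg.
rewrite /STFT -innerBr//; apply: le_trans (inner_CS hf (L2B hx hx0)) _.
have : (nsq mu (fun t => (tfshift x g t - tfshift x0 g t)%R) <= (e / (sqf mu f + 1))%:E)%E.
  have -> : (fun t => (tfshift x g t - tfshift x0 g t)%R) = (fun t => (
     modulation x.2 (fun t => (translation x.1 g t - translation x0.1 g t)%R) t +
     modulation x0.2 (fun t => modulation (x.2 - x0.2) (translation x0.1 g) t - translation x0.1 g t)%R t)%R).
    apply/funext => t; rewrite /tfshift /modulation.
    rewrite !mulrBr [X in _ = _ - _ + (X - _)]mulrA -cexp2piD (_ : x0.2 * t + (x.2 - x0.2) * t = x.2 * t); last by ring.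
    by ring.
  have m1 : cmeasurable (fun t => translation x.1 g t - translation x0.1 g t).
    by apply: cmeasurableB => //; exact: cmeasurable_translation.
  have m2 : cmeasurable (fun t => modulation (x.2 - x0.2) (translation x0.1 g) t - translation x0.1 g t).
    by apply: cmeasurableB => //; exact: cmeasurable_modulation.
  apply: le_trans (nsqD_le2 _ (cmeasurable_modulation _ m1) (cmeasurable_modulation _ m2)) _.
  have nM (s : R) k : nsq mu (modulation s k) = nsq mu k.
    by apply: nsq_eq => t; rewrite /modulation sqnM sqn_cexp2pi mul1r.
  rewrite !nM.
  have E : nsq mu (fun t => (translation x.1 g t - translation x0.1 g t)%R) =
           nsq mu (fun t => (translation (x.1 - x0.1) g t - g t)%R).
    rewrite -[LHS](nsq_preserving (shift_preserving x0.1) m1).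
    by congr nsq; apply/funext => t; rewrite /translation addrK; congr (g _ - _); ring.
  rewrite E.
  apply: (@le_trans _ _ (2 * (e / (sqf mu f + 1) / 4)%:E + 2 * (e / (sqf mu f + 1) / 4)%:E)%E).
    by apply: leeD; apply: lee_wpmul2l.
  by rewrite -!EFinM -!EFinD lee_fin; move: c0; lra.
rewrite (sqfE (L2B hx hx0)) lee_fin => h.
apply: (@le_trans _ _ (sqf mu f * (e / (sqf mu f + 1)))).
  by rewrite ler_wpM2l// sqf_ge0.
by rewrite mulrA ler_pdivrMr// mulrC ler_wpM2l ?(ltW e0)// lerDl.
Qed.

End Continuity.

(** * Biorthogonality of dual windows on the adjoint lattice *)

Section Moyal.
Context {R : realType}.
Local Notation mu := (mu1 R).
Implicit Types (f g w h : line R -> R[i]) (x z : plane R).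

Section Polarization.
Context {d d' : measure_display} {T : measurableType d} {T' : measurableType d'}.
Variables (m : {measure set T -> \bar R}) (m' : {measure set T' -> \bar R}).

(** The squared norms of F - c G for c = 1 and c = i determine the inner
    product. *)
Lemma polarization (F G : T -> R[i]) (F' G' : T' -> R[i]) :
  L2 m F -> L2 m G -> L2 m' F' -> L2 m' G' -> sqf m F = sqf m' F' -> sqf m G = sqf m' G' ->
  (forall c : R[i], sqf m (fun y => F y - c * G y) = sqf m' (fun y => F' y - c * G' y)) ->
  inner m F G = inner m' F' G'.
Proof.
move=> hF hG hF' hG' eF eG E.
have K c : complex.Re (c^* * inner m F G) = complex.Re (c^* * inner m' F' G').
  have := E c; rewrite (sqfB hF (L2Z c hG)) (sqfB hF' (L2Z c hG')) !sqfZ// eF eG.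
  by rewrite !innerZr//; lra.
have := K 1; have := K 'i%C.
case: (inner m F G) (inner m' F' G') => [a b] [a' b'].
rewrite !cReM /= => h1 h2; apply: complex_ext => /=; lra.
Qed.

End Polarization.

(** Moyal's identity, by polarization of the isometry for rank-one kernels. *)
Lemma moyal f g w h : L2 mu f -> L2 mu g -> L2 mu w -> L2 mu h ->
  inner (mu2 R) (STFT g f) (STFT h w) = inner mu f w * inner mu h g.
Proof.
move=> hf hg hw hh; rewrite -inner_tensor2//.
have E k e : L2 (mu2 R) k -> spreading_function k e -> sqf (mu2 R) e = sqf (mu2 R) k.
  by move=> hk he; rewrite /sqf (spreading_isometry hk he).
have L1 := L2_tensor hf hg; have L3 := L2_tensor hw hh.
apply: polarization; try exact: L2_STFT; try exact: L2_tensor.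
- by apply: E => //; exact: spreading_tensor.
- by apply: E => //; exact: spreading_tensor.
move=> c; have := spreading_lin (- c) L1 L3 (spreading_tensor hf hg) (spreading_tensor hw hh).
have -> : (fun z : plane R => tensor f g z + - c * tensor w h z) = (fun z => tensor f g z - c * tensor w h z).
  by apply/funext => z; rewrite mulNr.
have -> : (fun z : plane R => STFT g f z + - c * STFT h w z) = (fun z => STFT g f z - c * STFT h w z).
  by apply/funext => z; rewrite mulNr.
by move=> /E -> //; apply: L2B => //; exact: L2Z.
Qed.

Lemma inner_tfshift z f g : L2 mu f -> L2 mu g ->
  inner mu (tfshift z f) (tfshift z g) = inner mu f g.
Proof.
move=> hf hg.
have m1 : cmeasurable (fun t : line R => tfshift z f t * (tfshift z g t)^*).
  by apply: cmeasurableM; [case: (L2_tfshift z hf)|apply: cmeasurableJ; case: (L2_tfshift z hg)].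
rewrite /inner -[LHS](cintegral_preserving (shift_preserving z.1) m1).
congr cintegral; apply/funext => t; rewrite /tfshift /modulation /translation addrK.
rewrite conjM mulrACA mulJ_sqn sqn_cexp2pi.
by rewrite -[(1 : R)%:C]/(1 : R[i]) mul1r.
Qed.

Lemma STFT_shift_arg g f (z x : plane R) : L2 mu f -> L2 mu g ->
  STFT g (tfshift (- z.1, - z.2) f) x =
  cexp2pi ((z.2 + x.2) * z.1) * STFT g f (z.1 + x.1, z.2 + x.2).
Proof.
move=> hf hg; have hi := L2_mulJ_integrable hf (L2_tfshift (z.1 + x.1, z.2 + x.2) hg).
rewrite /STFT {2}/inner -cintegralZ// /inner.
have mF : cmeasurable (fun t => tfshift (- z.1, - z.2) f t * (tfshift x g t)^*).
  apply: cmeasurableM; first by case: (L2_tfshift (- z.1, - z.2) hf).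
  by apply: cmeasurableJ; case: (L2_tfshift x hg).
rewrite -[LHS](cintegral_preserving (shift_preserving (- z.1)) mF).
congr cintegral; apply/funext => t; rewrite /tfshift /modulation /translation /= addrK.
rewrite (_ : t - z.1 - x.1 = t - (z.1 + x.1)); last by ring.
rewrite !conjM -!cexp2piN.
have E : cexp2pi (- z.2 * (t - z.1)) * cexp2pi (- (x.2 * (t - z.1))) =
   cexp2pi ((z.2 + x.2) * z.1) * cexp2pi (- ((z.2 + x.2) * t)).
  by rewrite -!cexp2piD; congr cexp2pi; ring.
transitivity ((cexp2pi (- z.2 * (t - z.1)) * cexp2pi (- (x.2 * (t - z.1)))) *
   (f t * (g (t - (z.1 + x.1)))^*)); first by ring.
by rewrite E; ring.
Qed.

End Moyal.

Section Unfolding.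
Context {R : realType}.
Variables (b0 nu0 : R).
Hypotheses (b0_gt0 : 0 < b0) (nu0_gt0 : 0 < nu0).
Local Notation pshift := (pshift b0 nu0).
Implicit Types (x : plane R) (k : int * int).

Lemma esum_fset_lim (I : choiceType) (a : I -> R) : (forall i, 0 <= a i) ->
  (\esum_(i in [set: I]) (a i)%:E < +oo)%E ->
  forall e, 0 < e -> exists A : {fset I}, forall B, (A `<=` B)%fset ->
    `|fine (\esum_(i in [set: I]) (a i)%:E) - \sum_(i <- B) a i| < e.
Proof.
move=> a0 fin e e0; set S := (\esum_(i in _) _)%E in fin *.
have S0 : (0 <= S)%E by apply: esum_ge0 => i _; rewrite lee_fin.
have Sfin : S \is a fin_num by rewrite ge0_fin_numE.
have [_ [X [finX _] <-]] := @ub_ereal_sup_adherent _ _ _ e0 Sfin.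
rewrite fsbig_finite//= sumEFin -/S => hX.
exists (fset_set X) => B XB.
have := fset_sum_le_esum B a0; have := fset_sum_le a0 XB.
rewrite -/S -(fineK Sfin) lee_fin /= => h1 h2.
move: hX; rewrite -/(esum _ _) -/S -[S in X in (X < _)%E](fineK Sfin) -EFinB lte_fin => h3.
by rewrite ger0_norm ?subr_ge0//; lra.
Qed.

(** Positive and negative parts are unfolded separately by Tonelli's theorem,
    which makes both sums finite almost everywhere; there the unconditional
    sum S is their difference. *)
Lemma Rintegral_unfold a b (F S : plane R -> R) :
  (mu2 R).-integrable setT (EFin \o F) -> measurable_fun setT S ->
  (forall x e, 0 < e -> exists A : {fset int * int}, forall B, (A `<=` B)%fset ->
     `|S x - \sum_(k <- B) F (pshift k x)| < e) ->
  \int[mu2 R]_(x in box b0 nu0 a b) S x = \int[mu2 R]_x F x.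
Proof.
move=> iF mS lim.
have mF : measurable_fun setT F by have /measurable_int/measurable_EFinP := iF.
pose P x := Num.max (F x) 0; pose N x := Num.max (- F x) 0.
have P0 x : 0 <= P x by rewrite le_max lexx orbT.
have N0 x : 0 <= N x by rewrite le_max lexx orbT.
have FE x : F x = P x - N x.
  by rewrite /P /N; case: (lerP 0 (F x)) => h; rewrite /Num.max;
     case: ltP; case: ltP; lra.
have mP : measurable_fun setT P by apply: measurable_maxr => //; exact: measurable_cst.
have mN : measurable_fun setT N.
  by apply: measurable_maxr; [exact: measurableT_comp|exact: measurable_cst].
have dom (G : plane R -> R) : measurable_fun setT G -> (forall x, 0 <= G x <= `|F x|) ->
    (mu2 R).-integrable setT (EFin \o G).
  move=> mG hG; apply: (le_integrable _ _ _ iF) => //; first exact/measurable_EFinP.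
  by move=> x _ /=; rewrite lee_fin ger0_norm; have /andP[] := hG x.
have iP : (mu2 R).-integrable setT (EFin \o P).
  by apply: dom => // x; rewrite P0 /P ge_max ler_norm normr_ge0.
have iN : (mu2 R).-integrable setT (EFin \o N).
  by apply: dom => // x; rewrite N0 /N ge_max -normrN ler_norm normr_ge0.
pose E (G : plane R -> R) x := (\esum_(k in [set: int * int]) (G (pshift k x))%:E)%E.
have E0 (G : plane R -> R) x : (forall x, 0 <= G x) -> (0 <= E G x)%E.
  by move=> G0; apply: esum_ge0 => k _; rewrite lee_fin.
have mE (G : plane R -> R) : measurable_fun setT G -> (forall x, 0 <= G x) -> measurable_fun setT (E G).
  move=> mG G0; apply: measurable_esum => [k|k x]; last by rewrite lee_fin.
  apply/measurable_EFinP; apply: measurableT_comp => //.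
  by case: (pshift_preserving b0 nu0 k).
have iE (G : plane R -> R) : measurable_fun setT G -> (forall x, 0 <= G x) ->
    (mu2 R).-integrable setT (EFin \o G) ->
    [/\ (\int[mu2 R]_(x in box b0 nu0 a b) E G x = \int[mu2 R]_x (G x)%:E)%E,
        (mu2 R).-integrable (box b0 nu0 a b) (E G) &
        {ae mu2 R, forall x, box b0 nu0 a b x -> (E G x < +oo)%E}].
  move=> mG G0 iG.
  have I1 : (\int[mu2 R]_(x in box b0 nu0 a b) E G x = \int[mu2 R]_x (G x)%:E)%E.
    by rewrite [RHS](integral_unfold b0_gt0 nu0_gt0 a b)//; exact/measurable_EFinP.
  have fG : (\int[mu2 R]_x (G x)%:E < +oo)%E.
    have /integrableP[_] := iG; congr (_ < _)%E; apply: eq_integral => x _ /=.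
    by rewrite ger0_norm.
  have iEG : (mu2 R).-integrable (box b0 nu0 a b) (E G).
    apply/integrableP; split; first by apply: measurable_funTS; exact: mE.
    under eq_integral do rewrite gee0_abs ?E0//.
    by rewrite I1.
  split => //; have := integrable_ae (measurable_box b0 nu0 a b) iEG.
  have ae_f := ae_filter_ringOfSetsType (mu2 R).
  by apply: filterS => x h /h; rewrite ge0_fin_numE// E0.
have [I1 J1 K1] := iE P mP P0 iP; have [I2 J2 K2] := iE N mN N0 iN.
have -> : \int[mu2 R]_x F x = fine (\int[mu2 R]_x (P x)%:E - \int[mu2 R]_x (N x)%:E)%E.
  rewrite /Rintegral -integralB//; congr fine; apply: eq_integral => x _.
  by rewrite FE EFinB.
rewrite -I1 -I2 -integralB//; last exact: measurable_box.
rewrite /Rintegral; congr fine.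
have S_lim x : (E P x < +oo)%E -> (E N x < +oo)%E -> (S x)%:E = (E P x - E N x)%E.
  move=> fP fN; have fP' : E P x \is a fin_num by rewrite ge0_fin_numE// E0.
  have fN' : E N x \is a fin_num by rewrite ge0_fin_numE// E0.
  rewrite -(fineK fP') -(fineK fN') -EFinB; congr EFin.
  apply/eqP; rewrite -subr_eq0 -normr_le0; apply/ler_addgt0Pr => e e0; rewrite add0r.
  have e3 : 0 < e / 3 by rewrite divr_gt0.
  have [A hA] := lim x _ e3.
  have [B hB] := esum_fset_lim (fun k => P0 (pshift k x)) fP e3.
  have [D hD] := esum_fset_lim (fun k => N0 (pshift k x)) fN e3.
  pose X := (A `|` B `|` D)%fset.
  have {}hA := hA X (fsubset_trans (fsubsetUl _ _) (fsubsetUl _ _)).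
  have {}hB := hB X (fsubset_trans (fsubsetUr A B) (fsubsetUl _ _)).
  have {}hD := hD X (fsubsetUr _ _).
  have XE : \sum_(k <- X) F (pshift k x) = \sum_(k <- X) P (pshift k x) - \sum_(k <- X) N (pshift k x).
    by rewrite -sumrB; apply: eq_bigr => k _; rewrite FE.
  rewrite XE in hA; move: hA hB hD; rewrite -!/(E _ _).
  rewrite !ltr_norml ler_norml => /andP[? ?] /andP[? ?] /andP[? ?].
  by apply/andP; split; lra.
apply: ae_eq_integral.
- exact: measurable_box.
- by apply: measurable_funTS; exact/measurable_EFinP.
- by apply: measurable_funTS; apply: emeasurable_funB; exact: mE.
have ae_f := ae_filter_ringOfSetsType (mu2 R).
by apply: filterS2 K1 K2 => x k1 k2 xb; apply: S_lim; [exact: k1|exact: k2].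
Qed.

Lemma cintegral_unfold a b (F S : plane R -> R[i]) :
  cintegrable (mu2 R) F -> cmeasurable S ->
  (forall x e, 0 < e -> exists A : {fset int * int}, forall B, (A `<=` B)%fset ->
     sqn (S x - \sum_(k <- B) F (pshift k x)) <= e) ->
  cintegral (mu2 R) (box b0 nu0 a b) S = cintegral (mu2 R) setT F.
Proof.
move=> [iR iI] [mR mI] lim.
have half e : 0 < e -> (e / 2) ^+ 2 < e ^+ 2 :> R.
  by move=> e0; rewrite ltr_pXn2r// ?nnegrE ?divr_ge0 ?(ltW e0)//; lra.
apply: complex_ext => /=; apply: Rintegral_unfold => // x e e0.
  have [A hA] := lim x ((e / 2) ^+ 2) (exprn_gt0 2 (divr_gt0 e0 (ltr0n _ 2))).
  exists A => B /hA hB; rewrite -(@ltr_pXn2r _ 2) ?nnegrE ?(ltW e0)//.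
  apply: le_lt_trans (half e e0); apply: le_trans hB.
  have := Re_sqn (S x - \sum_(k <- B) F (pshift k x)); congr (`|_| ^+ 2 <= _).
  by rewrite cReD cReN; congr (_ - _); rewrite (raddf_sum (@complex.Re R)).
have [A hA] := lim x ((e / 2) ^+ 2) (exprn_gt0 2 (divr_gt0 e0 (ltr0n _ 2))).
exists A => B /hA hB; rewrite -(@ltr_pXn2r _ 2) ?nnegrE ?(ltW e0)//.
apply: le_lt_trans (half e e0); apply: le_trans hB.
have := Im_sqn (S x - \sum_(k <- B) F (pshift k x)); congr (`|_| ^+ 2 <= _).
by rewrite cImD cImN; congr (_ - _); rewrite (raddf_sum (@complex.Im R)).
Qed.

End Unfolding.

Section WexlerRaz.
Context {R : realType}.
Variables (b0 nu0 : R).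
Hypotheses (b0_gt0 : 0 < b0) (nu0_gt0 : 0 < nu0).
Variables (g h : line R -> R[i]).
Local Notation mu := (mu1 R).
Hypotheses (hg : L2 mu g) (hdual : dual_window b0 nu0 g h).
Let hh : L2 mu h. Proof. by case: hdual. Qed.
Local Notation lat := (lattice b0 nu0).
Local Notation p := (nu0^-1).
Local Notation q := (b0^-1).

Let p0 : 0 < p. Proof. by rewrite invr_gt0. Qed.
Let q0 : 0 < q. Proof. by rewrite invr_gt0. Qed.

Let shiftE k (z : plane R) : pshift p q k z = (z.1 + (lat k).1, z.2 + (lat k).2).
Proof. by rewrite /pshift /lattice !invrK. Qed.

(** The reconstruction formula for the time-frequency shifts of f and w says
    that a periodization over the lattice is constant. *)
Lemma dual_window_sum f w (z : plane R) (e : R) : L2 mu f -> L2 mu w -> 0 < e ->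
  exists A : {fset int * int}, forall B, (A `<=` B)%fset ->
   sqn (inner mu f w - \sum_(k <- B) STFT g f (pshift p q k z) * (STFT h w (pshift p q k z))^*) <= e.
Proof.
move=> hf hw e0; pose f' := tfshift (- z.1, - z.2) f; pose w' := tfshift (- z.1, - z.2) w.
have hf' : L2 mu f' by exact: L2_tfshift.
have hw' : L2 mu w' by exact: L2_tfshift.
have [A hA] := inner_L2_sum_lim (fun k => L2_tfshift (lat k) hh) hf' hw' (hdual.2 f' hf') e0.
exists A => B /hA; rewrite inner_tfshift//; congr (sqn (_ - _) <= _).
apply: eq_bigr => k _; rewrite shiftE.
rewrite -(innerJ hw' (L2_tfshift (lat k) hh)).
rewrite -[inner mu f' _]/(STFT g f' (lat k)) -[inner mu w' _]/(STFT h w' (lat k)).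
rewrite !STFT_shift_arg// conjM mulrACA mulJ_sqn sqn_cexp2pi.
by rewrite -[(1 : R)%:C]/(1 : R[i]) mul1r.
Qed.

(** Integrate the periodization against a nontrivial character of the torus
    and use Moyal's identity. *)
Lemma wexler_raz k : k != 0 -> STFT g h (lattice p q k) = 0.
Proof.
move=> k0; pose z := lattice p q k; pose mu' := lattice p q (- k).
have muE : mu' = (- z.1, - z.2) by rewrite /mu' /z /lattice /= !intrN !mulNr.
(* Any nonzero w would do. With f and h' the shifts of w and h by - z,
   covariance turns the periodization attached to w into V_g f conj(V_h' f)
   times a character, and Moyal evaluates its integral as |f|^2 <h', g>. *)
pose w := cchar (0 : R) 1 0; have hw : L2 mu w by exact: (L2_cchar 0 0 ltr01).
pose f := tfshift mu' w; have hf : L2 mu f by exact: L2_tfshift.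
pose h' := tfshift mu' h; have hh' : L2 mu h' by exact: L2_tfshift.
pose chi := character p q (- k).
have mchi : cmeasurable chi by exact: cmeasurable_character.
pose F y := STFT g f y * (STFT h' f y)^*.
have FE y : F y = STFT g f y * (STFT h w y)^* * (chi y)^*.
  by rewrite /F /f /h' STFT_covariance// symp_lattice conjM mulrA mulrAC.
have iF : cintegrable (mu2 R) F by apply: L2_mulJ_integrable; exact: L2_STFT.
pose S y := inner mu f w * (chi y)^*.
have mS : cmeasurable S by apply: cmeasurableM; [exact: cmeasurable_cst|exact: cmeasurableJ].
have lim (y : plane R) (e : R) : 0 < e -> exists A : {fset int * int}, forall B, (A `<=` B)%fset ->
     sqn (S y - \sum_(k <- B) F (pshift p q k y)) <= e.
  move=> e0; have [A hA] := dual_window_sum y hf hw e0.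
  exists A => B /hA; congr (_ <= _); rewrite /S.
  rewrite (_ : \sum_(k <- B) F (pshift p q k y) =
     (\sum_(k <- B) STFT g f (pshift p q k y) * (STFT h w (pshift p q k y))^*) * (chi y)^*).
    by rewrite -mulrBl sqnM sqn_conj sqn_character mulr1.
  by rewrite mulr_suml; apply: eq_bigr => i _; rewrite FE /chi (character_periodic p0 q0).
have := cintegral_unfold p0 q0 0 0 iF mS lim.
rewrite -[RHS]/(inner (mu2 R) (STFT g f) (STFT h' f)) moyal//.
have m := measurable_box p q 0 0.
have -> : cintegral (mu2 R) (box p q 0 0) S = 0.
  rewrite -(cintegral_mrestr (mu2 R) m mS).
  have LS := L2_character p0 q0 0 0 (- k); have L0 := L2_character p0 q0 0 0 0.
  have /= E := character_orth p0 q0 0 0 0 (- k).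
  rewrite eq_sym oppr_eq0 (negbTE k0) in E.
  rewrite (_ : S = fun y => inner mu f w * (character p q 0 y * (chi y)^*)).
    rewrite cintegralZ; last exact: (L2_mulJ_integrable L0 LS).
    by rewrite -[cintegral _ _ _]/(inner _ _ _) (Prop_irrelevance m (measurable_box p q 0 0)) E mulr0.
  apply/funext => y; rewrite /S; congr (_ * _).
  by rewrite /character /= !mul0r subr0 cexp2pi0 mul1r.
move=> /esym/eqP; rewrite mulf_eq0 => /orP[/eqP f0|/eqP gh0].
  have : sqf mu f = 0 by have := inner_ff hf; rewrite f0 => -[].
  rewrite /f /sqf (nsq_tfshift _ (L2_cmeas hw)) -/(sqf mu w) => w0.
  have : nsq mu w = 1%E.
    rewrite /w /cchar nsq_cutoff.
    under eq_integral do rewrite sqn_cexp2pi.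
    rewrite integral_cst//= lebesgue_measure_itv/=.
    by rewrite invr1 add0r lte_fin ltr01 sube0 mul1e.
  by rewrite sqfE// w0 => -[] /eqP; rewrite eq_sym oner_eq0.
have T0 : tfshift (0, 0) g = g.
  by apply/funext => t; rewrite /tfshift /modulation /translation /= mul0r cexp2pi0 mul1r subr0.
have := STFT_shift_arg z (0, 0) hh hg.
rewrite -muE /= !addr0 -[lattice p q k]/z [z]surjective_pairing /= => E.
have E0 : STFT g (tfshift mu' h) (0, 0) = 0.
  by rewrite /STFT T0 gh0.
move: E; rewrite E0 => /esym/eqP; rewrite mulf_eq0 => /orP[/eqP c0|/eqP //].
by have := sqn_cexp2pi (z.2 * z.1); rewrite c0 sqn0 => /eqP; rewrite eq_sym oner_eq0.
Qed.

End WexlerRaz.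

(** ** The error bound over the period at the origin *)

Section PeriodBound.
Context {R : realType}.
Variables (b0 nu0 : R).
Hypotheses (b0_gt0 : 0 < b0) (nu0_gt0 : 0 < nu0).
Variables (g h : line R -> R[i]).
Local Notation mu := (mu1 R).
Hypotheses (hg : L2 mu g) (hdual : dual_window b0 nu0 g h).
Let hh : L2 mu h. Proof. by case: hdual. Qed.
Local Notation V := (STFT g h).
Local Notation U := (Ufun b0 nu0 g h).
Variables (A B : R).
Hypotheses (A_gt0 : 0 < A) (leAB : A <= B).
Hypothesis Ubnd : {ae mu2 R, forall x, (A%:E <= U x <= B%:E)%E}.

Lemma measure_rect (a b c d : R) : a < b -> c < d ->
  mu2 R (`[a, b[ `*` `[c, d[) = ((b - a) * (d - c))%:E.
Proof.
move=> ab cd; rewrite product_measure1E; [|exact: measurable_itv|exact: measurable_itv].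
by rewrite /= !lebesgue_measure_itv /= !lte_fin ab cd -!EFinB -EFinM.
Qed.

(** The transform vanishes at the corner (1/nu0, 0) of the period, so near
    that corner the relative loss comes arbitrarily close to 1. *)
Lemma ess_sup_defect_ge1 :
  (1 <= ess_sup (mrestr (mu2 R) (measurable_period_box b0 nu0)) (defect b0 nu0 g h))%E.
Proof.
have p0 : 0 < nu0^-1 by rewrite invr_gt0.
have q0 : 0 < b0^-1 by rewrite invr_gt0.
have Q0 : (0 < mu2 R (period_box b0 nu0))%E.
  by rewrite /period_box measure_rect// !subr0 lte_fin mulr_gt0.
have := ess_sup_ge (mrestr (mu2 R) (measurable_period_box b0 nu0)) (defect b0 nu0 g h).
have [s -> s0] := loss_ess_sup b0 nu0 g h (measurable_period_box b0 nu0) Q0.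
move=> /(ae_mrestr (mu2 R) (measurable_period_box b0 nu0)) hs.
rewrite lee_fin leNgt; apply/negP => s1.
pose x0 : plane R := (nu0^-1, 0).
have V0 : V x0 = 0.
  have -> : x0 = lattice nu0^-1 b0^-1 (1, 0) by rewrite /lattice /= mul1r mul0r.
  exact: wexler_raz.
(* If |V|^2 <= e < (1 - s) A then the loss exceeds s: U >= A. *)
pose e := (1 - s) * A / 2; have e0 : 0 < e by rewrite divr_gt0// mulr_gt0// subr_gt0.
have [d d0 hd] := STFT_continuous x0 hh hg e0.
pose r := Num.min d (Num.min nu0^-1 b0^-1) / 2.
have r0 : 0 < r by rewrite divr_gt0// !lt_min d0 p0 q0.
have rm : r < Num.min d (Num.min nu0^-1 b0^-1) by rewrite /r; move: r0; rewrite /r; lra.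
move: rm; rewrite !lt_min => /and3P[rd rp rq].
pose D : set (plane R) := `[nu0^-1 - r, nu0^-1[ `*` `[0, r[.
have mD : measurable D by apply: measurableX; exact: measurable_itv.
have ae_f := ae_filter_ringOfSetsType (mu2 R).
have : {ae mu2 R, forall x, ~ D x}.
  apply: filterS2 (u_bnd Ubnd) hs => x [uE /andP[uA _]] hx [].
  rewrite /= !in_itv/= => /andP[x1 x2] /andP[x3 x4].
  have Qx : period_box b0 nu0 x by split; rewrite /= in_itv/=; apply/andP; split; lra.
  have := hx Qx; rewrite /defect sqn_normc lee_fin.
  have u0 : 0 < fine (U x) by exact: lt_le_trans uA.
  rewrite lerBlDr -lerBlDl ler_pdivlMr// => h1.
  have := hd x; rewrite V0 /x0 /= !subr0 => h2.
  have : sqn (V x) <= e.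
    apply: h2; rewrite ltr_norml; apply/andP; split; lra.
  have : (1 - s) * A <= (1 - s) * fine (U x) by rewrite ler_wpM2l// subr_ge0 ltW.
  by rewrite /e in e0 *; lra.
case=> N [mN N0 DN]; have : (mu2 R D <= mu2 R N)%E.
  by apply: le_measure; rewrite ?inE// => x Dx; apply: DN => /(_ Dx).
by rewrite N0 /D measure_rect ?gtrBl// lee_fin subr0 leNgt mulr_gt0// subKr.
Qed.

End PeriodBound.

Section PartB.
Context {R : realType}.

Lemma best_approximation (t0 xi0 : R) (H : @operator R) (kappa eta : plane R -> R[i])
  (b0 nu0 : R) (g h : line R -> R[i]) (A B : R) :
  0 <= t0 -> 0 <= xi0 -> HS_kernel H kappa -> spreading_function kappa eta ->
  {ae mu2 R, forall x, ~ (`[- t0, t0] `*` `[- xi0, xi0]) x -> eta x = 0} ->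
  0 < b0 -> 0 < nu0 -> 1 / b0 > 2 * xi0 -> 1 / nu0 > 2 * t0 ->
  L2 (mu1 R) g -> dual_window b0 nu0 g h -> 0 < A -> A <= B ->
  {ae mu2 R, forall x, period_box b0 nu0 x -> (A%:E <= Ufun b0 nu0 g h x <= B%:E)%E} ->
  (exists! m : int * int -> R[i], best_gabor_multiplier b0 nu0 g h H m) /\
  forall m, best_gabor_multiplier b0 nu0 g h H m ->
    (exists M, symplectic_FT b0 nu0 m M) /\
    forall M, symplectic_FT b0 nu0 m M ->
      [/\ {ae mu2 R, forall x, centered_box b0 nu0 x ->
             M x = eta x * (STFT g h x)^* / (fine (Ufun b0 nu0 g h x))%:C},
          (L2norm (mu2 R) (fun x => (eta x - M x * STFT g h x)%R) ^+ 2 <=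
           L2norm (mu2 R) eta ^+ 2 *
           ess_sup (mrestr (mu2 R) (measurable_period_box b0 nu0))
             (defect b0 nu0 g h))%E
        & (L2norm (mu2 R) (fun x => (eta x - M x * STFT g h x)%R) ^+ 2 <=
           L2norm (mu2 R) eta ^+ 2 *
           ess_sup (mrestr (mu2 R) (measurable_centered_box b0 nu0))
             (defect b0 nu0 g h))%E].
Proof.
move=> t0_ge0 xi0_ge0 Hk He supp b0_gt0 nu0_gt0 hxi ht hg hd A0 AB Uper.
have hh : L2 (mu1 R) h by case: hd.
have ae_f := ae_filter_ringOfSetsType (mu2 R).
have Ubnd : {ae mu2 R, forall x, (A%:E <= Ufun b0 nu0 g h x <= B%:E)%E}.
  apply: (ae_periodic b0_gt0 nu0_gt0 (a := 0) (b := 0)).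
    by move=> x k; rewrite Ufun_periodic.
  by rewrite box_period.
pose a : R := - (nu0^-1 / 2); pose b : R := - (b0^-1 / 2).
have supp' : {ae mu2 R, forall x, ~ box b0 nu0 a b x -> eta x = 0}.
  apply: filterS supp => x hx nx; apply: hx => -[]; rewrite /= !in_itv/=.
  move=> /andP[x1 x2] /andP[x3 x4]; apply: nx; rewrite !div1r in ht hxi.
  by split; rewrite /= in_itv/= /a /b; apply/andP; split; lra.
have C0 : (0 < mu2 R (box b0 nu0 a b))%E.
  have p0 : 0 < nu0^-1 by rewrite invr_gt0.
  have q0 : 0 < b0^-1 by rewrite invr_gt0.
  have E (c r : R) : c + r - c = r by ring.
  rewrite /box measure_rect; [|by rewrite ltrDl|by rewrite ltrDl].
  by rewrite !E lte_fin mulr_gt0.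
split.
  exists (best_symbol b0 nu0 g h eta a b); split.
    exact: (best_symbol_best b0_gt0 nu0_gt0 hg hh A0 AB Ubnd Hk He supp').
  by move=> m /(best_unique b0_gt0 nu0_gt0 hg hh A0 AB Ubnd Hk He supp') ->.
move=> m hm; split.
  exact: (symplectic_FT_exists b0_gt0 nu0_gt0 a b ((l2E m).1 (proj1 hm))).
move=> M /(symplectic_FT_box b0_gt0 nu0_gt0 a b)[mM pM hM].
have EM := best_transform b0_gt0 nu0_gt0 hg hh A0 AB Ubnd Hk He supp' hm mM pM hM.
split.
- by rewrite -box_centered.
- rewrite !L2norm_sqr.
  have := error_le_nsq b0_gt0 nu0_gt0 hg hh A0 Ubnd He supp' mM pM EM.
  move=> /le_trans; apply; rewrite -[leLHS]mule1.
  apply: lee_wpmul2l; first exact: nsq_ge0.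
  exact: (ess_sup_defect_ge1 b0_gt0 nu0_gt0 hg hd A0 Ubnd).
- rewrite !L2norm_sqr; move: (measurable_centered_box b0 nu0); rewrite -box_centered => mC.
  exact: (error_le_ess_sup b0_gt0 nu0_gt0 hg hh A0 Ubnd He supp' mC C0 mM pM EM).
Qed.

End PartB.

(** * Tight Gabor frames from short windows *)

(** Duality: pair the sum F with itself, use 2 Re (c conj(y)) <= r |c|^2 +
    |y|^2 / r on each term with y the coefficient of F, and choose r = C, or
    r small when C = 0. *)
Lemma bessel_synthesis (R : realType) (d : measure_display) (T : measurableType d)
  (m : {measure set T -> \bar R}) (I : choiceType) (u : I -> T -> R[i]) (C : R) :
  (forall i, L2 m (u i)) -> 0 <= C ->
  (forall (f : T -> R[i]) (A : {fset I}), L2 m f -> \sum_(i <- A) sqn (inner m f (u i)) <= C * sqf m f) ->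
  forall (c : I -> R[i]) (A : {fset I}),
  sqf m (fun x => \sum_(i <- A) c i * u i x) <= C * \sum_(i <- A) sqn (c i).
Proof.
move=> hu C0 B c A; set F := (fun x => _).
have hF : L2 m F by apply: L2_bigsum => i; exact: L2Z.
have F0 := sqf_ge0 m F; set s := \sum_(i <- A) _.
have s0 : 0 <= s by apply: sumr_ge0 => i _; exact: sqn_ge0.
have K (r : R) : 0 < r -> 2 * sqf m F <= r * s + r^-1 * (C * sqf m F).
  move=> r0.
  have E : sqf m F = \sum_(i <- A) complex.Re (c i * (inner m F (u i))^*).
    have := inner_ff hF; rewrite {1}/F inner_suml//; last by move=> i; exact: L2Z.
    move=> /(congr1 (@complex.Re R)) /= <-; rewrite (raddf_sum (@complex.Re R)).
    by apply: eq_bigr => i _; rewrite innerZl// innerJ.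
  have P (x y : R[i]) : 2 * complex.Re (x * y^*) <= r * sqn x + r^-1 * sqn y.
    have := sqn_ge0 (r%:C * x - y); rewrite sqnB sqnM sqnR -mulrA.
    rewrite (_ : complex.Re (r%:C * (x * y^*)) = r * complex.Re (x * y^*)); last first.
      by rewrite cReM /= mul0r subr0.
    move=> h; rewrite -(ler_pM2l r0) mulrDr mulVKf ?gt_eqF//.
    by move: h; rewrite expr2; lra.
  apply: (@le_trans _ _ (\sum_(i <- A) (r * sqn (c i) + r^-1 * sqn (inner m F (u i))))).
    by rewrite E mulr_sumr; apply: ler_sum => i _; exact: P.
  rewrite big_split/= -!mulr_sumr lerD2l ler_wpM2l ?invr_ge0 ?(ltW r0)//.
  exact: B.
have [C1|C1] := eqVneq C 0.
  rewrite C1 mul0r; apply/ler_addgt0Pr => e e0; rewrite add0r.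
  have := K (e / (s + 1)); rewrite divr_gt0 ?ltr_wpDl// => /(_ isT).
  rewrite C1 mul0r mulr0 addr0.
  have : e / (s + 1) * s <= e.
    by rewrite mulrAC ler_pdivrMr ?ltr_wpDl// ler_wpM2l ?(ltW e0)// lerDl.
  by lra.
have Cp : 0 < C by rewrite lt_neqAle eq_sym C1.
by have := K C Cp; rewrite mulKf//; lra.
Qed.

Section TightFrame.
Context {R : realType}.
Variables (b0 nu0 : R).
Hypotheses (b0_gt0 : 0 < b0) (nu0_gt0 : 0 < nu0).
Local Notation mu := (mu1 R).
Local Notation lat := (lattice b0 nu0).
Variable w : line R -> R.
Hypothesis mw : measurable_fun setT w.
Hypothesis w_supp : forall t, ~ (0 <= t < nu0^-1) -> w t = 0.
Hypothesis w_sum : forall t : R,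
  (\esum_(m in [set: int]) ((w (t - m%:~R * b0)) ^+ 2)%:E = 1)%E.
Implicit Types (f : line R -> R[i]) (k : int * int) (m n : int).

Definition window : line R -> R[i] := fun t => (w t)%:C.

Lemma w_bnd t : w t ^+ 2 <= 1.
Proof.
rewrite -lee_fin -(w_sum t).
have := @fset_sum_le_esum _ _ (fun m : int => w (t - m%:~R * b0) ^+ 2) [fset 0]%fset.
by rewrite big_seq_fset1 mul0r subr0; apply => m; exact: sqr_ge0.
Qed.

Lemma cmeasurable_window : cmeasurable window.
Proof. exact: cmeasurable_real. Qed.

Lemma L2_window : L2 mu window.
Proof.
apply: (L2_le cmeasurable_window (L2_cchar 0 0 nu0_gt0)) => t.
rewrite sqnR /cchar /cutoff; case: ifPn => ht; first by rewrite sqn_cexp2pi w_bnd.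
rewrite w_supp ?expr0n ?sqn0// => h; move/negP: ht; apply.
by rewrite inE /= in_itv/= add0r.
Qed.

Let slice f m : line R -> R[i] := fun t => f t * (w (t - m%:~R * b0))%:C.

Let mshift m : measurable_fun setT (fun t : line R => w (t - m%:~R * b0)).
Proof. by apply: (measurableT_comp mw); case: (shift_preserving (- (m%:~R * b0))). Qed.

Let L2_slice f m : L2 mu f -> L2 mu (slice f m).
Proof.
move=> hf; apply: (L2_le _ hf).
  by apply: cmeasurableM; [case: hf|apply: cmeasurable_real; exact: mshift].
by move=> t; rewrite sqnM sqnR ler_piMr ?sqn_ge0// w_bnd.
Qed.

Let tile m := measurable_period_itv (m%:~R * b0) nu0.

Let slice_supp f m (t : line R) : ~ (m%:~R * b0 <= t < m%:~R * b0 + nu0^-1) -> slice f m t = 0.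
Proof.
move=> h; rewrite /slice w_supp ?mulr0// => /andP[h1 h2]; apply: h.
by apply/andP; split; lra.
Qed.

Let inner_slice f m n : L2 mu f ->
  inner mu f (tfshift (lat (m, n)) window) = inner (mrestr mu (tile m)) (slice f m) (echar nu0 n).
Proof.
move=> hf; have me : cmeasurable (fun t => slice f m t * (echar nu0 n t)^*).
  apply: cmeasurableM; first by case: (L2_slice m hf).
  by apply: cmeasurableJ; exact: measurable_echar.
rewrite /inner cintegral_mrestr// [RHS]cintegral_cutoff; congr cintegral.
apply/funext => t; rewrite /cutoff; case: ifPn => ht.
  rewrite /tfshift /modulation /translation /window /slice /= conjM.
  by rewrite (_ : (w (t - m%:~R * b0))%:C^* = (w (t - m%:~R * b0))%:C) ?mulrA 1?mulrAC//; apply: complex_ext => /=; rewrite ?oppr0.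
have S0 := @slice_supp (fun=> 1) m t; rewrite /slice mul1r in S0.
rewrite /tfshift /modulation /translation /window /= S0 ?mulr0 ?rmorph0 ?mulr0//.
by move=> h; move/negP: ht; apply; rewrite inE /= in_itv.
Qed.

Let nsq_slice f m : L2 mu f -> nsq (mrestr mu (tile m)) (slice f m) =
  (\int[mu]_t (sqn (f t) * w (t - m%:~R * b0) ^+ 2)%:E)%E.
Proof.
move=> hf; rewrite nsq_mrestr; last by case: (L2_slice m hf).
rewrite integral_mkcond; apply: eq_integral => t _; rewrite patchE.
case: ifPn => ht; first by rewrite sqnM sqnR.
have S0 := @slice_supp (fun=> 1) m t; rewrite /slice mul1r in S0.
suff /complexI -> : (w (t - m%:~R * b0))%:C = 0%:C :> R[i] by rewrite expr0n mulr0.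
by apply: S0 => h; move/negP: ht; apply; rewrite inE /= in_itv.
Qed.

(** Each translate of the window fits in one period of the Fourier series of
    frequencies n nu0, so that Parseval sums the coefficients over n; the sum
    over translates then reproduces the norm. *)
Lemma tight_frame f : L2 mu f ->
  (\esum_(k in [set: int * int]) (sqn (inner mu f (tfshift (lat k) window)))%:E =
   (nu0^-1 * sqf mu f)%:E)%E.
Proof.
move=> hf; have p0 : 0 < nu0^-1 by rewrite invr_gt0.
have E := @esum_esum R int int setT (fun=> setT)
  (fun m n => (sqn (inner mu f (tfshift (lat (m, n)) window)))%:E).
transitivity (\esum_(m in [set: int]) \esum_(n in [set: int])
    (sqn (inner mu f (tfshift (lat (m, n)) window)))%:E)%E.
  rewrite E; last by move=> m n _ _; rewrite lee_fin sqn_ge0.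
  rewrite (_ : [set: int] `*`` _ = [set: int * int]); last first.
    by apply/seteqP; split.
  by apply: eq_esum => -[].
transitivity (\esum_(m in [set: int]) (nu0^-1 * sqf (mrestr mu (tile m)) (slice f m))%:E)%E.
  apply: eq_esum => m _; rewrite -(fourier_parseval nu0_gt0 (L2_mrestr _ (L2_slice m hf))).
  by apply: eq_esum => n _; rewrite inner_slice.
rewrite esumZl ?ltW//; last by move=> m; exact: sqf_ge0.
rewrite EFinM -sqfE//; congr (_ * _)%E.
transitivity (\esum_(m in [set: int]) (\int[mu]_t (sqn (f t) * w (t - m%:~R * b0) ^+ 2)%:E)%E)%E.
  by apply: eq_esum => m _; rewrite -nsq_slice// sqfE//; exact: L2_mrestr (L2_slice m hf).
have mf := L2_cmeas hf.
rewrite -integral_esum//; last 2 first.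
- move=> m; apply/measurable_EFinP; apply: measurable_funM; first exact: measurable_sqn.
  by apply: measurable_funX; exact: mshift.
- by move=> m t; rewrite lee_fin mulr_ge0 ?sqn_ge0 ?sqr_ge0.
apply: eq_integral => t _.
have := sqn_ge0 (f t); rewrite le_eqVlt => /predU1P[<-|f0].
  by rewrite esum1// => m _; rewrite mul0r.
rewrite (esumZl (ltW f0)) ?w_sum ?mule1// => m; exact: sqr_ge0.
Qed.

Lemma window_gabor_frame : gabor_frame b0 nu0 window.
Proof.
split; first exact: L2_window.
exists nu0^-1, nu0^-1; split; first by rewrite invr_gt0.
move=> f hf; set S := (\esum_(k in _) _)%E.
have -> : S = (nu0^-1 * sqf mu f)%:E.
  by rewrite -tight_frame//; apply: eq_esum => k _; rewrite sqn_normc.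
by rewrite L2norm_sqr sqfE// -EFinM; split.
Qed.

(** In a tight frame the reconstruction F of f satisfies |F| <= |f| by
    [bessel_synthesis] and Re <F, f> = |f|^2 by [tight_frame], which forces F
    = f. *)
Lemma window_dual : dual_window b0 nu0 window (fun t => nu0%:C * window t).
Proof.
have hw := L2_window; have p0 : 0 < nu0^-1 by rewrite invr_gt0.
split; first exact: L2Z.
move=> f hf; pose u k := tfshift (lat k) window.
have hu k : L2 mu (u k) by exact: L2_tfshift.
pose c k := nu0%:C * inner mu f (u k).
have -> : (fun k t => inner mu f (tfshift (lat k) window) *
    tfshift (lat k) (fun s => nu0%:C * window s) t) = (fun k t => c k * u k t).
  apply/funext => k; apply/funext => t.
  by rewrite /c /u /tfshift /modulation /translation; ring.
have nuB f' (A : {fset int * int}) : L2 mu f' -> \sum_(k <- A) sqn (inner mu f' (u k)) <= nu0^-1 * sqf mu f'.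
  move=> hf'; rewrite -lee_fin -tight_frame//.
  by apply: (@fset_sum_le_esum _ _ (fun k => sqn (inner mu f' (u k)))) => k; exact: sqn_ge0.
have syn := bessel_synthesis hu (ltW p0) nuB.
have sc k : sqn (c k) = nu0 ^+ 2 * sqn (inner mu f (u k)) by rewrite sqnM sqnR.
have hc : ell2 c.
  rewrite /ell2 (_ : (\esum_(k in _) _)%E = (nu0 ^+ 2 * (nu0^-1 * sqf mu f))%:E) ?ltry//.
  rewrite EFinM -tight_frame// -esumZl ?sqr_ge0//; last by move=> k; exact: sqn_ge0.
  by apply: eq_esum => k _; rewrite sc.
have [F hF sF] : exists2 F, L2 mu F & L2_sum mu (fun k t => c k * u k t) F.
  apply: (L2_synthesis hu (ltW p0)) => // d A.
  by rewrite sqfE ?lee_fin ?syn//; apply: L2_bigsum => k; exact: L2Z.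
have hS A : L2 mu (fun t => \sum_(k <- A) c k * u k t) by apply: L2_bigsum => k; exact: L2Z.
have F_le : sqf mu F <= sqf mu f.
  rewrite -lee_fin -sqfE//; apply: nsq_le_approx => //; first exact: sqf_ge0.
  move=> e e0; have /L2_sumP /(_ e e0)[A hA] := sF.
  exists (fun t => \sum_(k <- A) c k * u k t); split => //; first exact: hA.
  rewrite sqfE// lee_fin (le_trans (syn _ _))//.
  under eq_bigr do rewrite sc.
  rewrite -mulr_sumr; apply: (@le_trans _ _ (nu0^-1 * (nu0 ^+ 2 * (nu0^-1 * sqf mu f)))).
    by rewrite ler_wpM2l ?(ltW p0)// ler_wpM2l ?sqr_ge0// nuB.
  by rewrite (_ : nu0^-1 * _ = sqf mu f)//; field; rewrite gt_eqF.
have Ff : sqf mu f <= complex.Re (inner mu F f).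
  apply/ler_addgt0Pr => e e0.
  have e2 : 0 < (e / 2) ^+ 2 by rewrite exprn_gt0// divr_gt0.
  have [A hA] := inner_L2_sum_lim hu hF hf sF e2.
  have [D hD] : exists D : {fset int * int}, forall B, (D `<=` B)%fset ->
      `|nu0^-1 * sqf mu f - \sum_(k <- B) sqn (inner mu f (u k))| < nu0^-1 * (e / 2).
    have := @esum_fset_lim R _ (fun k => sqn (inner mu f (u k))) (fun k => sqn_ge0 _).
    rewrite tight_frame// ltry => /(_ isT (nu0^-1 * (e / 2))); apply.
    by rewrite mulr_gt0// divr_gt0.
  have {}hA := hA _ (fsubsetUl A D); have {}hD := hD _ (fsubsetUr A D).
  move: (A `|` D)%fset hA hD => B hA hD {A D}.
  have ReM (x y : R) : complex.Re (x%:C * y%:C) = x * y by rewrite cReM /= mul0r subr0.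
  have near (x y z d : R) : `|x - z| < d / 2 -> `|y - z| <= d / 2 -> x <= y + d.
    by rewrite ltr_norml ler_norml => /andP[? ?] /andP[? ?]; lra.
  have S : complex.Re (\sum_(k <- B) c k * inner mu (u k) f) =
      nu0 * \sum_(k <- B) sqn (inner mu f (u k)).
    rewrite (raddf_sum (@complex.Re R)) mulr_sumr; apply: eq_bigr => k _.
    rewrite /c -(innerJ hf (hu k)) -mulrA mulJ_sqn; exact: ReM.
  have : `|complex.Re (inner mu F f) - nu0 * \sum_(k <- B) sqn (inner mu f (u k))| <= e / 2.
    rewrite -S -cReN -cReD -(@ler_pXn2r _ 2) ?nnegrE ?divr_ge0 ?(ltW e0)//.
    exact: le_trans (Re_sqn _) hA.
  have : `|sqf mu f - nu0 * \sum_(k <- B) sqn (inner mu f (u k))| < e / 2.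
    have -> : sqf mu f - nu0 * \sum_(k <- B) sqn (inner mu f (u k)) =
        nu0 * (nu0^-1 * sqf mu f - \sum_(k <- B) sqn (inner mu f (u k))).
      by rewrite mulrBr mulVKf ?gt_eqF.
    rewrite normrM gtr0_norm// -ltr_pdivlMl//.
  exact: near.
have FfE : nsq mu (fun t => (F t - f t)%R) = 0%E.
  rewrite (sqfE (L2B hF hf)); congr EFin; apply/eqP; rewrite eq_le sqf_ge0 andbT.
  by rewrite sqfB//; lra.
apply/L2_sumP => e e0; have /L2_sumP /(_ e e0)[A hA] := sF.
exists A => B /hA; congr (_ <= _)%E.
have := nsq_eq0 (L2_cmeas (L2B hF hf)) FfE => Ef.
apply: nsq_ae_eq; [by case: (L2B hF (hS B))|by case: (L2B hf (hS B))|].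
have ae_f := ae_filter_ringOfSetsType mu.
by apply: filterS Ef => t /eqP; rewrite subr_eq0 => /eqP ->.
Qed.

End TightFrame.

(** * Decay of the short-time Fourier transform of a smooth window *)

Section Calculus.
Context {R : realType}.
Local Notation mu := (mu1 R).
Implicit Types (f k p w : R -> R) (t x : R).

(** A function with two derivatives, the second one continuous; the
    derivatives are carried along because they enter the estimates. *)
Definition C2 f f1 f2 : Prop :=
  [/\ forall t, is_derive t 1 f (f1 t), forall t, is_derive t 1 f1 (f2 t) & continuous f2].

Lemma is_derive_continuous f f1 : (forall t, is_derive t 1 f (f1 t)) -> continuous f.
Proof.
move=> d t; apply: differentiable_continuous; apply/derivable1_diffP.
by case: (d t).
Qed.

Lemma C2_continuous f f1 f2 : C2 f f1 f2 -> [/\ continuous f, continuous f1 & continuous f2].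
Proof. by move=> [d1 d2 c]; split => //; exact: is_derive_continuous. Qed.

Lemma continuous_mul f g : continuous f -> continuous g -> continuous (fun t => f t * g t).
Proof. by move=> cf cg t; apply: continuousM; [exact: cf|exact: cg]. Qed.

Lemma continuous_add f g : continuous f -> continuous g -> continuous (fun t => f t + g t).
Proof. by move=> cf cg t; apply: continuousD; [exact: cf|exact: cg]. Qed.

Lemma continuous_scale (c : R) f : continuous f -> continuous (fun t => c * f t).
Proof. by apply: continuous_mul => t; exact: cst_continuous. Qed.

Lemma is_derive_mul f g (df dg t : R) : is_derive t 1 f df -> is_derive t 1 g dg ->
  is_derive t 1 (fun s => f s * g s) (df * g t + f t * dg).
Proof.
move=> hf hg; have := is_deriveM hf hg => h; apply: (is_derive_eq h).
by rewrite /GRing.scale/=; ring.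
Qed.

Lemma is_derive_affine f (df a b t : R) : is_derive (a * t + b) 1 f df ->
  is_derive t 1 (fun s => f (a * s + b)) (a * df).
Proof.
move=> hf; have hg : is_derive t 1 (fun s => a * s + b) a.
  have h := is_deriveD (is_deriveZ a (is_derive_id t 1)) (is_derive_cst b t 1).
  by apply: (is_derive_eq h); rewrite addr0 /GRing.scale/= mulr1.
by have h := @is_derive1_comp R f (fun s => a * s + b) t df a hf hg; apply: (is_derive_eq h); rewrite mulrC.
Qed.

Lemma C2M f f1 f2 g g1 g2 : C2 f f1 f2 -> C2 g g1 g2 ->
  C2 (fun t => f t * g t) (fun t => f1 t * g t + f t * g1 t)
     (fun t => (f2 t * g t + f1 t * g1 t) + (f1 t * g1 t + f t * g2 t)).
Proof.
move=> Cf Cg; have [cf cf1 cf2] := C2_continuous Cf; have [cg cg1 cg2] := C2_continuous Cg.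
case: Cf Cg => [df df1 _] [dg dg1 _]; split.
- by move=> t; exact: is_derive_mul.
- by move=> t; apply: is_deriveD; exact: is_derive_mul.
- by repeat first [apply: continuous_add | apply: continuous_mul].
Qed.

Lemma continuous_affine (a b : R) : continuous (fun t : R => a * t + b).
Proof.
move=> t; apply: continuousD; last exact: cst_continuous.
by apply: continuousM; [exact: cst_continuous|exact: cvg_id].
Qed.

Lemma C2_affine f f1 f2 (a b : R) : C2 f f1 f2 ->
  C2 (fun t => f (a * t + b)) (fun t => a * f1 (a * t + b)) (fun t => a * (a * f2 (a * t + b))).
Proof.
move=> [df df1 cf2]; split.
- by move=> t; exact: is_derive_affine.
- by move=> t; exact: (is_deriveZ a (is_derive_affine (df1 (a * t + b)))).
- apply: continuous_scale; apply: continuous_scale => t.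
  by apply: continuous_comp; [exact: continuous_affine|exact: cf2].
Qed.

Lemma C2_wave (a b : R) : C2 (fun t => cos (a * t + b)) (fun t => a * - sin (a * t + b))
  (fun t => a * (a * - cos (a * t + b))).
Proof.
apply: (@C2_affine (@cos R) (fun t => - sin t) (fun t => - cos t)); split.
- by move=> t; exact: is_derive_cos.
- by move=> t; have := is_deriveN (is_derive_sin t).
- by move=> t; apply: continuousN; exact: continuous_cos.
Qed.

Lemma integrable_continuous f (a b : R) : continuous f ->
  mu.-integrable (`[a, b]%classic : set (line R)) (EFin \o f).
Proof.
move=> cf; apply: continuous_compact_integrable; first exact: segment_compact.
exact: continuous_subspaceT.
Qed.

Lemma Rintegral_bound f (a b M : R) : a <= b -> continuous f ->
  (forall t, a <= t <= b -> `|f t| <= M) ->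
  `|\int[mu]_(t in `[a, b]) f t| <= M * (b - a).
Proof.
move=> ab cf hM.
have mI : measurable (`[a, b]%classic : set (line R)) by exact: measurable_itv.
apply: le_trans (le_normr_Rintegral mI (integrable_continuous a b cf)) _.
apply: (@le_trans _ _ (\int[mu]_(t in `[a, b]) M)).
  apply: le_Rintegral => //.
  - apply: integrable_continuous => t; apply: continuous_comp; first exact: cf.
    exact: norm_continuous.
  - by apply: integrable_continuous => t; exact: cst_continuous.
rewrite Rintegral_cst//= lebesgue_measure_itv/= lte_fin.
case: ltP => ab'; first by rewrite -EFinB /=.
by rewrite mulr0 mulr_ge0// ?subr_ge0//; apply: le_trans (hM a _); rewrite ?lexx.
Qed.

(** Integrating by parts twice against an oscillation, without boundary terms;
    k sin / v + k' cos / v^2 is an antiderivative of k cos + k'' cos / v^2. *)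
Lemma oscillatory_integral k k1 k2 (a b v s : R) : a < b -> C2 k k1 k2 -> v != 0 ->
  k a = 0 -> k b = 0 -> k1 a = 0 -> k1 b = 0 ->
  \int[mu]_(t in `[a, b]) (k t * cos (v * t + s)) =
  - (v ^- 2 * \int[mu]_(t in `[a, b]) (k2 t * cos (v * t + s))).
Proof.
move=> ab Ck v0 ka kb k1a k1b; have [ck ck1 ck2] := C2_continuous Ck.
have [dc ds _] := C2_wave v s; case: Ck => [dk dk1 _].
pose F t := v ^- 2 * (k1 t * cos (v * t + s) - k t * (v * - sin (v * t + s))).
pose f t := k t * cos (v * t + s) + v ^- 2 * (k2 t * cos (v * t + s)).
have ccos : continuous (fun t => cos (v * t + s)).
  by apply: is_derive_continuous => t; exact: dc.
have c1 : continuous (fun t => k t * cos (v * t + s)).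
  exact: continuous_mul.
have c2 : continuous (fun t => k2 t * cos (v * t + s)).
  exact: continuous_mul.
have c3 : continuous (fun t => v ^- 2 * (k2 t * cos (v * t + s))).
  exact: continuous_scale.
have cf : continuous f by exact: continuous_add.
have dF t : is_derive t 1 F (f t).
  have h := is_deriveZ (v ^- 2) (is_deriveB (is_derive_mul (dk1 t) (dc t)) (is_derive_mul (dk t) (ds t))).
  by apply: (is_derive_eq h); rewrite /f /GRing.scale /=; field.
have := continuous_FTC2 ab (continuous_subspaceT cf) (F := F).
have cF := is_derive_continuous dF.
have LR : derivable_oo_LRcontinuous F a b.
  split; first by move=> t _; case: (dF t).
    by apply: cvg_at_right_filter; exact: cF.
  by apply: cvg_at_left_filter; exact: cF.
move=> /(_ LR) FTC.
have {}FTC := FTC (fun t _ => _).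
have : \int[mu]_(t in `[a, b]) f t = 0.
  rewrite /Rintegral FTC; first by rewrite /F ka kb k1a k1b !mul0r !subr0 mulr0 -EFinB subrr.
  by move=> t; rewrite derive1E; case: (dF t).
have mI : measurable (`[a, b]%classic : set (line R)) by exact: measurable_itv.
rewrite /f RintegralD//; [|exact: integrable_continuous|exact: integrable_continuous].
rewrite RintegralZl//; last exact: integrable_continuous.
by move=> /eqP; rewrite addr_eq0 => /eqP.
Qed.

End Calculus.

Section Decay.
Context {R : realType}.
Local Notation mu := (mu1 R).
Implicit Types (f p : R -> R) (t b nu s : R).

Lemma schwartz_C2 p : real_schwartz p -> C2 p (derive1n 1 p) (derive1n 2 p).
Proof.
move=> [dp _].
have D n t : is_derive t 1 (derive1n n p) (derive1n n.+1 p t).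
  by rewrite derive1nS derive1E; exact/derivableP.
split; [exact: (D 0)|exact: (D 1)|].
by apply: is_derive_continuous => t; exact: (D 2).
Qed.

Lemma schwartz_decay p n : real_schwartz p -> exists2 C : R, 0 <= C &
  forall t, `|derive1n n p t| <= C / (1 + t ^+ 2).
Proof.
move=> [_ bp]; have [C0 h0] := bp 0%N n; have [C2 h2] := bp 2%N n.
have c0 : 0 <= C0 by apply: le_trans (h0 0).
have c2 : 0 <= C2 by apply: le_trans (h2 0).
exists (C0 + C2); first exact: addr_ge0.
move=> t; have t2 : 0 < 1 + t ^+ 2 by rewrite ltr_pwDl// sqr_ge0.
rewrite ler_pdivlMr// mulrDr mulr1 lerD//; first by have := h0 t; rewrite expr0 mul1r.
by have := h2 t; rewrite normrM normrX real_normK ?num_real// mulrC.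
Qed.

(** Shifting by a bounded amount changes the Cauchy weight by a bounded
    factor, since b^2 <= 2 (t - b)^2 + 2 t^2. *)
Lemma weight_shift (La t b : R) : `|t| <= La ->
  (1 + (t - b) ^+ 2)^-1 <= 2 * (1 + La ^+ 2) / (1 + b ^+ 2).
Proof.
move=> tL; have b1 : 0 < 1 + b ^+ 2 by rewrite ltr_pwDl// sqr_ge0.
have c1 : 0 < 1 + (t - b) ^+ 2 by rewrite ltr_pwDl// sqr_ge0.
rewrite -[leLHS]mul1r ler_pdivrMr// mulrAC ler_pdivlMr// mul1r.
have t2 : t ^+ 2 <= La ^+ 2.
  by rewrite -(ger0_norm (sqr_ge0 t)) normrX lerXn2r ?nnegrE// (le_trans _ tL).
have h : 0 <= La ^+ 2 * (t - b) ^+ 2 by rewrite mulr_ge0 ?sqr_ge0.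
have := sqr_ge0 (t - (b - t)); move: h t2.
rewrite !expr2; nra.
Qed.

Lemma continuous_bounded f (La : R) : 0 <= La -> continuous f ->
  exists2 M : R, 0 <= M & forall t, - La <= t <= La -> `|f t| <= M.
Proof.
move=> L0 cf; have LL : - La <= La by rewrite (le_trans _ L0)// oppr_le0.
have cn : continuous (fun t => `|f t|).
  by move=> t; apply: continuous_comp; [exact: cf|exact: norm_continuous].
have [c _ hc] := EVT_max LL (continuous_subspaceT cn).
by exists `|f c| => // t ht; apply: hc; rewrite in_itv.
Qed.

Variables (w w1 w2 : R -> R) (L : R).
Hypotheses (Cw : C2 w w1 w2) (L_gt0 : 0 < L).
Hypothesis w_supp : forall t, L <= `|t| -> w t = 0.
Local Notation La := (L + 1).

(** Together with the values of w this makes all boundary terms vanish at the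
    ends of [-(L + 1), L + 1]. *)
Lemma support_derivative t : L < `|t| -> w1 t = 0.
Proof.
move=> Lt; have [dw _ _] := Cw.
have := dw t; move=> [_ <-]; transitivity ('D_1 (cst (0 : R)) t); last exact: derive_cst.
apply: near_eq_derive.
have : \forall s \near t, L < `|s|.
  exact: (cvgr_gt _ (@norm_continuous R R t) _ Lt).
by apply: filterS => s /ltW /w_supp ->.
Qed.

(** The shifted Schwartz function contributes the decay in b. The trivial
    bound and the one obtained from [oscillatory_integral] combine to the
    decay in nu, also near nu = 0. *)
Lemma oscillatory_decay p : real_schwartz p -> exists2 K : R, 0 <= K &
  forall b nu s, `|\int[mu]_(t in `[- La, La]) (w t * p (t - b) * cos (2 * pi * nu * t + s))| <=
    K * ((1 + b ^+ 2)^-1 * (1 + nu ^+ 2)^-1).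
Proof.
move=> hp; have Cp := schwartz_C2 hp.
have [cw cw1 cw2] := C2_continuous Cw; have [cp cp1 cp2] := C2_continuous Cp.
have La0 : 0 < La by rewrite addr_gt0.
have [M0 M00 B0] := continuous_bounded (ltW La0) cw.
have [M1 M10 B1] := continuous_bounded (ltW La0) cw1.
have [M2 M20 B2] := continuous_bounded (ltW La0) cw2.
have [D0 D00 E0] := schwartz_decay 0 hp.
have [D1 D10 E1] := schwartz_decay 1 hp.
have [D2 D20 E2] := schwartz_decay 2 hp.
pose M := M0 + M1 + M2; pose D := D0 + D1 + D2.
pose Q := 2 * (1 + La ^+ 2).
have M_ge0 : 0 <= M by rewrite !addr_ge0.
have D_ge0 : 0 <= D by rewrite !addr_ge0.
have Q_ge0 : 0 <= Q by rewrite mulr_ge0// addr_ge0// sqr_ge0.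
pose K := 2 * (4 * (M * (D * Q)) * (2 * La)).
have L2_ge0 : 0 <= 2 * La by rewrite mulr_ge0// ltW.
exists K.
  apply: mulr_ge0 => //; apply: mulr_ge0 => //; apply: mulr_ge0 => //.
  exact: mulr_ge0 M_ge0 (mulr_ge0 D_ge0 Q_ge0).
move=> b nu s; set v := 2 * pi * nu.
pose c := (1 + b ^+ 2)^-1.
have c0 : 0 < c by rewrite invr_gt0 ltr_pwDl// sqr_ge0.
have W n Dn : 0 <= Dn -> Dn <= D -> (forall t, `|derive1n n p t| <= Dn / (1 + t ^+ 2)) ->
    forall t, - La <= t <= La -> `|derive1n n p (t - b)| <= D * Q * c.
  move=> Dn0 DnD En t ht; apply: le_trans (En _) _.
  rewrite -mulrA ler_pM// ?invr_ge0 ?addr_ge0 ?sqr_ge0//.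
  by apply: weight_shift; rewrite ler_norml.
have W0 := W 0%N D0 D00; have W1 := W 1%N D1 D10; have W2 := W 2%N D2 D20.
have {W0} W0 t : - La <= t <= La -> `|p (t - b)| <= D * Q * c.
  by apply: W0 => //; rewrite /D; lra.
have {W1} W1 t : - La <= t <= La -> `|derive1n 1 p (t - b)| <= D * Q * c.
  by apply: W1 => //; rewrite /D; lra.
have {W2 W} W2 t : - La <= t <= La -> `|derive1n 2 p (t - b)| <= D * Q * c.
  by apply: W2 => //; rewrite /D; lra.
have {}B0 t : - La <= t <= La -> `|w t| <= M by move/B0 => h; rewrite /M; lra.
have {}B1 t : - La <= t <= La -> `|w1 t| <= M by move/B1 => h; rewrite /M; lra.
have {}B2 t : - La <= t <= La -> `|w2 t| <= M by move/B2 => h; rewrite /M; lra.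
have Cs : C2 (fun t => p (t - b)) (fun t => derive1n 1 p (t - b)) (fun t => derive1n 2 p (t - b)).
  have := C2_affine 1 (- b) Cp.
  have E (q : R -> R) : (fun t => q (1 * t + - b)) = (fun t => q (t - b)).
    by apply/funext => t; rewrite mul1r.
  have E' (q : R -> R) : (fun t => 1 * q (1 * t + - b)) = (fun t => q (t - b)).
    by apply/funext => t; rewrite !mul1r.
  have E'' (q : R -> R) : (fun t => 1 * (1 * q (1 * t + - b))) = (fun t => q (t - b)).
    by apply/funext => t; rewrite !mul1r.
  by rewrite E E' E''.
have Ck := C2M Cw Cs; have [ck _ ck2] := C2_continuous Ck.
have ccos : continuous (fun t : R => cos (v * t + s)).
  by have [] := C2_continuous (C2_wave v s).
have LL : - La < La by rewrite gtrN.
have lenLa : La - - La = 2 * La by ring.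
have cosb t : `|cos (v * t + s)| <= 1 by rewrite ler_norml cos_geN1 cos_le1.
have Mc : 0 <= M * (D * Q * c).
  exact: mulr_ge0 M_ge0 (mulr_ge0 (mulr_ge0 D_ge0 Q_ge0) (ltW c0)).
have triv : `|\int[mu]_(t in `[- La, La]) (w t * p (t - b) * cos (v * t + s))| <=
    4 * (M * (D * Q * c)) * (2 * La).
  rewrite -lenLa; apply: Rintegral_bound; [exact: ltW|exact: continuous_mul|].
  move=> t ht; rewrite !normrM -[leRHS]mulr1 ler_pM ?mulr_ge0//.
  apply: (@le_trans _ _ (M * (D * Q * c))); last by lra.
  by rewrite ler_pM// ?W0 ?B0.
have small : `|\int[mu]_(t in `[- La, La]) (w t * p (t - b) * cos (v * t + s))| * v ^+ 2 <=
    4 * (M * (D * Q * c)) * (2 * La).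
  have [->|v0] := eqVneq v 0; first by rewrite expr0n mulr0; apply: mulr_ge0 => //; exact: mulr_ge0.
  have nLa : `|La| = La by rewrite gtr0_norm.
  rewrite (oscillatory_integral s LL Ck v0); last 4 first.
  - by rewrite w_supp ?mul0r// normrN nLa lerDl.
  - by rewrite w_supp ?mul0r// nLa lerDl.
  - by rewrite w_supp ?support_derivative ?mul0r ?addr0// normrN nLa ?lerDl ?ltrDl.
  - by rewrite w_supp ?support_derivative ?mul0r ?addr0// nLa ?lerDl ?ltrDl.
  rewrite normrN normrM normfV normrX real_normK ?num_real// mulrAC mulVf ?sqrf_eq0// mul1r.
  rewrite -lenLa; apply: Rintegral_bound; [exact: ltW|exact: continuous_mul|].
  move=> t ht; rewrite normrM -[leRHS]mulr1 ler_pM//.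
  have P (x y : R) : `|x| <= M -> `|y| <= D * Q * c -> `|x * y| <= M * (D * Q * c).
    by move=> hx hy; rewrite normrM ler_pM.
  have P1 := P _ _ (B2 t ht) (W0 t ht); have P2 := P _ _ (B1 t ht) (W1 t ht).
  have P3 := P _ _ (B0 t ht) (W2 t ht).
  apply: le_trans (ler_normD _ _) _; apply: le_trans (lerD (ler_normD _ _) (ler_normD _ _)) _.
  by move: P1 P2 P3; lra.
have n1 : 0 < 1 + nu ^+ 2 by rewrite ltr_pwDl// sqr_ge0.
rewrite mulrA ler_pdivlMr//.
have vnu : nu ^+ 2 <= v ^+ 2.
  rewrite /v exprMn ler_peMl ?sqr_ge0// -[leLHS](expr1n _ 2) lerXn2r ?nnegrE//.
    by rewrite mulr_ge0// pi_ge0.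
  by have := pi_ge2 R; lra.
rewrite mulrDr mulr1.
have I0 := normr_ge0 (\int[mu]_(t in `[- La, La]) (w t * p (t - b) * cos (v * t + s))).
have := ler_wpM2l I0 vnu.
rewrite /K -/c; move: triv small.
set I := `| _ |; move=> h1 h2 h3; nra.
Qed.

End Decay.

Section FeichtingerWindow.
Context {R : realType}.
Local Notation mu := (mu1 R).

Lemma cauchy_weight_measurable : measurable_fun setT (fun t : line R => (1 + t ^+ 2)^-1 : R).
Proof. by apply: continuous_measurable_fun; exact: (@continuous_oneDsqrV R). Qed.

Lemma cauchy_weight_ge0 (t : R) : 0 <= (1 + t ^+ 2)^-1.
Proof. by rewrite invr_ge0 addr_ge0// sqr_ge0. Qed.

Lemma integral_cauchy_weight : (\int[mu]_t ((1 + t ^+ 2)^-1)%:E < +oo)%E.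
Proof.
have mE : measurable_fun setT (fun t : line R => ((1 + t ^+ 2)^-1)%:E).
  by apply/measurable_EFinP; exact: cauchy_weight_measurable.
pose P : set (line R) := `[0, +oo[%classic.
have mP : measurable P by exact: measurable_itv.
have half : (\int[mu]_(t in P) ((1 + t ^+ 2)^-1)%:E < +oo)%E.
  by rewrite (integral0y_oneDsqr R) ltry.
pose h : line R -> \bar R := (fun t => ((1 + t ^+ 2)^-1)%:E) \_ P.
have h0 t : (0 <= h t)%E.
  by rewrite /h patchE; case: ifP => // _; rewrite lee_fin cauchy_weight_ge0.
have mh : measurable_fun setT h.
  by apply/(measurable_restrictT _ _).1 => //; exact: measurable_funTS.
have hE t : 0 <= t -> h t = ((1 + t ^+ 2)^-1)%:E.
  move=> t0; have Pt : P t by rewrite /P /= in_itv/= t0.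
  by rewrite /h patchE mem_set.
have mh' : measurable_fun setT (fun t : line R => h (0 - t)).
  by apply: (measurableT_comp mh); case: (reflect_preserving (0 : R)).
apply: (@le_lt_trans _ _ (\int[mu]_t (h t + h (0 - t)%R))%E).
  apply: ge0_le_integral => //.
  - by move=> t _; rewrite lee_fin cauchy_weight_ge0.
  - exact: emeasurable_funD.
  move=> t _; case: (leP 0 t) => t0; first by rewrite -hE// leeDl.
  have -> : ((1 + t ^+ 2)^-1)%:E = h (0 - t)%R.
    by rewrite hE sub0r ?sqrrN// oppr_ge0 ltW.
  by rewrite leeDr.
rewrite ge0_integralD// (reflect_preserving (0 : R)).2// -integral_mkcond.
exact: lte_add_pinfty.
Qed.

Lemma normc_nonneg (z : R[i]) : 0 <= normc z.
Proof. by case: z => a b; exact: sqrtr_ge0. Qed.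

Lemma normc_powR (z : R[i]) : normc z = sqn z `^ 2^-1.
Proof.
rewrite -sqn_normc -powR_mulrn ?normc_nonneg// -powRrM mulfV// powRr1//.
exact: normc_nonneg.
Qed.

Lemma normc_le (z : R[i]) : normc z <= `|complex.Re z| + `|complex.Im z|.
Proof.
rewrite -(@ler_pXn2r _ 2) ?nnegrE ?addr_ge0//; last exact: normc_nonneg.
rewrite sqn_normc /sqn sqrrD !real_normK ?num_real//.
by rewrite lerD2r lerDl mulrn_wge0// mulr_ge0.
Qed.

Variables (w w1 w2 : R -> R) (L : R).
Hypotheses (Cw : C2 w w1 w2) (L_gt0 : 0 < L).
Hypothesis w_supp : forall t, L <= `|t| -> w t = 0.
Local Notation La := (L + 1).
Local Notation J p s x := (\int[mu]_(t in `[- La, La]) (w t * p (t - x.1) * cos (2 * pi * x.2 * t + s))).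

(** The real and imaginary parts of a product of phi and an exponential are
    cosine integrals, a sine being a cosine with the phase shifted by - pi /
    2. *)
Lemma STFT_real_window (phi : line R -> R[i]) (x : plane R) : schwartz phi ->
  let r t := complex.Re (phi t) in let q t := complex.Im (phi t) in
  STFT phi (window w) x = (J r 0 x - J q (- (pi / 2)) x) +i* (- (J q 0 x + J r (- (pi / 2)) x)).
Proof.
move=> [hr hq] r q.
have [cw _ _] := C2_continuous Cw.
have [cr _ _] := C2_continuous (schwartz_C2 hr); have [cq _ _] := C2_continuous (schwartz_C2 hq).
have cs (p : R -> R) : continuous p -> continuous (fun t => p (t - x.1)).
  move=> cp t; apply: (@continuous_comp _ _ _ (fun t => t - x.1) p); last exact: cp.
  by apply: continuousB; [exact: cvg_id|exact: cst_continuous].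
have cc (s : R) : continuous (fun t : R => cos (2 * pi * x.2 * t + s)).
  by have [] := C2_continuous (C2_wave (2 * pi * x.2) s).
have cJ (p : R -> R) s : continuous p -> continuous (fun t => w t * p (t - x.1) * cos (2 * pi * x.2 * t + s)).
  by move=> cp; apply: continuous_mul => //; apply: continuous_mul => //; exact: cs.
have mI : measurable (`[- La, La]%classic : set (line R)) by exact: measurable_itv.
have out (t : line R) : t \notin (`[- La, La]%classic : set (line R)) -> w t = 0.
  move=> ht; apply: w_supp; rewrite leNgt; apply/negP => h; move/negP: ht; apply.
  by rewrite inE /= in_itv/= -ler_norml (le_trans (ltW h))// lerDl.
have rest (F : line R -> R) : (forall t, w t = 0 -> F t = 0) ->
    \int[mu]_t F t = \int[mu]_(t in `[- La, La]) F t.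
  move=> hF; rewrite [RHS]Rintegral_mkcond; congr Rintegral; apply/funext => t.
  by rewrite patchE; case: ifPn => // /out /hF.
have sinE (y : R) : sin y = cos (y + - (pi / 2)).
  by rewrite cosD cosN sinN cos_pihalf sin_pihalf; ring.
have argE (t : R) : 2 * pi * (x.2 * t) = 2 * pi * x.2 * t by ring.
apply: complex_ext => /=.
  rewrite rest; last by move=> t wt; rewrite /window wt mul0r.
  rewrite -RintegralB//; [|exact/integrable_continuous/cJ|exact/integrable_continuous/cJ].
  apply: eq_Rintegral => t _; rewrite /tfshift /modulation /translation /window /cexp2pi.
  by rewrite !(cReM, cReJ, cImJ, cImM) /= argE sinE addr0; ring.
rewrite rest; last by move=> t wt; rewrite /window wt mul0r.
rewrite -RintegralD//; [|exact/integrable_continuous/cJ|exact/integrable_continuous/cJ].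
rewrite -[RHS]mulN1r -RintegralZl//; last first.
  by apply: integrable_continuous; apply: continuous_add; exact: cJ.
apply: eq_Rintegral => t _; rewrite /tfshift /modulation /translation /window /cexp2pi.
by rewrite !(cImM, cReM, cReJ, cImJ) /= argE sinE addr0; ring.
Qed.

(** The decay in both variables makes the transform integrable. *)
Lemma window_STFT_integrable (phi : line R -> R[i]) : schwartz phi -> cmeasurable phi ->
  cmeasurable (window w) ->
  (cLnorm (mu2 R) 1 (STFT phi (window w)) < +oo)%E.
Proof.
move=> hphi mphi mw; have [hr hq] := hphi.
have [K1 K10 B1] := oscillatory_decay Cw L_gt0 w_supp hr.
have [K2 K20 B2] := oscillatory_decay Cw L_gt0 w_supp hq.
pose c (t : R) := (1 + t ^+ 2)^-1.
have c0 t : 0 <= c t by exact: cauchy_weight_ge0.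
pose K := 2 * K1 + 2 * K2; have K0 : 0 <= K by rewrite addr_ge0// mulr_ge0.
have bnd x : normc (STFT phi (window w) x) <= K * (c x.1 * c x.2).
  rewrite (STFT_real_window x hphi); apply: le_trans (normc_le _) _; rewrite /=.
  have /= b1 := B1 x.1 x.2 0; have /= b2 := B1 x.1 x.2 (- (pi / 2)).
  have /= b3 := B2 x.1 x.2 0; have /= b4 := B2 x.1 x.2 (- (pi / 2)).
  apply: le_trans (lerD (ler_normB _ _) _) _; first by rewrite normrN; exact: ler_normD.
  apply: le_trans (lerD (lerD b1 b4) (lerD b3 b2)) _.
  by rewrite /K -/(c x.1) -/(c x.2); lra.
have mc : measurable_fun setT (fun t : line R => c t) by exact: cauchy_weight_measurable.
have mV : cmeasurable (STFT phi (window w)) by exact: cmeasurable_STFT.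
have mF : measurable_fun setT (fun x : plane R => (K * (c x.1 * c x.2))%:E).
  apply/measurable_EFinP; apply: measurable_funM; first exact: measurable_cst.
  apply: measurable_funM; first by apply: (measurableT_comp mc); exact: measurable_fst.
  by apply: (measurableT_comp mc); exact: measurable_snd.
have mN : measurable_fun setT (fun x : plane R => `|(EFin \o (@normc R \o STFT phi (window w))) x|%E).
  apply: measurableT_comp => //; apply/measurable_EFinP.
  rewrite (_ : _ \o _ = fun x => sqn (STFT phi (window w) x) `^ 2^-1).
    by apply: (measurableT_comp (measurable_powR _)); exact: measurable_sqn.
  by apply/funext => x; exact: normc_powR.
rewrite /cLnorm Lnorm1; apply: (@le_lt_trans _ _ (\int[mu2 R]_x (K * (c x.1 * c x.2))%:E)%E).
  apply: ge0_le_integral => //.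
  move=> x _ /=; rewrite lee_fin ger0_norm ?normc_nonneg//; exact: bnd.
have -> : (\int[mu2 R]_x (K * (c x.1 * c x.2))%:E =
    \int[mu]_y \int[mu]_t (K * (c y * c t))%:E)%E.
  apply: (fubini_tonelli1 (fun z : plane R => (K * (c z.1 * c z.2))%:E)) => // z.
  by rewrite lee_fin mulr_ge0// mulr_ge0.
have ce : measurable_fun setT (fun t : line R => (c t)%:E) by exact/measurable_EFinP.
pose I := fine (\int[mu]_t (c t)%:E)%E.
have I0 : (0 <= \int[mu]_t (c t)%:E)%E by apply: integral_ge0 => t _; rewrite lee_fin.
have IE : (\int[mu]_t (c t)%:E = I%:E)%E.
  by rewrite /I fineK// ge0_fin_numE//; exact: integral_cauchy_weight.
have -> : (\int[mu]_y \int[mu]_t (K * (c y * c t))%:E =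
    \int[mu]_y ((K * I)%:E * (c y)%:E))%E.
  apply: eq_integral => y _.
  transitivity (\int[mu]_t ((K * c y)%:E * (c t)%:E))%E.
    by apply: eq_integral => t _; rewrite -EFinM mulrA.
  rewrite ge0_integralZl//; last 2 first.
  - by move=> t _; rewrite lee_fin.
  - by rewrite lee_fin mulr_ge0.
  by rewrite IE -!EFinM mulrAC.
rewrite ge0_integralZl//; last 2 first.
- by move=> t _; rewrite lee_fin.
- by rewrite lee_fin mulr_ge0// fine_ge0.
by rewrite IE -EFinM ltry.
Qed.

End FeichtingerWindow.

(** * A smooth tight window *)

Section SmoothWindow.
Context {R : realType}.
Local Notation mu := (mu1 R).
Implicit Types (f g : R -> R) (t : R).

Definition twice_smooth f : Prop := exists f1 f2, C2 f f1 f2.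

Lemma twice_smoothM f g : twice_smooth f -> twice_smooth g -> twice_smooth (fun t => f t * g t).
Proof. by move=> [f1 [f2 Cf]] [g1 [g2 Cg]]; do 2 eexists; exact: C2M Cf Cg. Qed.

Lemma twice_smoothD f g : twice_smooth f -> twice_smooth g -> twice_smooth (fun t => f t + g t).
Proof.
move=> [f1 [f2 [df df1 cf2]]] [g1 [g2 [dg dg1 cg2]]].
exists (fun t => f1 t + g1 t), (fun t => f2 t + g2 t); split.
- by move=> t; exact: is_deriveD.
- by move=> t; exact: is_deriveD.
- exact: continuous_add.
Qed.

Lemma twice_smooth_affine f (a b : R) : twice_smooth f -> twice_smooth (fun t => f (a * t + b)).
Proof. by move=> [f1 [f2 Cf]]; do 2 eexists; exact: C2_affine Cf. Qed.

Lemma twice_smooth_cst (c : R) : twice_smooth (fun=> c).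
Proof.
exists (fun=> 0), (fun=> 0); split.
- by move=> t; exact: is_derive_cst.
- by move=> t; exact: is_derive_cst.
- by move=> t; exact: cst_continuous.
Qed.

Lemma twice_smoothZ (c : R) f : twice_smooth f -> twice_smooth (fun t => c * f t).
Proof. exact: twice_smoothM (twice_smooth_cst c). Qed.

Lemma twice_smooth_sin f : twice_smooth f -> twice_smooth (fun t => sin (f t)).
Proof.
move=> [f1 [f2 Cf]]; have [cf cf1 cf2] := C2_continuous Cf; have [df df1 _] := Cf.
have ds t : is_derive t 1 (fun s => sin (f s)) (f1 t * cos (f t)).
  have h := @is_derive1_comp R (@sin R) f t _ _ (is_derive_sin (f t)) (df t).
  by apply: (is_derive_eq h); rewrite mulrC.
have dc t : is_derive t 1 (fun s => cos (f s)) (- (f1 t * sin (f t))).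
  have h := @is_derive1_comp R (@cos R) f t _ _ (is_derive_cos (f t)) (df t).
  by apply: (is_derive_eq h); rewrite mulNr mulrC.
exists (fun t => f1 t * cos (f t)), (fun t => f2 t * cos (f t) + f1 t * (- (f1 t * sin (f t)))); split => //.
- by move=> t; exact: is_derive_mul.
have cs : continuous (fun t => sin (f t)) by exact: is_derive_continuous ds.
have cc : continuous (fun t => cos (f t)) by exact: is_derive_continuous dc.
apply: continuous_add; first exact: continuous_mul.
rewrite (_ : (fun t => _) = (fun t => -1 * (f1 t * (f1 t * sin (f t))))).
  by apply: continuous_scale; do 2 apply: continuous_mul => //.
by apply/funext => t; ring.
Qed.

Definition pos3 t : R := Num.max 0 t ^+ 3.

Lemma continuous_pos : continuous (fun t : R => Num.max 0 t).
Proof.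
rewrite (_ : (fun t => _) = (fun t => 2^-1 * (t + `|t|))).
  apply: continuous_scale; apply: continuous_add => t; first exact: cvg_id.
  exact: norm_continuous.
apply/funext => t; case: (leP 0 t) => t0; first by rewrite ger0_norm//; lra.
by rewrite ltr0_norm//; lra.
Qed.

(** At the origin the difference quotient is the next lower power of the
    positive part, which is continuous. *)
Lemma is_derive_pos_power n t :
  is_derive t 1 (fun s : R => Num.max 0 s ^+ n.+2) (n.+2%:R * Num.max 0 t ^+ n.+1).
Proof.
have [t0|t0|->] := ltgtP t 0.
- rewrite expr0n mulr0.
  have h := is_derive_cst (0 : R) t 1; apply: near_eq_is_derive h.
  have : \forall s \near t, s < 0 by exact: lt_nbhsl.
  by apply: filterS => s s0; rewrite max_l ?(ltW s0)// expr0n.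
- apply: (@near_eq_is_derive R R R (fun s => s ^+ n.+2)).
    have : \forall s \near t, 0 < s by exact: lt_nbhsr.
    by apply: filterS => s s0; rewrite max_r ?(ltW s0).
  have h := is_deriveX n.+2 (is_derive_id t (1 : R)); rewrite exprfctE in h.
  by apply: (is_derive_eq h); rewrite /GRing.scale /= mulr1.
rewrite expr0n mulr0.
have cv : h^-1 *: (((fun s : R => Num.max 0 s ^+ n.+2) \o shift 0) (h *: (1 : R)) - Num.max 0 (0 : R) ^+ n.+2) @[h --> 0^'] --> (0 : R).
  have cn m : continuous (fun s : R => Num.max 0 s ^+ m).
    elim: m => [|m IH]; first by move=> s; exact: cst_continuous.
    by under eq_fun do rewrite exprS; apply: continuous_mul => //; exact: continuous_pos.
  have := cn n.+1 0; rewrite /continuous_at maxxx expr0n /= => c0.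
  have {}c0 : Num.max 0 s ^+ n.+1 @[s --> (0 : R)^'] --> (0 : R).
    by apply: cvg_trans c0; apply: cvg_app; exact: cvg_within.
  apply: cvg_trans c0; apply: near_eq_cvg.
  near=> s; have s0 : s != 0 by near: s; exact: nbhs_dnbhs_neq.
  rewrite /= addr0 /GRing.scale /= mulr1 expr0n subr0 exprS.
  case: (leP 0 s) => hs; first by rewrite -exprS [s ^+ n.+2]exprS mulKf.
  by rewrite mul0r expr0n mulr0.
apply: DeriveDef; first by apply/cvg_ex; exists 0.
exact: cvg_lim cv.
Unshelve. all: by end_near. Qed.

Lemma twice_smooth_pos3 : twice_smooth pos3.
Proof.
exists (fun t => 3 * Num.max 0 t ^+ 2), (fun t => 3 * (2 * Num.max 0 t ^+ 1)); split.
- by move=> t; exact: is_derive_pos_power.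
- by move=> t; exact: (is_deriveZ 3 (is_derive_pos_power 0 t)).
- apply: continuous_scale; apply: continuous_scale => t; exact: continuous_pos.
Qed.

(** The third difference of a truncated cube: a spline rising from 0 to 1. *)
Definition smooth_step t : R :=
  (pos3 t - 3 * pos3 (t - 1) + 3 * pos3 (t - 2) - pos3 (t - 3)) / 6.

Lemma smooth_step0 t : t <= 0 -> smooth_step t = 0.
Proof.
move=> t0; have E s : s <= 0 -> pos3 s = 0 by move=> s0; rewrite /pos3 max_l// expr0n.
rewrite /smooth_step !E ?mulr0 ?subr0 ?addr0 ?mul0r//; lra.
Qed.

Lemma smooth_step1 t : 3 <= t -> smooth_step t = 1.
Proof.
move=> t3; have E s : 0 <= s -> pos3 s = s ^+ 3 by move=> s0; rewrite /pos3 max_r.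
by rewrite /smooth_step !E; try lra; field.
Qed.

Lemma twice_smooth_step : twice_smooth smooth_step.
Proof.
have P c : twice_smooth (fun t => pos3 (t - c)).
  have := twice_smooth_affine 1 (- c) twice_smooth_pos3; congr twice_smooth.
  by apply/funext => t; rewrite mul1r.
have -> : smooth_step = fun t => 6^-1 * (pos3 (t - 0) + (-3 * pos3 (t - 1) + (3 * pos3 (t - 2) + (-1 * pos3 (t - 3))))).
  by apply/funext => t; rewrite /smooth_step subr0; field.
apply: twice_smoothZ; apply: twice_smoothD => //; apply: twice_smoothD.
  exact: twice_smoothZ.
by apply: twice_smoothD; exact: twice_smoothZ.
Qed.

Lemma esum_support (I : choiceType) (a : I -> R) (A : {fset I}) : (forall i, 0 <= a i) ->
  (forall i, i \notin A -> a i = 0) ->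
  (\esum_(i in [set: I]) (a i)%:E = (\sum_(i <- A) a i)%:E)%E.
Proof.
move=> a0 aA; apply/eqP; rewrite eq_le fset_sum_le_esum// andbT.
apply: esum_le_fset => // B; rewrite lee_fin.
have -> : \sum_(i <- A) a i = \sum_(i <- (A `|` B)%fset) a i.
  by apply: big_fset_incl; [exact: fsubsetUl|move=> i _ /aA].
by apply: fset_sum_le => //; exact: fsubsetUr.
Qed.

Variables (b0 d : R).
Hypotheses (d_gt0 : 0 < d) (d_le : d <= b0).

Local Notation step t := (smooth_step (3 / d * t)).

Definition tight_window t : R := sin (pi / 2 * step t) * sin (pi / 2 - pi / 2 * step (t - b0)).

Lemma step_low t : t <= 0 -> step t = 0.
Proof. by move=> t0; rewrite smooth_step0// pmulr_rle0// divr_gt0. Qed.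

Lemma step_high t : d <= t -> step t = 1.
Proof. by move=> t0; rewrite smooth_step1// mulrAC ler_pdivlMr// ler_pM2l. Qed.

Lemma tight_window_low t : t <= 0 -> tight_window t = 0.
Proof. by move=> t0; rewrite /tight_window step_low// mulr0 sin0 mul0r. Qed.

Lemma tight_window_high t : b0 + d <= t -> tight_window t = 0.
Proof.
by move=> tb; rewrite /tight_window (@step_high (t - b0)) ?mulr1 ?subrr ?sin0 ?mulr0//; lra.
Qed.

Lemma twice_smooth_window : twice_smooth tight_window.
Proof.
have S c : twice_smooth (fun t => step (t - c)).
  have := twice_smooth_affine (3 / d) (- (3 / d * c)) twice_smooth_step; congr twice_smooth.
  by apply/funext => t; rewrite mulrBr.
apply: twice_smoothM; apply: twice_smooth_sin.
  have := S 0; move=> /(twice_smoothZ (pi / 2)); congr twice_smooth.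
  by apply/funext => t; rewrite subr0.
have := twice_smoothD (twice_smooth_cst (pi / 2)) (twice_smoothZ (- (pi / 2)) (S b0)).
by congr twice_smooth; apply/funext => t; rewrite mulNr.
Qed.

(** Only two translates meet a given point, and their squares are the squares
    of the sine and the cosine of one angle. *)
Lemma tight_window_sum t :
  (\esum_(m in [set: int]) (tight_window (t - m%:~R * b0) ^+ 2)%:E = 1)%E.
Proof.
have b0_gt0 : 0 < b0 by exact: lt_le_trans d_le.
have [k /andP[h1 h2] _] := tile_uniq 0 t b0_gt0; rewrite !add0r in h1 h2.
rewrite (@esum_support _ (fun m => tight_window (t - m%:~R * b0) ^+ 2) [fset k; k - 1]%fset); last 2 first.
- by move=> m; exact: sqr_ge0.
- move=> m; rewrite !inE negb_or => /andP[m1 m2].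
  suff -> : tight_window (t - m%:~R * b0) = 0 by rewrite expr0n.
  have [mk|mk|mk] := ltgtP m k; last by rewrite mk eqxx in m1.
    have mk2 : m <= k - 2 by move: mk m1 m2; lia.
    apply: tight_window_high.
    have : m%:~R <= (k - 2)%:~R :> R by rewrite ler_int.
    rewrite intrB -(ler_pM2r b0_gt0) mulrBl (_ : 2%:~R = 2 :> R)// => h.
    by apply: (@le_trans _ _ (b0 + b0)); [rewrite lerD2l|lra].
  apply: tight_window_low.
  have : (k + 1)%:~R <= m%:~R :> R by rewrite ler_int; lia.
  by rewrite intrD -(ler_pM2r b0_gt0) => h; move: h; rewrite mulrDl; lra.
rewrite big_fsetU1 ?big_seq_fset1 /=; last by rewrite inE; lia.
set s := t - k%:~R * b0.
have s0 : 0 <= s by rewrite /s; lra.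
have s1 : s < b0 by rewrite /s; lra.
have -> : t - (k - 1)%:~R * b0 = s + b0 by rewrite intrB /s; ring.
rewrite /tight_window (@step_low (s - b0)); last by lra.
rewrite (@step_high (s + b0)); last by rewrite (le_trans d_le)// lerDr.
rewrite addrK mulr0 subr0 !mulr1 !sin_pihalf mulr1 mul1r.
have -> : sin (pi / 2 - pi / 2 * step s) = cos (pi / 2 * step s).
  by rewrite sinB cos_pihalf sin_pihalf; ring.
by rewrite addrC cos2Dsin2.
Qed.

End SmoothWindow.

(** * Frames above the critical density and best approximation *)

(** The transition length d is chosen so that two neighbouring transitions do
    not overlap (d <= b0) and the window fits in one period of the
    frequencies (b0 + d <= 1 / nu0). *)
Lemma gabor_frame_exists (R : realType) (phi : line R -> R[i]) (b0 nu0 : R) :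
  schwartz phi -> 0 < b0 -> 0 < nu0 -> b0 * nu0 < 1 ->
  exists g h : line R -> R[i],
    [/\ gabor_frame b0 nu0 g, dual_window b0 nu0 g h, S0 phi g & S0 phi h].
Proof.
move=> hphi b0_gt0 nu0_gt0 hb; have p0 : 0 < nu0^-1 by rewrite invr_gt0.
have bp : b0 < nu0^-1 by rewrite -(ltr_pM2r nu0_gt0) mulVf ?gt_eqF.
pose d := Num.min b0 (nu0^-1 - b0).
have d0 : 0 < d by rewrite lt_min b0_gt0 subr_gt0.
have db : d <= b0 by rewrite ge_min lexx.
have dp : b0 + d <= nu0^-1.
  have : d <= nu0^-1 - b0 by rewrite ge_min lexx orbT.
  by lra.
pose w := tight_window b0 d.
have [w1 [w2 Cw]] := twice_smooth_window b0 d.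
have [cw _ _] := C2_continuous Cw.
have mw : measurable_fun (setT : set (line R)) w by exact: continuous_measurable_fun.
have w_supp (t : R) : ~ (0 <= t < nu0^-1) -> w t = 0.
  move=> ht; case: (leP t 0) => t0; first exact: tight_window_low.
  apply: (tight_window_high d0); apply: le_trans dp _.
  by rewrite leNgt; apply/negP => h; apply: ht; rewrite ltW.
have w_far (t : R) : nu0^-1 <= `|t| -> w t = 0.
  move=> ht; apply: w_supp => /andP[t0 t1]; move: ht.
  by rewrite ger0_norm// leNgt t1.
have mphi : cmeasurable phi.
  have [hr hq] := hphi; split.
    by apply: continuous_measurable_fun; have [] := C2_continuous (schwartz_C2 hr).
  by apply: continuous_measurable_fun; have [] := C2_continuous (schwartz_C2 hq).
have w_sum := tight_window_sum d0 db.
have hd := window_dual nu0_gt0 mw w_supp w_sum.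
have hL := L2_window nu0_gt0 mw w_supp w_sum.
have S0w (v v1 v2 : R -> R) : C2 v v1 v2 -> (forall t : R, nu0^-1 <= `|t| -> v t = 0) ->
    L2 (mu1 R) (window v) -> S0 phi (window v).
  move=> Cv v_far Lv; split => //.
  by apply: (window_STFT_integrable Cv p0 v_far hphi mphi); case: Lv.
exists (window w), (fun t => nu0%:C * window w t); split => //.
- exact: (window_gabor_frame nu0_gt0 mw w_supp w_sum).
- exact: (S0w _ _ _ Cw).
have hE : (fun t => nu0%:C * window w t) = window (fun t => nu0 * w t).
  by apply/funext => t; rewrite /window; apply: complex_ext => /=; ring.
have [v1 [v2 Cv]] := twice_smoothZ nu0 (twice_smooth_window b0 d).
rewrite hE; apply: (S0w _ _ _ Cv); first by move=> t /w_far; rewrite /w => ->; rewrite mulr0.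
by rewrite -hE; exact: L2Z.
Qed.

Local Open Scope complex_scope.

Theorem corollary2 (R : realType)
  (phi : line R -> R[i]) (phi_schwartz : schwartz phi)
  (phi_neq0 : exists t, phi t != 0)
  (t0 xi0 : R) (t0_ge0 : 0 <= t0) (xi0_ge0 : 0 <= xi0)
  (H : @operator R) (kappaH etaH : plane R -> R[i])
  (HkappaH : HS_kernel H kappaH)
  (HetaH : spreading_function kappaH etaH)
  (supp_etaH : {ae mu2 R, forall x,
     ~ (`[- t0, t0] `*` `[- xi0, xi0]) x -> etaH x = 0})
  (underspread : t0 * xi0 < 1 / 4) :
  (* (a) *)
  (forall b0 nu0 : R, 0 < b0 -> 0 < nu0 ->
     1 / b0 > 2 * xi0 -> 1 / nu0 > 2 * t0 -> b0 * nu0 < 1 ->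
     exists g h : line R -> R[i],
       [/\ gabor_frame b0 nu0 g, dual_window b0 nu0 g h, S0 phi g & S0 phi h])
  /\
  (* (b) *)
  (forall (b0 nu0 : R) (g h : line R -> R[i]), 0 < b0 -> 0 < nu0 ->
     1 / b0 > 2 * xi0 -> 1 / nu0 > 2 * t0 ->
     gabor_frame b0 nu0 g -> dual_window b0 nu0 g h -> S0 phi g -> S0 phi h ->
     forall A B : R, 0 < A -> A <= B ->
     {ae mu2 R, forall x, period_box b0 nu0 x ->
        (A%:E <= Ufun b0 nu0 g h x <= B%:E)%E} ->
     (exists! m : int * int -> R[i], best_gabor_multiplier b0 nu0 g h H m) /\
     forall m, best_gabor_multiplier b0 nu0 g h H m ->
       (exists M, symplectic_FT b0 nu0 m M) /\
       forall M, symplectic_FT b0 nu0 m M ->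
         [/\ {ae mu2 R, forall x, centered_box b0 nu0 x ->
                M x = etaH x * (STFT g h x)^* / (fine (Ufun b0 nu0 g h x))%:C},
             (L2norm (mu2 R) (fun x => (etaH x - M x * STFT g h x)%R) ^+ 2 <=
              L2norm (mu2 R) etaH ^+ 2 *
              ess_sup (mrestr (mu2 R) (measurable_period_box b0 nu0))
                (defect b0 nu0 g h))%E
           & (L2norm (mu2 R) (fun x => (etaH x - M x * STFT g h x)%R) ^+ 2 <=
              L2norm (mu2 R) etaH ^+ 2 *
              ess_sup (mrestr (mu2 R) (measurable_centered_box b0 nu0))
                (defect b0 nu0 g h))%E]).
Proof.
split.
  by move=> b0 nu0 b0_gt0 nu0_gt0 _ _ hb; exact: (gabor_frame_exists phi_schwartz).
move=> b0 nu0 g h b0_gt0 nu0_gt0 hxi ht [hg _] hd _ _ A B A0 AB Ubnd.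
exact: (best_approximation t0_ge0 xi0_ge0 HkappaH HetaH supp_etaH b0_gt0 nu0_gt0 hxi ht hg hd A0 AB Ubnd).
Qed.
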